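(* Let $\xi=(\xi_n)_{n\in\mathbb Z_+}$, $\xi_n=(X_n,\eta_n)$, be the time-homogeneous Markov process on the half-strip $\Sigma=\mathbb R_+\times S$ described in the context, with kernel $\mathcal K_s$. Suppose the following. (1) (Non-confinement) $\Pr(\limsup_{n\to\infty}X_n=\infty)=1$. (2) (Limiting kernel) $\mathcal K:S\times\mathcal B(S)\to[0,1]$ is a Markov kernel on $S$ that has a unique invariant probability measure $\pi\in\mathcal P(S)$, and $u\mapsto\mathcal K(u,\cdot)$ is continuous from $(S,d_S)$ to $(\mathcal P(S),d_{\mathrm{TV}})$. (3) (Strong asymptotic Markovianity) There is a continuous map $\Gamma:(S,d_S)\to(\mathcal M_\pm(S),d_{\mathrm{TV}})$, $u\mapsto\Gamma_u$, such that $\sup_{u\in S}\|\mathcal K_s^\circ(x,u,\cdot)-\mathcal K(u,\cdot)-x^{-1}\Gamma_u\|_{\mathrm{TV}}=o(x^{-1})$ as $x\to\infty$. (4) (Moments) There are constants $p>2$, $q\ge2$, $x_B\in\mathbb R_+$ and $B_p,B_q<\infty$ such that, for all $n\in\mathbb Z_+$, $\mathbb E[|X_{n+1}-X_n|^p\mid\mathcal F_n]\le B_p$ on $\{X_n\ge x_B\}$ and $\mathbb E[|X_{n+1}|^q\mid\mathcal F_n]\le B_q$ on $\{X_n<x_B\}$. (5) (Lamperti regime) There are $d,e,\sigma^2\in C_b(S)$ (values at $u$ written $d_u,e_u,\sigma_u^2$) such that, as $x\to\infty$, $\sup_{u\in S}|\mu_1(x,u)-(d_u+\frac{e_u}{x})|=o(x^{-1})$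 and $\sup_{u\in S}|\mu_2(x,u)-\sigma_u^2|=o(1)$; moreover $\int_Sd_u\,\pi(du)=0$. (6) (Conditional drifts) There are $\lambda_u\in M_b(S)$, $u\in S$, such that $u\mapsto\lambda_u$ is continuous from $(S,d_S)$ to $(M_b(S),d_\infty)$ and $\lim_{x\to\infty}\sup_{u,v\in S}|\mu_1^\circ(x,u,v)-\lambda_u(v)|=0$. Let $\psi\in C_b(S)$ be a function (it exists and is unique up to additive constants) with $\int_S(\psi(u)-\psi(v))\,\mathcal K(u,dv)=d_u$ for all $u\in S$, and for $\theta\in\mathbb R$ define (independently of the choice of $\psi$) $$\tilde\delta_\theta:=2\int_S\Big[e_u+\int_S\psi(v)\,\Gamma_u(dv)\Big]\pi(du)+(2\theta-1)\int_S\Big[\sigma_u^2+2\int_S\lambda_u(v)\psi(v)\,\mathcal K(u,dv)\Big]\pi(du).$$ Let $\tau_r:=\min\{n\in\mathbb Z_+:X_n\le r\}$ ($\min\emptyset:=\infty$). Then: (a) If $\tilde\delta_\theta<0$ for some $\theta>0$, then for any $s\in[0,\theta\wedge\frac p2\wedge\frac q2)$ there exists $r_1\in\mathbb R_+$ for which $\mathbb E[\tau_r^s]<\infty$ for all $r\ge r_1$. (b) If $\tilde\delta_\theta>0$ for some $\theta\in(0,\frac p2\wedge\frac q2]$, then for every $s>\theta$ and every $r\in\mathbb R_+$ there exists $r_1\in(r,\infty)$ for which $\mathbb E[\tau_r^s]=\infty$ provided $X_0=x_0$ satisfies $x_0>r_1$.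
   Context: Notation: $\mathbb R_+=[0,\infty)$, $\mathbb Z_+=\{0,1,2,\dots\}$. $(S,d_S)$ is a compact metric space with Borel sets $\mathcal B(S)$; $\mathcal P(S)$ is the set of Borel probability measures on $S$, $\mathcal M_\pm(S)$ the set of finite signed Borel measures; $C_b(S)$ is the set of continuous real functions on $S$; $M_b(S)$ is the set of bounded measurable real functions on $S$ with metric $d_\infty(f,g)=\sup_{u\in S}|f(u)-g(u)|$. $\|\cdot\|_{\mathrm{TV}}$ is the total variation norm, $\|\nu\|_{\mathrm{TV}}=\sup\{\int f\,d\nu: f\in C_b(S),\ \sup|f|\le1\}$, and $d_{\mathrm{TV}}(\mu,\nu)=\frac12\|\mu-\nu\|_{\mathrm{TV}}$. A probability $\nu\in\mathcal P(S)$ is invariant for a Markov kernel $\mathcal K$ if $\nu(B)=\int_S\nu(du)\mathcal K(u,B)$ for all $B\in\mathcal B(S)$. The process: on a probability space with filtration $(\mathcal F_n)_{n\in\mathbb Z_+}$, $\xi=(\xi_n)$ is an adapted process in $\Sigma=\mathbb R_+\times S$ with $\xi_n=(X_n,\eta_n)$, $X_n\in\mathbb R_+$, $\eta_n\in S$, and $\mathcal K_s$ is a Markov kernel on $\Sigma$ with $\Pr(\xi_{n+1}\in A\mid\mathcal F_n)=\mathcal K_s(\xi_n,A)$ a.s. for all Borel $A\subseteq\Sigma$, $n\in\mathbb Z_+$. The initial state $\xi_0=(x_0,u_0)\in\Sigma$ is deterministic but arbitrary; statements imposing a condition on $x_0$ concern the process with the given kernel started from such an $x_0$. For $B\in\mathcal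 B(S)$, $\mathcal K_s^\circ(x,u,B):=\mathcal K_s((x,u),\mathbb R_+\times B)$. For $k\in\{1,2\}$ and $x\ge x_B$, $\mu_k(x,u):=\int_{\mathbb R_+\times S}(y-x)^k\,\mathcal K_s((x,u),d(y,v))$, so $\mathbb E[(X_{n+1}-X_n)^k\mid\mathcal F_n]=\mu_k(\xi_n)$ on $\{X_n\ge x_B\}$. The function $\mu_1^\circ:\Sigma\times S\to\mathbb R$ is the (measurable, essentially unique) conditional drift given the next $S$-coordinate: $\mu_1^\circ(x,u,v)=\int_{\mathbb R_+}(y-x)\,\mathcal L(x,u,v,dy)$, where $\mathcal L(x,u,v,\cdot)$ is a regular conditional distribution of $X_{n+1}$ given $(\xi_n,\eta_{n+1})=(x,u,v)$, i.e. $\mathcal K_s((x,u),d(y,v))=\mathcal K_s^\circ(x,u,dv)\mathcal L(x,u,v,dy)$; thus $\mu_1(x,u)=\int_S\mathcal K_s^\circ(x,u,dv)\,\mu_1^\circ(x,u,v)$. *)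

(* Defs.v *)
From HB Require Import structures.
From mathcomp Require Import all_boot all_order all_algebra.
From mathcomp Require Import all_classical all_reals all_analysis.
From mathcomp Require Import measurable_realfun.

Set Implicit Arguments.
Unset Strict Implicit.
Unset Printing Implicit Defensive.

Import Order.TTheory GRing.Theory Num.Theory.
Import numFieldNormedType.Exports.

Local Open Scope classical_set_scope.
Local Open Scope ring_scope.

(* Measurable types are pointed in MathComp-Analysis, so a metric space needs a
   distinguished point before it can carry its Borel sets; the point plays no
   other role. *)
#[short(type="pmetricType")]
HB.structure Definition PointedMetric (K : numDomainType) :=
  { M of Metric K M & Pointed M }.

Notation borel S := (g_sigma_algebraType (@open S)).

(* R * S with its product sigma-algebra. The half-strip [0, +oo[ * S is the
   subset [half_strip] of it; the product sigma-algebra is the Borel one since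
   S is going to be compact metric, hence second countable. *)
Notation strip R S := (measurableTypeR R * borel S)%type.

Section charges.
Context d (T : measurableType d) (R : realType).
Local Open Scope ereal_scope.

Definition hahn_pair (nu : {charge set T -> \bar R}) :
    {PN : set T * set T | hahn_decomposition nu PN.1 PN.2} :=
  let: exist P exN := cid (Hahn_decomposition nu) in
  let: exist N PN := cid exN in exist _ (P, N) PN.

(* The integral against nu = nu^+ - nu^-; by uniqueness of the Jordan
   decomposition it does not depend on the chosen Hahn decomposition. *)
Definition charge_integral (nu : {charge set T -> \bar R}) (f : T -> R) : R :=
  (\int[jordan_pos (svalP (hahn_pair nu))]_x f x
   - \int[jordan_neg (svalP (hahn_pair nu))]_x f x)%R.

Definition charge_sub (nu1 nu2 : {charge set T -> \bar R}) :
  {charge set T -> \bar R} := cadd nu1 (copp nu2).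

End charges.

Section total_variation.
Context (R : realType) (S : pmetricType R).
Local Open Scope ereal_scope.

Definition tv_norm (nu : {charge set (borel S) -> \bar R}) : \bar R :=
  ereal_sup [set (charge_integral nu f)%:E | f in
    [set f : S -> R | continuous f /\ forall u, (`|f u| <= 1)%R]].

Definition tv_dist (nu1 nu2 : {charge set (borel S) -> \bar R}) : \bar R :=
  (2^-1)%:E * tv_norm (charge_sub nu1 nu2).

Definition tv_continuous (nu : S -> {charge set (borel S) -> \bar R}) : Prop :=
  forall u, tv_dist (nu v) (nu u) @[v --> u] --> 0.

End total_variation.

(* The library does not equip the values [k x] of a probability kernel with the
   finite-measure structure that makes them charges; [kernel_at k x] has it. *)
Section kernel_charge.
Context d d' (X : measurableType d) (Y : measurableType d') (R : realType).
Variables (k : R.-pker X ~> Y) (x : X).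
Local Open Scope ereal_scope.

Definition kernel_at : set Y -> \bar R := k x.

HB.instance Definition _ := Measure.on kernel_at.

Let kernel_at_fin : fin_num_fun kernel_at.
Proof. exact: finite_kernel_measure. Qed.

HB.instance Definition _ := @Measure_isFinite.Build _ _ _
  kernel_at kernel_at_fin.

End kernel_charge.

Section invariance.
Context d (T : measurableType d) (R : realType).
Local Open Scope ereal_scope.

Definition invariant (K : R.-pker T ~> T) (nu : probability T R) : Prop :=
  forall B, measurable B -> nu B = \int[nu]_u K u B.

Definition unique_invariant (K : R.-pker T ~> T) (pi0 : probability T R) :=
  invariant K pi0 /\ forall nu, invariant K nu ->
    forall B, measurable B -> nu B = pi0 B.

End invariance.

Section half_strip_kernel.
Context (R : realType) (S : pmetricType R).
Local Open Scope ereal_scope.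

Definition Rplus : set R := [set x : R | (0 <= x)%R].

Definition half_strip : set (strip R S) := Rplus `*` setT.

(* A Markov kernel on the half-strip is encoded as a kernel on R * S that leaves
   the half-strip invariant; its values at negative abscissae are never used. *)
Definition half_strip_kernel (Ks : R.-pker strip R S ~> strip R S) : Prop :=
  forall z, half_strip z -> Ks z half_strip = 1.

Variable Ks : R.-pker strip R S ~> strip R S.

Definition modulation_law (z : strip R S) (B : set (borel S)) : \bar R :=
  Ks z (Rplus `*` B).

Lemma measurable_Rplus : measurable (Rplus : set (measurableTypeR R)).
Proof.
rewrite (_ : Rplus = `[0%R, +oo[%classic); first exact: measurable_itv.
by apply/seteqP; split => x; rewrite /Rplus /= in_itv /= andbT.
Qed.

Section measure.
Variable z : strip R S.
Local Notation mu := (modulation_law z).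

Let mu0 : mu set0 = 0. Proof. by rewrite /modulation_law setX0 measure0. Qed.

Let mu_ge0 B : 0 <= mu B. Proof. exact: measure_ge0. Qed.

Let mu_sigma_additive : semi_sigma_additive mu.
Proof.
move=> F mF tF mUF; rewrite /modulation_law.
have -> : Rplus `*` \bigcup_n F n = \bigcup_n (Rplus `*` F n).
  apply/seteqP; split => -[x u] /=; first by move=> [x0 [n _ Fu]]; exists n.
  by move=> [n _ [x0 Fu]]; split => //; exists n.
apply: measure_semi_sigma_additive.
- by move=> n; apply: measurableX => //; exact: measurable_Rplus.
- apply/trivIsetP => i j _ _ ij; rewrite -setXI.
  by move/trivIsetP : tF => -> //; rewrite setX0.
- apply: bigcup_measurable => n _.
  by apply: measurableX => //; exact: measurable_Rplus.
Qed.

HB.instance Definition _ := isMeasure.Build _ _ _ mu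
  mu0 mu_ge0 mu_sigma_additive.

Let mu_fin : fin_num_fun mu.
Proof.
move=> B mB; apply: finite_kernel_measure.
by apply: measurableX => //; exact: measurable_Rplus.
Qed.

HB.instance Definition _ := @Measure_isFinite.Build _ _ _ mu mu_fin.

End measure.

(* Extended-real valued on purpose: the integral of a function whose positive or
   negative part is not integrable is infinite, so a finite distance to a real
   number forces the moment to exist. Likewise for [conditional_drift]. *)
Definition drift_moment (k : nat) (x : R) (u : S) : \bar R :=
  \int[Ks (x, u)]_(z in half_strip) ((z.1 - x) ^+ k)%:E.

(* L ((x, u), v) is a regular conditional distribution of the next abscissa,
   given the current state (x, u) and the next modulation v. *)
Definition conditional_law
    (L : R.-pker (strip R S * borel S) ~> measurableTypeR R) : Prop :=
  forall z, half_strip z ->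
    (forall v, L (z, v) Rplus = 1) /\
    (forall A, measurable A ->
       Ks z A = \int[modulation_law z]_v L (z, v) [set y | A (y, v)]).

End half_strip_kernel.

Definition conditional_drift (R : realType) (S : pmetricType R)
    (L : R.-pker (strip R S * borel S) ~> measurableTypeR R)
    (x : R) (u v : S) : \bar R :=
  (\int[L ((x, u), v)]_(y in @Rplus R) (y - x)%:E)%E.

Section processes.
Context d (Omega : measurableType d) (R : realType) (P : probability Omega R).
Local Open Scope ereal_scope.

Definition filtration (F : nat -> set (set Omega)) : Prop :=
  (forall n, sigma_algebra setT (F n) /\ F n `<=` measurable) /\
  (forall n, F n `<=` F n.+1).

(* Y is a version of the conditional expectation of the nonnegative random
   variable Z given the sigma-algebra G. *)
Definition conditional_expectation (G : set (set Omega))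
    (Z Y : Omega -> \bar R) : Prop :=
  (forall B, measurable B -> G (Y @^-1` B)) /\
  (forall A, G A -> \int[P]_(w in A) Y w = \int[P]_(w in A) Z w).

Variable S : pmetricType R.

Record half_strip_process (F : nat -> set (set Omega))
    (Ks : R.-pker strip R S ~> strip R S) (z0 : strip R S)
    (xi : nat -> Omega -> strip R S) : Prop := {
  process_filtration : filtration F ;
  process_adapted : forall n A, measurable A -> F n (xi n @^-1` A) ;
  process_half_strip : forall n w, half_strip (xi n w) ;
  process_init : forall w, xi 0%N w = z0 ;
  process_markov : forall n A, measurable A ->
    conditional_expectation (F n)
      (fun w => (\1_(xi n.+1 @^-1` A) w)%:E) (fun w => Ks (xi n w) A) }.

Variable xi : nat -> Omega -> strip R S.

Definition non_confined : Prop :=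
  P [set w | limn_esup (fun n => ((xi n w).1)%:E) = +oo] = 1.

Definition moment_bounds (F : nat -> set (set Omega)) (p q xB Bp Bq : R) : Prop :=
  forall n,
    (exists2 Y, conditional_expectation (F n)
        (fun w => (`|(xi n.+1 w).1 - (xi n w).1| `^ p)%:E) Y &
      {ae P, forall w, (xB <= (xi n w).1)%R -> Y w <= Bp%:E}) /\
    (exists2 Y, conditional_expectation (F n)
        (fun w => (`|(xi n.+1 w).1| `^ q)%:E) Y &
      {ae P, forall w, ((xi n w).1 < xB)%R -> Y w <= Bq%:E}).

(* The least such n, and +oo = ereal_inf set0 when there is none. *)
Definition passage_time (r : R) (w : Omega) : \bar R :=
  ereal_inf [set (n%:R)%:E | n in [set n : nat | ((xi n w).1 <= r)%R]].

Definition passage_moment (r s : R) : \bar R :=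
  \int[P]_w (passage_time r w `^ s).

End processes.

Definition delta_tilde (R : realType) (S : pmetricType R)
    (K : R.-pker borel S ~> borel S) (pi0 : probability (borel S) R)
    (Gamma : S -> {charge set (borel S) -> \bar R})
    (e sigma2 : S -> R) (lambda : S -> S -> R) (psi : S -> R) (theta : R) : R :=
  2 * \int[pi0]_u (e u + charge_integral (Gamma u) psi)
  + (2 * theta - 1) *
    \int[pi0]_u (sigma2 u + 2 * \int[K u]_v (lambda u v * psi v)).

(* Main.v *)
(* Far from the origin the process is reduced to a scalar Lamperti problem by
   the function
     Z (x, u) = x + psi u + c + g u / (1 + x),  g = g0 - (theta - 1/2) psi^2,
   where [psi] absorbs the fluctuations of the drift [d] and [g0] those of the
   next order term
     h = 2 (e + Gamma psi) + (2 theta - 1) (sigma^2 + 2 K (lambda psi)).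
   One step then satisfies, up to a prescribed error and uniformly in the phase,
     2 Z E[dZ] + (2 theta - 1) E[dZ^2] = pi h = delta_tilde theta.
   The Poisson equation for [h] need not be solvable; a bounded approximate
   solution [g0] comes from the Cesaro averages of [K], which converge uniformly
   because an ultrafilter limit of bad ones would be a second invariant law.

   If [delta_tilde theta < 0], the powers [Z^(2 (s - j))], [j = 0, 1, ...], are
   supermartingales with an explicit negative drift, and an induction on [j]
   bounds the probability of surviving [n] steps above a level by [n^(-s)].  If
   [delta_tilde theta > 0], [min (Z, 4 m)^(2 theta)] is a submartingale below
   [2 m]; hence a level of order [m] is reached before the passage with a
   probability of order [m^(-2 theta)], and from there the process survives of
   order [m^2] further steps with probability at least 1/2. *)

Require Import Defs.
From HB Require Import structures.
From mathcomp Require Import all_boot all_order all_algebra.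
From mathcomp Require Import all_classical all_reals all_analysis.
From mathcomp Require Import measurable_realfun ring lra.

Set Implicit Arguments.
Unset Strict Implicit.
Unset Printing Implicit Defensive.

Import Order.TTheory GRing.Theory Num.Theory.
Import numFieldNormedType.Exports.

Local Open Scope classical_set_scope.
Local Open Scope ring_scope.

(** * One-step estimates for powers *)

(** Origin of the corrections. The drift of X alone is of order 1; [psi] cancels it, as d + K psi -
    psi = 0, so that x E[dZ] tends to e + Gamma psi + K g - g. In E[dZ^2] the terms in [psi] and d
    alone add up to K psi^2 - psi^2, next to sigma^2 + 2 K (lambda psi). That remainder is a
    coboundary with weight 2 theta - 1, and the part -(theta - 1/2) psi^2 of g cancels it. With G =
    2 g0 the sum is h + K G - G, which only has to be close to its mean: delta_tilde has a strict
    sign, so half of its absolute value is an admissible error. The constant c keeps Z at least 1.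
    One drift inequality, for theta, serves all the smaller exponents t, because the coefficient 2 t
    - 1 of the second moment only decreases. The p-th moment with p > 2 makes the Taylor remainder
    of Z^(2 t) smaller than Z^(2 t - 2) as long as 2 t <= p; this is where the bound p / 2 on the
    exponents comes from. *)

Lemma eq_ler (R : numDomainType) (x y : R) : x = y -> x <= y.
Proof. by move=> ->. Qed.

Section power_expansion.
Context {R : realType}.
Implicit Types (x y t nu p : R).

(** The intermediate point is again within [|y - 1|] of 1, so the lemma can be applied a second time
    there; two rounds give a second order expansion. *)
Lemma mean_value_at1 (g dg : R -> R) (e : R) :
  (forall y, `|y - 1| < e -> is_derive y 1 g (dg y)) -> g 1 = 0 ->
  forall y, `|y - 1| < e ->
  exists2 c, `|c - 1| <= `|y - 1| & g y = dg c * (y - 1).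
Proof.
move=> dgE g1 y ye.
have ctg z : `|z - 1| < e -> {for z, continuous g}.
  by move=> /dgE dz; apply/differentiable_continuous/derivable1_diffP.
have [y1|y1] := leP 1 y.
  have [||c cy gE] := @MVT_segment _ g dg 1 y y1.
  - move=> z; rewrite in_itv/= => /andP[z1 zy]; apply: dgE.
    by move: ye; rewrite !ltr_norml => /andP[? ?]; apply/andP; split; lra.
  - apply: continuous_in_subspaceT => z; rewrite inE/= in_itv/= => /andP[z1 zy].
    apply: ctg; by move: ye; rewrite !ltr_norml => /andP[? ?]; apply/andP; split; lra.
  exists c; last by rewrite -gE g1 subr0.
  by move: cy; rewrite in_itv/= => /andP[? ?]; rewrite !ger0_norm; lra.
have [||c cy gE] := @MVT_segment _ g dg y 1 (ltW y1).
- move=> z; rewrite in_itv/= => /andP[z1 zy]; apply: dgE.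
  by move: ye; rewrite !ltr_norml => /andP[? ?]; apply/andP; split; lra.
- apply: continuous_in_subspaceT => z; rewrite inE/= in_itv/= => /andP[z1 zy].
  apply: ctg; by move: ye; rewrite !ltr_norml => /andP[? ?]; apply/andP; split; lra.
exists c; last by rewrite -opprB mulrN -gE g1 sub0r opprK.
by move: cy; rewrite in_itv/= => /andP[? ?]; rewrite !ler0_norm; lra.
Qed.

Lemma powR_expansion_near1 nu (eps : R) : 0 < eps ->
  exists2 e : R, 0 < e < 1 & forall y, `|y - 1| < e ->
  `|y `^ nu - 1 - nu * (y - 1) - nu * (nu - 1) / 2 * (y - 1) ^+ 2| <=
  eps * (y - 1) ^+ 2.
Proof.
move=> eps0.
pose M : R := 1 + `|nu| * `|nu - 1|.
have M0 : 0 < M by rewrite /M ltr_wpDr// mulr_ge0.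
have : {for 1, continuous (fun y => y `^ (nu - 2))}.
  apply/differentiable_continuous/derivable1_diffP.
  by have := is_derive1_powR (nu - 2) (@ltr01 R); case.
move=> /cvgrPdist_lt/(_ (eps / M)); rewrite divr_gt0// => /(_ isT).
move=> /nbhs_ballP[e0 /= e0_gt0 he0].
(* The radius 1/2 keeps [y] positive, where powers are differentiable. *)
exists (Num.min e0 (1/2)).
  by apply/andP; split; [rewrite lt_min; lra|rewrite gt_min; apply/orP; right; lra].
have pos y : `|y - 1| < Num.min e0 (1/2) -> 0 < y.
  rewrite lt_min => /andP[_]; rewrite ltr_norml => /andP[]; lra.
move=> y ye.
have [||c cy ->] := @mean_value_at1
  (fun y => y `^ nu - 1 - nu * (y - 1) - nu * (nu - 1) / 2 * (y - 1) ^+ 2)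
  (fun y => nu * (y `^ (nu - 1) - 1 - (nu - 1) * (y - 1)))
  (Num.min e0 (1/2)) _ _ y ye.
- move=> z /pos z0.
  have := is_derive1_powR nu z0 => dz.
  by apply: is_derive_eq; rewrite /GRing.scale/=; lra.
- by rewrite powR1; lra.
have ce : `|c - 1| < Num.min e0 (1/2) by rewrite (le_lt_trans cy).
have [||c' cy' ->] := @mean_value_at1
  (fun y => y `^ (nu - 1) - 1 - (nu - 1) * (y - 1))
  (fun y => (nu - 1) * (y `^ (nu - 2) - 1))
  (Num.min e0 (1/2)) _ _ c ce.
- move=> z /pos z0.
  have := is_derive1_powR (nu - 1) z0 => dz.
  apply: is_derive_eq; rewrite /GRing.scale/=.
  have -> : nu - 1 - 1 = nu - 2 by lra.
  by lra.
- by rewrite powR1; lra.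
have c'e : `|c' - 1| < Num.min e0 (1/2) by rewrite (le_lt_trans cy').
have := he0 c'; rewrite /ball/= powR1 distrC => /(_ _)/ltW.
move: (c'e); rewrite lt_min => /andP[-> _] /(_ isT); rewrite distrC => hc'.
have -> : eps * (y - 1) ^+ 2 = eps * `|y - 1| * `|y - 1|.
  by rewrite -mulrA -expr2 real_normK ?num_real.
rewrite !normrM; apply: ler_pM => //.
rewrite (@le_trans _ _ (`|nu| * (`|nu - 1| * (eps / M) * `|y - 1|)))//.
  by rewrite ler_wpM2l// ler_pM// ler_wpM2l.
rewrite !mulrA ler_wpM2r// ler_pdivrMr// mulrC ler_wpM2l ?ltW//.
by rewrite /M; lra.
Qed.

(** Away from 0 the [p]-th power dominates the lower ones, since [a - p] is nonpositive. *)
Lemma powR_le_far (e h a p : R) : 0 < e -> e <= h -> a <= p ->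
  h `^ a <= e `^ (a - p) * h `^ p.
Proof.
move=> e0 eh ap; have h0 : 0 < h by exact: lt_le_trans eh.
have -> : h `^ a = h `^ (a - p) * h `^ p.
  by rewrite -powRD ?subrK// (gt_eqF h0) implybT.
rewrite ler_wpM2r ?powR_ge0//.
have -> : a - p = - (p - a) by lra.
rewrite !powRN lef_pV2 ?posrE ?powR_gt0//.
by apply: ge0_ler_powR; rewrite ?nnegrE; lra.
Qed.

Lemma powR_expansion1 nu p (eps : R) : 2 < p -> 0 < nu <= p -> 0 < eps ->
  exists2 C : R, 0 <= C & forall y, 0 <= y ->
  `|y `^ nu - 1 - nu * (y - 1) - nu * (nu - 1) / 2 * (y - 1) ^+ 2| <=
  eps * (y - 1) ^+ 2 + C * `|y - 1| `^ p.
Proof.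
move=> p2 /andP[nu0 nup] eps0.
have [e /andP[e0 e1] he] := powR_expansion_near1 nu eps0.
pose C := (1 + e^-1) `^ nu * e `^ (nu - p) + e `^ (0 - p) +
  `|nu| * e `^ (1 - p) + `|nu * (nu - 1) / 2| * e `^ (2 - p).
have C0 : 0 <= C by rewrite /C !addr_ge0// ?mulr_ge0// ?powR_ge0.
exists C => // y y0.
have [ye|ey] := ltP `|y - 1| e.
  by rewrite (le_trans (he _ ye))// lerDl mulr_ge0 ?powR_ge0.
rewrite (@le_trans _ _ (C * `|y - 1| `^ p))//; last first.
  by rewrite lerDr mulr_ge0 ?sqr_ge0// ltW.
set h := `|y - 1| in ey *.
have h0 : 0 < h by exact: lt_le_trans ey.
rewrite (@le_trans _ _ (y `^ nu + 1 + `|nu| * h + `|nu * (nu - 1) / 2| * h ^+ 2))//.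
  rewrite (le_trans (ler_normB _ _))// normrM normrX lerD2r.
  rewrite (le_trans (ler_normB _ _))// normrM lerD2r.
  rewrite (le_trans (ler_normB _ _))// normr1 lerD2r.
  by rewrite ger0_norm ?powR_ge0.
rewrite /C !mulrDl lerD//; last first.
  rewrite -[leRHS]mulrA ler_wpM2l// -powR_mulrn ?(ltW h0)//.
  by apply: powR_le_far => //; lra.
rewrite lerD//; last first.
  rewrite -[leRHS]mulrA ler_wpM2l// -[X in X <= _]powRr1 ?(ltW h0)//.
  by apply: powR_le_far => //; lra.
rewrite lerD//; last first.
  by rewrite -(powRr0 h); apply: powR_le_far => //; lra.
rewrite -[leRHS]mulrA (@le_trans _ _ ((1 + e^-1) `^ nu * h `^ nu))//; last first.
  by rewrite ler_wpM2l ?powR_ge0//; apply: powR_le_far => //; lra.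
have ei : 0 < e^-1 by rewrite invr_gt0.
rewrite -powRM ?(ltW h0)//; last by lra.
apply: ge0_ler_powR; rewrite ?nnegrE ?(ltW nu0)// ?mulr_ge0 ?addr_ge0 ?(ltW ei) ?(ltW h0)//.
have : 1 <= e^-1 * h by rewrite mulrC ler_pdivlMr ?mul1r.
have : y - 1 <= h by rewrite ler_norm.
by lra.
Qed.

Lemma powR_expansion nu p (eps : R) : 2 < p -> 0 < nu <= p -> 0 < eps ->
  exists2 C : R, 0 <= C & forall a b, 0 < a -> 0 <= b ->
  `|b `^ nu - a `^ nu - nu * a `^ (nu - 1) * (b - a)
    - nu * (nu - 1) / 2 * a `^ (nu - 2) * (b - a) ^+ 2| <=
  a `^ (nu - 2) * (eps * (b - a) ^+ 2 + C * a `^ (2 - p) * `|b - a| `^ p).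
Proof.
move=> p2 nup eps0; have [C C0 hC] := powR_expansion1 p2 nup eps0.
exists C => // a b a0 b0.
have := hC (b / a) (divr_ge0 b0 (ltW a0)).
have -> : b / a - 1 = (b - a) / a by rewrite mulrBl divff ?(gt_eqF a0).
have /andP[nu0 _] := nup.
have E1 : a `^ nu = a `^ (nu - 2) * a ^+ 2.
  by rewrite -powR_mulrn ?(ltW a0)// -powRD ?subrK// (gt_eqF a0) ?implybT.
have E2 : a `^ (nu - 1) = a `^ (nu - 2) * a.
  rewrite -[X in _ = _ * X]powRr1 ?(ltW a0)// -powRD ?(gt_eqF a0) ?implybT//.
  by congr (_ `^ _); lra.
have E3 : a `^ (2 - p) * `|b - a| `^ p = a ^+ 2 * `|(b - a) / a| `^ p.
  rewrite normrM [X in (_ * X) `^ _]ger0_norm ?invr_ge0 ?(ltW a0)//.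
  rewrite powRM ?invr_ge0 ?(ltW a0)// -[a^-1]powR_inv1 ?(ltW a0)// -powRrM mulN1r.
  rewrite -[a ^+ 2]powR_mulrn ?(ltW a0)// mulrCA -powRD ?(gt_eqF a0) ?implybT//.
  by rewrite mulrC.
move=> h; rewrite -[C * _ * _]mulrA E3.
have -> : b `^ nu = a `^ (nu - 2) * a ^+ 2 * (b / a) `^ nu.
  by rewrite -E1 -powRM ?divr_ge0 ?(ltW a0)// mulrCA divff ?(gt_eqF a0) ?mulr1.
rewrite E1 E2.
have -> : a `^ (nu - 2) * a ^+ 2 * (b / a) `^ nu - a `^ (nu - 2) * a ^+ 2 -
  nu * (a `^ (nu - 2) * a) * (b - a) -
  nu * (nu - 1) / 2 * a `^ (nu - 2) * (b - a) ^+ 2 =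
  a `^ (nu - 2) * (a ^+ 2 * ((b / a) `^ nu - 1 - nu * ((b - a) / a) -
   nu * (nu - 1) / 2 * ((b - a) / a) ^+ 2)) by field; rewrite (gt_eqF a0).
rewrite normrM ger0_norm ?powR_ge0// ler_wpM2l ?powR_ge0//.
rewrite normrM ger0_norm ?sqr_ge0//.
rewrite (le_trans (ler_wpM2l (sqr_ge0 a) h))// le_eqVlt; apply/orP; left.
by apply/eqP; field; rewrite (gt_eqF a0).
Qed.

End power_expansion.

Section finite_mass.
Context d (T : measurableType d) (R : realType).
Variables (mu : {measure set T -> \bar R}) (D : set T).
Hypotheses (mD : measurable D) (muD : (mu D < +oo)%E).
Implicit Types f g : T -> R.

Lemma integrable_bdd f (M : R) : measurable_fun D f ->
  (forall x, D x -> `|f x| <= M) -> mu.-integrable D (EFin \o f).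
Proof.
move=> mf fM; apply: measurable_bounded_integrable => //.
exists M; split; first exact: num_real.
by move=> x Mx y Dy; rewrite /= (le_trans (fM _ Dy))// ltW.
Qed.

Lemma integrable_dom f g : measurable_fun D f ->
  (forall x, D x -> `|f x| <= g x) -> mu.-integrable D (EFin \o g) ->
  mu.-integrable D (EFin \o f).
Proof.
move=> mf fg; apply: le_integrable => //; first exact/measurable_EFinP.
move=> x Dx /=; rewrite lee_fin (le_trans (fg _ Dx))//.
by rewrite ler_norm.
Qed.

Lemma integrable_add f g : mu.-integrable D (EFin \o f) ->
  mu.-integrable D (EFin \o g) -> mu.-integrable D (EFin \o (fun x => f x + g x)).
Proof. by move=> fi gi; have := integrableD mD fi gi. Qed.

Lemma integrable_sub f g : mu.-integrable D (EFin \o f) ->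
  mu.-integrable D (EFin \o g) -> mu.-integrable D (EFin \o (fun x => f x - g x)).
Proof. by move=> fi gi; have := integrableB mD fi gi. Qed.

Lemma integrable_scale (k : R) f : mu.-integrable D (EFin \o f) ->
  mu.-integrable D (EFin \o (fun x => k * f x)).
Proof. by move=> fi; have := integrableZl mD k fi. Qed.

Lemma integrable_cst_fin (k : R) : mu.-integrable D (EFin \o (fun=> k)).
Proof. exact: (@integrable_bdd _ `|k|). Qed.

Lemma le_Rintegral_dist f g (e : R) : mu.-integrable D (EFin \o f) ->
  mu.-integrable D (EFin \o g) -> (forall x, D x -> `|f x - g x| <= e) ->
  `|\int[mu]_(x in D) f x - \int[mu]_(x in D) g x| <= e * fine (mu D).
Proof.
move=> fi gi fg; rewrite -RintegralB//.
rewrite (le_trans (le_normr_Rintegral _ _))//; first exact: integrable_sub.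
rewrite -Rintegral_cst//; apply: le_Rintegral => //.
- by have /integrable_norm := integrable_sub fi gi.
- exact: integrable_cst_fin.
Qed.

End finite_mass.

Section prob_mass.
Context d (T : measurableType d) (R : realType).
Variables (mu : {measure set T -> \bar R}) (D : set T).
Hypotheses (mD : measurable D) (muD : mu D = 1%E).
Implicit Types f g : T -> R.

Lemma mass1_lty : (mu D < +oo)%E. Proof. by rewrite muD ltry. Qed.
Local Hint Resolve mass1_lty : core.

Lemma Rintegral_cst1 (k : R) : \int[mu]_(x in D) k = k.
Proof. by rewrite Rintegral_cst// muD mulr1. Qed.

Section moments.
Variables (p a : R) (f : T -> R).
Hypotheses (p2 : 2 < p) (mf : measurable_fun D f).
Hypothesis fp : mu.-integrable D (EFin \o (fun x => `|f x - a| `^ p)).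

Lemma powR_le1D (h q : R) : 0 <= h -> 0 <= q <= p -> h `^ q <= 1 + h `^ p.
Proof.
move=> h0 /andP[q0 qp]; have [h1|h1] := leP h 1.
  rewrite (@le_trans _ _ 1)// ?lerDl ?powR_ge0//.
  have <- : 1 `^ q = 1 :> R by rewrite powR1.
  by apply: ge0_ler_powR; rewrite ?nnegrE.
by rewrite (@le_trans _ _ (h `^ p)) ?lerDr// ler_powR// ltW.
Qed.

Lemma measurable_fun_dev : measurable_fun D (fun x => f x - a).
Proof. exact: measurable_funB. Qed.

Lemma integrable_dev : mu.-integrable D (EFin \o (fun x => f x - a)).
Proof.
apply: (@integrable_dom _ _ _ _ _ mD _ (fun x => 1 + `|f x - a| `^ p)).
- exact: measurable_fun_dev.
- move=> x Dx; rewrite -[leLHS]powRr1//; apply: powR_le1D => //.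
  by have p3 := p2; apply/andP; split=> //; lra.
- by apply: integrable_add => //; exact: integrable_cst_fin.
Qed.

Lemma integrable_dev2 : mu.-integrable D (EFin \o (fun x => (f x - a) ^+ 2)).
Proof.
apply: (@integrable_dom _ _ _ _ _ mD _ (fun x => 1 + `|f x - a| `^ p)).
- by apply: measurable_funX; exact: measurable_fun_dev.
- move=> x Dx; rewrite normrX -powR_mulrn//; apply: powR_le1D => //.
  by have p3 := p2; apply/andP; split=> //; lra.
- by apply: integrable_add => //; exact: integrable_cst_fin.
Qed.

Lemma integrable_dev_poly k0 k1 k2 k3 :
  mu.-integrable D (EFin \o (fun x =>
    k0 + (k1 * (f x - a) + (k2 * (f x - a) ^+ 2 + k3 * `|f x - a| `^ p)))).
Proof.
apply: integrable_add => //; first exact: integrable_cst_fin.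
apply: integrable_add => //; first exact/integrable_scale/integrable_dev.
apply: integrable_add => //; first exact/integrable_scale/integrable_dev2.
exact: integrable_scale.
Qed.

Lemma Rintegral_dev_poly k0 k1 k2 k3 :
  \int[mu]_(x in D) (k0 + (k1 * (f x - a) + (k2 * (f x - a) ^+ 2 + k3 * `|f x - a| `^ p))) =
  k0 + (k1 * \int[mu]_(x in D) (f x - a)
     + (k2 * \int[mu]_(x in D) (f x - a) ^+ 2
     + k3 * \int[mu]_(x in D) `|f x - a| `^ p)).
Proof.
have i1 := integrable_dev; have i2 := integrable_dev2.
have j1 := integrable_scale mD k1 i1.
have j2 := integrable_scale mD k2 i2.
have j3 := integrable_scale mD k3 fp.
have j23 := integrable_add mD j2 j3.
have j123 := integrable_add mD j1 j23.
have j0 := integrable_cst_fin mD mass1_lty k0.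
rewrite (RintegralD mD j0 j123) Rintegral_cst1 (RintegralD mD j1 j23).
by rewrite (RintegralD mD j2 j3) !RintegralZl.
Qed.

End moments.
End prob_mass.

Section one_step.
Context {R : realType}.
Implicit Types (nu p B a eta : R).

Lemma powR_decay (q : R) eta : 0 < q -> 0 < eta ->
  exists2 a0, 1 <= a0 & forall a, a0 <= a -> a `^ (- q) <= eta.
Proof.
move=> q0 eta0.
exists (Num.max 1 (eta^-1 `^ q^-1)); first by rewrite le_max lexx.
move=> a; rewrite ge_max => /andP[a1 ae].
rewrite powRN -[leRHS]invrK lef_pV2 ?posrE ?invr_gt0 ?powR_gt0//; last first.
  by lra.
rewrite (_ : eta^-1 = (eta^-1 `^ q^-1) `^ q).
  by apply: ge0_ler_powR; rewrite ?nnegrE ?powR_ge0// ?(ltW q0)//; lra.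
by rewrite -powRrM mulVf ?gt_eqF// powRr1// invr_ge0 ltW.
Qed.

(** The expansion integrated. The threshold [a0] is chosen before the measure, so that one threshold
    serves the laws [Ks z] of all states. With [nu = 2 * t] the bracket is the drift expression of
    the Lamperti problem. *)
Lemma powR_moment nu p B eta : 2 < p -> 0 < nu <= p -> 0 < eta -> 0 <= B ->
  exists2 a0, 1 <= a0 & forall d (T : measurableType d)
    (mu : {measure set T -> \bar R}) (D : set T) (f : T -> R) a,
  measurable D -> mu D = 1%E -> measurable_fun D f ->
  (forall x, D x -> 0 <= f x) -> a0 <= a ->
  mu.-integrable D (EFin \o (fun x => `|f x - a| `^ p)) ->
  \int[mu]_(x in D) (f x - a) ^+ 2 <= B ->
  \int[mu]_(x in D) `|f x - a| `^ p <= B ->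
  mu.-integrable D (EFin \o (fun x => f x `^ nu)) /\
  `|\int[mu]_(x in D) f x `^ nu - a `^ nu
    - nu / 2 * a `^ (nu - 2) * (2 * a * \int[mu]_(x in D) (f x - a)
        + (nu - 1) * \int[mu]_(x in D) (f x - a) ^+ 2)| <= eta * a `^ (nu - 2).
Proof.
move=> p2 nup eta0 B0; have /andP[nu0 _] := nup.
pose e := eta / 2 / (B + 1).
have e0 : 0 < e by rewrite /e !divr_gt0//; lra.
have [C C0 hC] := powR_expansion p2 nup e0.
have [||a0 a01 ha0] := @powR_decay (p - 2) (eta / 2 / ((B + 1) * (C + 1))).
- by lra.
- by rewrite !divr_gt0// mulr_gt0//; lra.
exists a0 => // d T mu D f a mD muD mf f0 a0a fp m2B mpB.
have a_gt0 : 0 < a by lra.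
have mfn : measurable_fun D (fun x => f x `^ nu).
  exact: (measurableT_comp (measurable_powR nu)).
pose q := nu * a `^ (nu - 1); pose s := nu * (nu - 1) / 2 * a `^ (nu - 2).
pose k2 := a `^ (nu - 2) * e; pose k3 := a `^ (nu - 2) * (C * a `^ (2 - p)).
have hf x : D x -> `|f x `^ nu - (a `^ nu + (q * (f x - a)
    + (s * (f x - a) ^+ 2 + 0 * `|f x - a| `^ p)))| <=
    0 + (0 * (f x - a) + (k2 * (f x - a) ^+ 2 + k3 * `|f x - a| `^ p)).
  move=> Dx; apply: le_trans (le_trans (hC a (f x) a_gt0 (f0 _ Dx)) _);
    rewrite le_eqVlt; apply/orP; left; apply/eqP.
  - by congr (`|_|); rewrite /q /s; ring.
  - by rewrite /k2 /k3; ring.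
have Ip k0 k1 k2 k3 := integrable_dev_poly mD muD p2 mf fp k0 k1 k2 k3.
have Ep k0 k1 k2 k3 := Rintegral_dev_poly mD muD p2 mf fp k0 k1 k2 k3.
(* Integrability comes from the upper half of the expansion, whose right-hand side is integrable. *)
have fi : mu.-integrable D (EFin \o (fun x => f x `^ nu)).
  apply: (@integrable_dom _ _ _ _ _ mD _ _ mfn _ (Ip (a `^ nu) q (s + k2) k3)).
  move=> x Dx; rewrite ger0_norm ?powR_ge0//.
  have := le_trans (ler_norm _) (hf x Dx); lra.
split=> //.
have := le_normr_Rintegral mD (integrable_sub mD fi (Ip (a `^ nu) q s 0)).
rewrite RintegralB// Ep => h1.
have := le_trans h1 (le_Rintegral mD _ (Ip 0 0 k2 k3) hf) => /(_ _)/wrap[].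
  by have /integrable_norm := integrable_sub mD fi (Ip (a `^ nu) q s 0).
rewrite Ep.
set m1 := \int[mu]_(x in D) (f x - a) in h1 *.
set m2 := \int[mu]_(x in D) (f x - a) ^+ 2 in h1 m2B *.
set mp := \int[mu]_(x in D) `|f x - a| `^ p in h1 mpB *.
set I := \int[mu]_(x in D) f x `^ nu in h1 *.
move=> h2.
have -> : I - a `^ nu - nu / 2 * a `^ (nu - 2) * (2 * a * m1 + (nu - 1) * m2) =
  I - (a `^ nu + (q * m1 + (s * m2 + 0 * mp))).
  rewrite /q /s; have -> : a `^ (nu - 1) = a * a `^ (nu - 2).
    rewrite -[X in _ = X * _]powRr1 ?(ltW a_gt0)// -powRD ?(gt_eqF a_gt0) ?implybT//.
    by congr (_ `^ _); lra.
  by field.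
apply: le_trans h2 _.
have w0 : 0 <= a `^ (nu - 2) by exact: powR_ge0.
have m20 : 0 <= m2 by apply: Rintegral_ge0 => x _; exact: sqr_ge0.
have mp0 : 0 <= mp by apply: Rintegral_ge0 => x _; exact: powR_ge0.
have -> : 0 + (0 * m1 + (k2 * m2 + k3 * mp)) =
   (e * m2 + C * a `^ (2 - p) * mp) * a `^ (nu - 2) by rewrite /k2 /k3; ring.
rewrite ler_wpM2r//.
have -> : eta = eta / 2 + eta / 2 by field.
apply: lerD.
  by rewrite /e mulrAC ler_pdivrMr ?ler_wpM2l//; lra.
have := ha0 a a0a; rewrite opprB ler_pdivlMr ?mulr_gt0//; [|lra|lra].
apply: le_trans.
have -> : C * a `^ (2 - p) * mp = a `^ (2 - p) * (mp * C) by ring.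
by rewrite ler_wpM2l ?powR_ge0// ler_pM//; lra.
Qed.

End one_step.

Section lyapunov_step.
Context {R : realType}.
Implicit Types (nu p B a eta eps : R).

Lemma powR_drift_down nu p B eps : 2 < p -> 0 < nu <= p -> 0 < eps -> 0 <= B ->
  exists2 a0, 1 <= a0 & forall d (T : measurableType d)
    (mu : {measure set T -> \bar R}) (D : set T) (f : T -> R) a,
  measurable D -> mu D = 1%E -> measurable_fun D f ->
  (forall x, D x -> 0 <= f x) -> a0 <= a ->
  mu.-integrable D (EFin \o (fun x => `|f x - a| `^ p)) ->
  \int[mu]_(x in D) (f x - a) ^+ 2 <= B ->
  \int[mu]_(x in D) `|f x - a| `^ p <= B ->
  2 * a * \int[mu]_(x in D) (f x - a)
    + (nu - 1) * \int[mu]_(x in D) (f x - a) ^+ 2 <= - eps ->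
  mu.-integrable D (EFin \o (fun x => f x `^ nu)) /\
  \int[mu]_(x in D) f x `^ nu <= a `^ nu - nu * eps / 4 * a `^ (nu - 2).
Proof.
move=> p2 nup eps0 B0; have /andP[nu0 _] := nup.
have [|a0 a01 h] := powR_moment (eta := nu * eps / 4) p2 nup _ B0.
  by rewrite divr_gt0// mulr_gt0.
exists a0 => // d T mu D f a mD muD mf f0 a0a fp m2B mpB drift.
have [fi] := h _ _ _ _ _ _ mD muD mf f0 a0a fp m2B mpB.
rewrite ler_norml => /andP[_]; split => //.
set I := (\int[mu]_(x in D) f x `^ nu) in b *.
have w0 : 0 <= nu / 2 * a `^ (nu - 2) by rewrite mulr_ge0 ?powR_ge0 ?divr_ge0 ?ltW.
by have := ler_wpM2l w0 drift; lra.
Qed.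

(** The truncation at [2 * m] makes the power bounded, as a lower bound on a probability must be;
    below [m] its cost is smaller than the gain from the drift. *)
Lemma powR_drift_up nu p B eps : 2 < p -> 0 < nu <= p -> 0 < eps -> 0 <= B ->
  exists2 a0, 1 <= a0 & forall d (T : measurableType d)
    (mu : {measure set T -> \bar R}) (D : set T) (f : T -> R) a (m : R),
  measurable D -> mu D = 1%E -> measurable_fun D f ->
  (forall x, D x -> 0 <= f x) -> a0 <= a -> a <= m ->
  mu.-integrable D (EFin \o (fun x => `|f x - a| `^ p)) ->
  \int[mu]_(x in D) (f x - a) ^+ 2 <= B ->
  \int[mu]_(x in D) `|f x - a| `^ p <= B ->
  eps <= 2 * a * \int[mu]_(x in D) (f x - a)
    + (nu - 1) * \int[mu]_(x in D) (f x - a) ^+ 2 ->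
  a `^ nu <= \int[mu]_(x in D) (Num.min (f x) (2 * m)) `^ nu.
Proof.
move=> p2 nup eps0 B0; have /andP[nu0 nup'] := nup.
pose e := nu * eps / 4.
have e0 : 0 < e by rewrite divr_gt0// mulr_gt0.
have [a0 a01 h] := powR_moment p2 nup e0 B0.
have k0 : 0 < 2 `^ nu * (B + 1) by rewrite mulr_gt0 ?powR_gt0//; lra.
have [||a1 a11 h1] := @powR_decay R (p - 2) (e / (2 `^ nu * (B + 1))).
- by lra.
- by rewrite divr_gt0.
exists (Num.max a0 a1); first by rewrite le_max a01.
move=> d T mu D f a m mD muD mf f0; rewrite ge_max => /andP[a0a a1a] am.
move=> fp m2B mpB drift.
have [fi] := h _ _ _ _ _ _ mD muD mf f0 a0a fp m2B mpB.
rewrite ler_norml => /andP[b _].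
have a_gt0 : 0 < a by lra.
pose g x := (Num.min (f x) (2 * m)) `^ nu.
pose k := 2 `^ nu * a `^ (nu - p).
have fg x : D x -> f x `^ nu - k * `|f x - a| `^ p <= g x.
  move=> Dx; rewrite /g; have [fm|fm] := leP (f x) (2 * m).
    by rewrite gerBl mulr_ge0 ?powR_ge0// mulr_ge0 ?powR_ge0.
  rewrite (@le_trans _ _ 0) ?powR_ge0// subr_le0 /k -mulrA.
  rewrite (@le_trans _ _ (2 `^ nu * `|f x - a| `^ nu))//.
    rewrite -powRM//; apply: ge0_ler_powR; rewrite ?nnegrE ?(ltW nu0) ?f0//.
    by rewrite ger0_norm; lra.
  rewrite ler_wpM2l ?powR_ge0//; apply: powR_le_far => //.
  by rewrite ger0_norm; lra.
have mg : measurable_fun D g.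
  by apply: (measurableT_comp (measurable_powR nu)); exact: measurable_minr.
have gi : mu.-integrable D (EFin \o g).
  apply: (integrable_dom mD mg _ fi) => x Dx.
  rewrite ger0_norm ?powR_ge0//; apply: ge0_ler_powR.
  - exact: ltW.
  - by rewrite nnegrE le_min f0//=; lra.
  - by rewrite nnegrE f0.
  - by rewrite ge_min lexx.
have ki := integrable_scale mD k fp.
have := le_Rintegral mD (integrable_sub mD fi ki) gi fg.
rewrite RintegralB// RintegralZl//.
set I := (\int[mu]_(x in D) f x `^ nu) in b *.
set mp := (\int[mu]_(x in D) `|f x - a| `^ p) in mpB *.
have mp0 : 0 <= mp by apply: Rintegral_ge0 => x _; exact: powR_ge0.
move=> hg; apply: le_trans hg.
have w0 : 0 <= nu / 2 * a `^ (nu - 2) by rewrite mulr_ge0 ?powR_ge0 ?divr_ge0 ?ltW.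
have hd := ler_wpM2l w0 drift.
suff hk : k * mp <= e * a `^ (nu - 2) by rewrite /e in b hk *; lra.
have -> : k * mp = a `^ (- (p - 2)) * (2 `^ nu * mp) * a `^ (nu - 2).
  have E : a `^ (nu - p) = a `^ (- (p - 2)) * a `^ (nu - 2).
    by rewrite -powRD ?(gt_eqF a_gt0) ?implybT//; congr (_ `^ _); lra.
  by rewrite /k E; ring.
rewrite ler_wpM2r ?powR_ge0//.
have := h1 _ a1a; rewrite ler_pdivlMr//; apply: le_trans.
by rewrite ler_wpM2l ?powR_ge0// ler_wpM2l ?powR_ge0//; lra.
Qed.

(** The tangent of y |-> m^2 / (m^2 + y^2) at [a] plus a quadratic term with the uniform constant 2
    / m^2. Over a common denominator the difference has the factor (b - a)^2, and the other factor
    is nonnegative because 2 a b <= a^2 + b^2. *)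
Lemma quadratic_escape (m a b : R) : 0 < m -> 0 <= a -> 0 <= b ->
  m ^+ 2 / (m ^+ 2 + b ^+ 2) <= m ^+ 2 / (m ^+ 2 + a ^+ 2)
   - 2 * m ^+ 2 / (m ^+ 2 + a ^+ 2) ^+ 2 * a * (b - a)
   + 2 / m ^+ 2 * (b - a) ^+ 2.
Proof.
move=> m0 a0 b0.
have m2 : 0 < m ^+ 2 by rewrite exprn_gt0.
have A0 : 0 < m ^+ 2 + a ^+ 2 by rewrite ltr_pwDl ?sqr_ge0.
have B0 : 0 < m ^+ 2 + b ^+ 2 by rewrite ltr_pwDl ?sqr_ge0.
rewrite -subr_ge0.
have -> : m ^+ 2 / (m ^+ 2 + a ^+ 2)
   - 2 * m ^+ 2 / (m ^+ 2 + a ^+ 2) ^+ 2 * a * (b - a)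
   + 2 / m ^+ 2 * (b - a) ^+ 2 - m ^+ 2 / (m ^+ 2 + b ^+ 2) =
   (b - a) ^+ 2 * (2 * (m ^+ 2 + a ^+ 2) ^+ 2 * (m ^+ 2 + b ^+ 2)
     - m ^+ 2 * m ^+ 2 * (a ^+ 2 + 2 * a * b - m ^+ 2)) /
   (m ^+ 2 * (m ^+ 2 + a ^+ 2) ^+ 2 * (m ^+ 2 + b ^+ 2)).
  by field; rewrite !gt_eqF.
apply: divr_ge0; last by rewrite ltW// !mulr_gt0// exprn_gt0.
apply: mulr_ge0; first exact: sqr_ge0.
have : 0 <= (a - b) ^+ 2 by exact: sqr_ge0.
set x := m ^+ 2 in m2 *.
have a2 : 0 <= a ^+ 2 by exact: sqr_ge0.
have b2 : 0 <= b ^+ 2 by exact: sqr_ge0.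
rewrite sqrrB => hab.
have : x * x * (a ^+ 2 + 2 * a * b - x) <= x * x * (2 * a ^+ 2 + b ^+ 2).
  by rewrite ler_wpM2l ?mulr_ge0 ?(ltW m2)//; lra.
suff : x * x * (2 * a ^+ 2 + b ^+ 2) <= 2 * (x + a ^+ 2) ^+ 2 * (x + b ^+ 2) by lra.
set y := a ^+ 2 in a2 *; set z := b ^+ 2 in b2 *.
rewrite -subr_ge0.
have -> : 2 * (x + y) ^+ 2 * (x + z) - x * x * (2 * y + z) =
  2 * x ^+ 3 + x ^+ 2 * z + 2 * x ^+ 2 * y + 4 * x * y * z + 2 * y ^+ 2 * x + 2 * y ^+ 2 * z by ring.
have x0 := ltW m2; have x2 := exprn_ge0 2 x0; have y2 := exprn_ge0 2 a2.
have x3 := exprn_ge0 3 x0.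
have m1 := mulr_ge0 x2 b2; have m3 := mulr_ge0 x2 a2.
have m4 := mulr_ge0 (mulr_ge0 x0 a2) b2.
have m5 := mulr_ge0 y2 x0; have m6 := mulr_ge0 y2 b2.
by clear -x3 m1 m3 m4 m5 m6; lra.
Qed.

(** The function m^2 / (m^2 + Z^2) is large near the origin, and its expectation grows by at most a
    constant over m^2 per step. A small multiple of m^2 steps therefore does not bring the process
    down from [2 * m] to [m] with large probability. *)
Lemma escape_step p B : 2 < p -> 0 <= B ->
  forall d (T : measurableType d)
    (mu : {measure set T -> \bar R}) (D : set T) (f : T -> R) a (m : R),
  measurable D -> mu D = 1%E -> measurable_fun D f ->
  (forall x, D x -> 0 <= f x) -> 0 <= a -> 0 < m ->
  mu.-integrable D (EFin \o (fun x => `|f x - a| `^ p)) ->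
  \int[mu]_(x in D) (f x - a) ^+ 2 <= B ->
  `|a * \int[mu]_(x in D) (f x - a)| <= B ->
  \int[mu]_(x in D) (m ^+ 2 / (m ^+ 2 + f x ^+ 2)) <=
    m ^+ 2 / (m ^+ 2 + a ^+ 2) + 4 * B / m ^+ 2.
Proof.
move=> p2 B0 d T mu D f a m mD muD mf f0 a0 m0 fp m2B am1B.
have m2 : 0 < m ^+ 2 by rewrite exprn_gt0.
have A0 : 0 < m ^+ 2 + a ^+ 2 by rewrite ltr_pwDl ?sqr_ge0.
have mD1 : (mu D < +oo)%E by rewrite muD ltry.
have gi : mu.-integrable D (EFin \o (fun x => m ^+ 2 / (m ^+ 2 + f x ^+ 2))).
  apply: (@integrable_bdd _ _ _ _ _ mD mD1 _ 1).
  - apply: (@measurableT_comp _ _ _ _ _ _ (fun y : R => m ^+ 2 / (m ^+ 2 + y ^+ 2))) => //.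
    apply: continuous_measurable_fun => y.
    apply: cvgM; first exact: cvg_cst.
    apply: cvgV; first by rewrite gt_eqF// ltr_pwDl ?sqr_ge0.
    by apply: cvgD; [exact: cvg_cst|exact: exprn_continuous].
  - move=> x Dx; have fx0 : 0 < m ^+ 2 + f x ^+ 2 by rewrite ltr_pwDl ?sqr_ge0.
    by rewrite ger0_norm ?divr_ge0 ?(ltW m2) ?(ltW fx0)// ler_pdivrMr// mul1r lerDl sqr_ge0.
pose k1 := - (2 * m ^+ 2 / (m ^+ 2 + a ^+ 2) ^+ 2 * a).
have Ip := integrable_dev_poly mD muD p2 mf fp (m ^+ 2 / (m ^+ 2 + a ^+ 2)) k1 (2 / m ^+ 2) 0.
have := le_Rintegral mD gi Ip => /(_ _)/wrap[].
  move=> x Dx; apply: le_trans (quadratic_escape m0 a0 (f0 _ Dx)) _.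
  by apply: eq_ler; rewrite /k1; ring.
move/le_trans; apply.
rewrite (Rintegral_dev_poly mD muD p2 mf fp) mul0r addr0 lerD2l.
have -> : 4 * B / m ^+ 2 = 2 / m ^+ 2 * B + 2 / m ^+ 2 * B by ring.
apply: lerD; last by rewrite ler_wpM2l// divr_ge0// ltW.
rewrite (le_trans (ler_norm _))// /k1 mulNr normrN -[X in `|X|]mulrA normrM.
apply: ler_pM => //.
rewrite ger0_norm; last by rewrite divr_ge0 ?mulr_ge0 ?exprn_ge0 ?(ltW m0)// ltW.
rewrite ler_pdivrMr ?exprn_gt0// mulrAC ler_pdivlMr// -mulrA ler_wpM2l//.
by rewrite -expr2; apply: lerXn2r; rewrite ?nnegrE ?(ltW m2) ?(ltW A0)// lerDl sqr_ge0.
Qed.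

End lyapunov_step.

(** * Survival of a killed kernel *)

Section survival.
Context d (T : measurableType d) (R : realType) (k : R.-pker T ~> T).
Variables (C : set T).
Hypothesis mC : measurable C.
Implicit Types (f V : T -> R) (z : T) (n : nat).

(** The probability that the chain started at [z] is in [C] at all the times 0, ..., n. Time 0
    counts, so the function vanishes off [C]. *)
Fixpoint survival (n : nat) (z : T) : R :=
  \1_C z * (if n is m.+1 then \int[k z]_(y in C) survival m y else 1).

Lemma kernel_le1 z : (k z C <= 1)%E.
Proof.
rewrite (le_trans _ (sprob_kernel_le1 k z))//.
by apply: le_measure; rewrite ?inE.
Qed.

Lemma kernel_lty z : (k z C < +oo)%E.
Proof. by rewrite (le_lt_trans (kernel_le1 z)) ?ltry. Qed.
Local Hint Resolve kernel_lty : core.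

Lemma fine_kernel_le1 z : fine (k z C) <= 1.
Proof.
rewrite -lee_fin fineK ?kernel_le1//.
by rewrite ge0_fin_numE.
Qed.

Lemma measurable_kernel_Rintegral f : measurable_fun setT f ->
  (forall z, 0 <= f z) -> measurable_fun setT (fun z => \int[k z]_(y in C) f y).
Proof.
move=> mf f0; apply: (@measurableT_comp _ _ _ _ _ _ fine) => //.
under eq_fun do rewrite integral_mkcond.
apply: measurable_fun_integral_kernel.
- by move=> U mU; exact: measurable_kernel.
- by move=> z; apply: erestrict_ge0 => y _; rewrite lee_fin.
- apply/(measurable_restrictT _ mC)/measurable_funTS.
  exact/measurable_EFinP.
Qed.

Lemma survival_spec n : [/\ measurable_fun setT (survival n),
  forall z, 0 <= survival n z & forall z, survival n z <= 1].
Proof.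
elim: n => [|n [mn n0 n1]] /=.
  split; first by under eq_fun do rewrite mulr1; exact: measurable_indic.
  - by move=> z; rewrite mulr1.
  - by move=> z; rewrite mulr1 indicE; case: (_ \in _).
have in_ z : (k z).-integrable C (EFin \o survival n).
  apply: (@integrable_bdd _ _ _ _ _ mC _ _ 1) => //.
    exact: measurable_funTS.
  by move=> y _; rewrite ger0_norm.
have i0 z : 0 <= \int[k z]_(y in C) survival n y by exact: Rintegral_ge0.
have i1 z : \int[k z]_(y in C) survival n y <= 1.
  apply: le_trans (fine_kernel_le1 z); rewrite -[leRHS]mul1r -Rintegral_cst//.
  by apply: le_Rintegral => //; exact: integrable_cst_fin.
split.
- by apply: measurable_funM; [exact: measurable_indic|exact: measurable_kernel_Rintegral].
- by move=> z; rewrite mulr_ge0.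
- by move=> z; rewrite indicE; case: (_ \in _); rewrite ?mul1r ?mul0r.
Qed.

Lemma measurable_survival n : measurable_fun setT (survival n).
Proof. by case: (survival_spec n). Qed.

Lemma survival_ge0 n z : 0 <= survival n z.
Proof. by case: (survival_spec n). Qed.

Lemma survival_le1 n z : survival n z <= 1.
Proof. by case: (survival_spec n). Qed.

Lemma integrable_survival n z : (k z).-integrable C (EFin \o survival n).
Proof.
apply: (@integrable_bdd _ _ _ _ _ mC _ _ 1) => //.
  exact/measurable_funTS/measurable_survival.
by move=> y _; rewrite ger0_norm ?survival_ge0 ?survival_le1.
Qed.

Lemma survival_out n z : ~ C z -> survival n z = 0.
Proof. by move=> Cz; case: n => [|n] /=; rewrite indicE memNset// mul0r. Qed.

Lemma survival0 z : C z -> survival 0 z = 1.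
Proof. by move=> Cz /=; rewrite indicE mem_set// mul1r. Qed.

Lemma survivalS n z : C z ->
  survival n.+1 z = \int[k z]_(y in C) survival n y.
Proof. by move=> Cz /=; rewrite indicE mem_set// mul1r. Qed.

Lemma survival_nincr n z : survival n.+1 z <= survival n z.
Proof.
have [Cz|Cz] := pselect (C z); last by rewrite !survival_out.
elim: n z Cz => [|n ih] z Cz; first by rewrite survival0// survival_le1.
rewrite !survivalS//; by apply: le_Rintegral => // *; exact: integrable_survival.
Qed.

Lemma survival_antitone m n z : (m <= n)%N -> survival n z <= survival m z.
Proof.
move=> /subnK <-; elim: (n - m)%N => // i ih.
by rewrite addSn (le_trans (survival_nincr _ _)).
Qed.

(** First-step decomposition of the expected time spent in [C] during a window of times. *)
Lemma survival_sumS m n z : C z -> \sum_(i < n) survival (m + i).+1 z =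
  \int[k z]_(y in C) (\sum_(i < n) survival (m + i) y).
Proof.
move=> Cz; elim: n => [|n ih].
  rewrite big_ord0; under eq_Rintegral do rewrite big_ord0.
  by rewrite Rintegral_cst// mul0r.
rewrite big_ord_recr ih -[LHS]/(_ + _) survivalS//.
have si j : (k z).-integrable C (EFin \o (fun y => \sum_(i < j) survival (m + i) y)).
  elim: j => [|j ihj].
    under eq_fun do rewrite /= big_ord0; exact: integrable_cst_fin.
  under eq_fun do rewrite /= big_ord_recr/=; apply: integrable_add => //.
  exact: integrable_survival.
rewrite -RintegralD//; last exact: integrable_survival.
by apply: eq_Rintegral => y _; rewrite big_ord_recr.
Qed.

End survival.

Section survival_tail.
Context d (T : measurableType d) (R : realType) (k : R.-pker T ~> T).
Variables (C : set T) (Z : T -> R).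
Hypotheses (mC : measurable C) (Z1 : forall z, C z -> 1 <= Z z).

Local Notation surv := (survival k C).

(** The integral is over [C] only: for the killed chain the power counts as 0 once [C] has been
    left. *)
Definition power_drift (s c : R) := forall z, C z ->
  (k z).-integrable C (EFin \o (fun y => Z y `^ (2 * s))) /\
  \int[k z]_(y in C) Z y `^ (2 * s) <= Z z `^ (2 * s) - c * Z z `^ (2 * s - 2).

Let Zpos z : C z -> 0 < Z z.
Proof. by move=> /Z1; apply: lt_le_trans. Qed.

(* For any level [m], the function [Z^(2s) (a + n b)] with [a = m^(2-2s) / c]
   and [b = m^(-2s)] dominates the expected time spent in [C] before [n]: below
   [m] by the drift, above [m] because it exceeds [n]. The choice [m^2 = n]
   balances the two terms. *)
Lemma survival_tail_le1 s c : 0 < s <= 1 -> 0 < c -> power_drift s c ->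
  exists2 K, 0 <= K & forall n z, C z ->
    surv n z <= K * Z z `^ (2 * s) * n.+1%:R `^ (- s).
Proof.
move=> /andP[s0 s1] c0 drift.
have green m n z : 0 < m -> C z -> \sum_(i < n) surv i z <=
    Z z `^ (2 * s) * (m `^ (2 - 2 * s) / c + n%:R * m `^ (- (2 * s))).
  move=> m0; pose a := m `^ (2 - 2 * s) / c; pose b := m `^ (- (2 * s)).
  have a0 : 0 <= a by rewrite divr_ge0 ?powR_ge0 ?ltW.
  have b0 : 0 <= b by exact: powR_ge0.
  rewrite -/a -/b; elim: n z => [|n ih] z Cz.
    by rewrite big_ord0 mulr_ge0 ?powR_ge0// mul0r addr0.
  have [mZ|Zm] := leP m (Z z).
    have Zb : 1 <= Z z `^ (2 * s) * b.
      rewrite /b powRN -ler_pdivrMr ?invr_gt0 ?powR_gt0// invrK mul1r.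
      by apply: ge0_ler_powR; rewrite ?nnegrE ?(ltW (Zpos Cz)) ?(ltW m0)//; lra.
    rewrite (@le_trans _ _ n.+1%:R)//.
      rewrite (@le_trans _ _ (\sum_(i < n.+1) 1))//.
        by apply: ler_sum => i _; exact: survival_le1.
      by rewrite sumr_const card_ord.
    rewrite (@le_trans _ _ (n.+1%:R * (Z z `^ (2 * s) * b)))//.
      by rewrite ler_peMr.
    by rewrite mulrDr [leRHS]addrC mulrCA lerDl mulr_ge0// powR_ge0.
  rewrite big_ord_recl survival0//.
  have -> : \sum_(i < n) surv (lift ord0 i) z =
    \int[k z]_(y in C) (\sum_(i < n) surv i y) by exact: (survival_sumS k mC 0 n Cz).
  have [Vi Vd] := drift z Cz.
  have Si : (k z).-integrable C (EFin \o (fun y => \sum_(i < n) surv i y)).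
    apply: (@integrable_bdd _ _ _ _ _ mC (kernel_lty k mC z) _ n%:R).
      apply/measurable_funTS/measurable_sum => i; exact: measurable_survival.
    move=> y _; rewrite ger0_norm ?sumr_ge0// => [|i _]; last exact: survival_ge0.
    rewrite (@le_trans _ _ (\sum_(i < n) 1))//.
      by apply: ler_sum => i _; exact: survival_le1.
    by rewrite sumr_const card_ord.
  have ab0 : 0 <= a + n%:R * b by rewrite addr_ge0// mulr_ge0.
  have := le_Rintegral mC Si (integrable_scale mC (a + n%:R * b) Vi) => /(_ _)/wrap[].
    by move=> y Cy; rewrite [leRHS]mulrC; exact: ih.
  rewrite RintegralZl// => h.
  have h1 : a * (c * Z z `^ (2 * s - 2)) >= 1.
    rewrite /a mulrA divfK ?gt_eqF//.
    have -> : 2 * s - 2 = - (2 - 2 * s) by lra.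
    rewrite powRN ler_pdivlMr ?powR_gt0 ?Zpos// mul1r.
    apply: ge0_ler_powR; rewrite ?nnegrE ?(ltW (Zpos Cz)) ?(ltW m0) ?(ltW Zm)//.
    by lra.
  have h2 : 0 <= n%:R * b * (c * Z z `^ (2 * s - 2)).
    by rewrite !mulr_ge0 ?powR_ge0 ?(ltW c0).
  have := ler_wpM2l ab0 Vd.
  have h3 : 0 <= Z z `^ (2 * s) * b by rewrite mulr_ge0 ?powR_ge0.
  rewrite -natr1; lra.
exists (c^-1 + 1); first by rewrite addr_ge0 ?invr_ge0 ?ltW.
move=> n z Cz.
have n0 : 0 < n.+1%:R :> R by rewrite ltr0n.
(* Survival probabilities decrease in time, so the last one is at most the average over the
   window. *)
have h1 : n.+1%:R * surv n z <= \sum_(i < n.+1) surv i z.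
  rewrite mulr_natl -[X in _ *+ X]card_ord -sumr_const.
  apply: ler_sum => i _; apply: survival_antitone => //.
  by rewrite -ltnS.
have m0 : 0 < n.+1%:R `^ 2^-1 :> R by rewrite powR_gt0.
have := le_trans h1 (green _ n.+1 z m0 Cz).
rewrite -!powRrM.
have -> : 2^-1 * (2 - 2 * s) = 1 - s by field.
have -> : 2^-1 * - (2 * s) = - s by field.
have -> : n.+1%:R `^ (1 - s) = n.+1%:R * n.+1%:R `^ (- s) :> R.
  by rewrite powRD ?(gt_eqF n0) ?implybT// powRr1 ?ltW.
move=> h; rewrite -(ler_pM2l n0); apply: le_trans h _.
rewrite le_eqVlt; apply/orP; left; apply/eqP; ring.
Qed.

(** The known decay bounds survival up to time n by a multiple of Z^(2 s - 2), which the drift of A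
    Z^(2 s) compensates. So A Z^(2 s) dominates the expected time spent in [C] after n; since
    survival decreases, dividing by the length of the window gains one more factor 1/n. *)
Lemma survival_tail_step s c K : 1 < s -> 0 < c -> power_drift s c -> 0 <= K ->
  (forall n z, C z ->
    surv n z <= K * Z z `^ (2 * (s - 1)) * n.+1%:R `^ (- (s - 1))) ->
  exists2 K', 0 <= K' & forall n z, C z ->
    surv n z <= K' * Z z `^ (2 * s) * n.+1%:R `^ (- s).
Proof.
move=> s1 c0 drift K0 hK.
have green n j z : C z -> \sum_(i < j) surv (n + i) z <=
    K * n.+1%:R `^ (- (s - 1)) / c * Z z `^ (2 * s).
  set A := K * n.+1%:R `^ (- (s - 1)) / c.
  have A0 : 0 <= A by rewrite divr_ge0 ?mulr_ge0 ?powR_ge0 ?(ltW c0).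
  elim: j z => [|j ih] z Cz.
    by rewrite big_ord0 mulr_ge0 ?powR_ge0.
  rewrite big_ord_recl addn0.
  have -> : \sum_(i < j) surv (n + lift ord0 i) z = \sum_(i < j) surv (n + i).+1 z.
    by apply: eq_bigr => i _; rewrite lift0 addnS.
  rewrite survival_sumS//.
  have [Vi Vd] := drift z Cz.
  have Si : (k z).-integrable C (EFin \o (fun y => \sum_(i < j) surv (n + i) y)).
    apply: (@integrable_bdd _ _ _ _ _ mC (kernel_lty k mC z) _ j%:R).
      apply/measurable_funTS/measurable_sum => i; exact: measurable_survival.
    move=> y _; rewrite ger0_norm ?sumr_ge0// => [|i _]; last exact: survival_ge0.
    rewrite (@le_trans _ _ (\sum_(i < j) 1))//.
      by apply: ler_sum => i _; exact: survival_le1.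
    by rewrite sumr_const card_ord.
  have := le_Rintegral mC Si (integrable_scale mC A Vi) => /(_ _)/wrap[].
    by move=> y Cy; exact: ih.
  rewrite RintegralZl// => h1.
  have := hK n z Cz.
  have -> : K * Z z `^ (2 * (s - 1)) * n.+1%:R `^ (- (s - 1)) =
            A * (c * Z z `^ (2 * s - 2)).
    have -> : 2 * (s - 1) = 2 * s - 2 by lra.
    by rewrite /A; field; rewrite gt_eqF.
  have := ler_wpM2l A0 Vd; lra.
exists (K / c * 2 `^ s).
  by rewrite mulr_ge0 ?powR_ge0// divr_ge0// ltW.
move=> N z Cz.
pose n := N./2.
have n0 : 0 < n.+1%:R :> R by rewrite ltr0n.
have N0 : 0 < N.+1%:R :> R by rewrite ltr0n.
have h1 : n.+1%:R * surv N z <= \sum_(i < n.+1) surv (n + i) z.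
  rewrite mulr_natl -[X in _ *+ X]card_ord -sumr_const.
  apply: ler_sum => i _; apply: survival_antitone => //.
  have hN : (n + n <= N)%N by rewrite addnn /n -{2}(odd_double_half N) leq_addl.
  by rewrite (leq_trans _ hN)// leq_add2l -ltnS.
have := le_trans h1 (green n n.+1 z Cz).
have -> : n.+1%:R `^ (- (s - 1)) = n.+1%:R * n.+1%:R `^ (- s) :> R.
  rewrite opprB powRD ?(gt_eqF n0) ?implybT// powRr1 ?ltW//.
have -> : K * (n.+1%:R * n.+1%:R `^ (- s)) / c * Z z `^ (2 * s) =
  n.+1%:R * (K / c * Z z `^ (2 * s) * n.+1%:R `^ (- s)) by ring.
rewrite ler_pM2l// => /le_trans; apply.
have -> : K / c * 2 `^ s * Z z `^ (2 * s) * N.+1%:R `^ (- s) =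
   K / c * Z z `^ (2 * s) * (2 `^ s * N.+1%:R `^ (- s)) by ring.
rewrite ler_wpM2l ?mulr_ge0 ?powR_ge0 ?invr_ge0 ?(ltW c0)//.
have s0 : 0 <= s by lra.
rewrite !powRN -[leLHS]mul1r ler_pdivrMr ?powR_gt0// mulrAC.
rewrite ler_pdivlMr ?powR_gt0// mul1r -powRM ?(ltW n0)//.
apply: ge0_ler_powR; rewrite ?nnegrE ?mulr_ge0 ?(ltW n0) ?(ltW N0)//.
rewrite -natrM ler_nat mul2n.
by rewrite doubleS ltnS /n -{1}(odd_double_half N) -add1n leq_add2r leq_b1.
Qed.

(** The exponent is lowered by 1 until it is at most 1, hence the drift hypothesis for all the
    positive [s - j]. Both the base case and the climb back use it for [j = 0]. *)
Lemma survival_tail s : 0 < s ->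
  (forall j : nat, 0 < s - j%:R -> exists2 c, 0 < c & power_drift (s - j%:R) c) ->
  exists2 K, 0 <= K & forall n z, C z ->
    surv n z <= K * Z z `^ (2 * s) * n.+1%:R `^ (- s).
Proof.
move=> s0 drift.
have [N sN] : exists N : nat, s <= N.+1%:R.
  by exists (Num.truncn s); rewrite ltW ?truncnS_gt.
elim: N s s0 sN drift => [|N ih] s s0 sN drift.
  have [|c c0 Dc] := drift 0%N; rewrite ?subr0//.
  by rewrite subr0 in Dc; apply: (@survival_tail_le1 s c) => //; rewrite s0.
have [s1|s1] := leP s 1.
  have [|c c0 Dc] := drift 0%N; rewrite ?subr0//.
  by rewrite subr0 in Dc; apply: (@survival_tail_le1 s c) => //; rewrite s0.
have [|||K K0 hK] := ih (s - 1).
- by lra.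
- by move: sN; rewrite -natr1; lra.
- move=> j; rewrite -addrA -opprD nat1r; exact: drift.
have [|c c0 Dc] := drift 0%N; rewrite ?subr0//.
by rewrite subr0 in Dc; apply: (@survival_tail_step s c K).
Qed.

End survival_tail.

(** * Lower bounds on survival *)

Section survival_lower.
Context d (T : measurableType d) (R : realType) (k : R.-pker T ~> T).
Variables (C : set T).
Hypotheses (mC : measurable C).
Local Notation surv := (survival k C).

(** A function bounded by 1 that loses at most [c] per step on average has lost at most [n * c]
    after n steps. The accumulated loss is integrated over [C], whose mass is at most 1. *)
Lemma survival_ge_linear (G : T -> R) (c : R) : 0 <= c ->
  (forall z, C z -> G z <= 1) ->
  (forall z, C z -> (k z).-integrable C (EFin \o G)) ->
  (forall z, C z -> G z - c <= \int[k z]_(y in C) G y) ->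
  forall n z, C z -> G z - n%:R * c <= surv n z.
Proof.
move=> c0 G1 Gi Gd; elim=> [|n ih] z Cz.
  by rewrite mul0r subr0 survival0// G1.
rewrite survivalS//.
have ci := integrable_cst_fin mC (kernel_lty k mC z) (n%:R * c).
have := le_Rintegral mC (integrable_sub mC (Gi z Cz) ci)
  (integrable_survival k mC n z) ih.
apply: le_trans; rewrite RintegralB//; last exact: Gi.
rewrite Rintegral_cst// -natr1 mulrDl mul1r.
have := Gd z Cz; have := fine_kernel_le1 k mC z.
have nc : 0 <= n%:R * c by rewrite mulr_ge0.
by move=> /(ler_wpM2l nc); lra.
Qed.

(** Optional stopping without stopping times: [W] is a submartingale until a state is met from which
    [N] further steps are survived with probability at least [W]. When the level is met does not
    matter, because survival of [N] steps implies survival of the fewer steps that remain. *)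
Lemma survival_ge_stationary (W : T -> R) (N : nat) :
  (forall z, C z -> W z <= 1) ->
  (forall z, C z -> (k z).-integrable C (EFin \o W)) ->
  (forall z, C z -> W z <= surv N z \/ W z <= \int[k z]_(y in C) W y) ->
  forall z, C z -> W z <= surv N z.
Proof.
move=> W1 Wi Wd z Cz; have : (N <= N)%N by [].
elim: {-2}N z Cz => [|n ih] z Cz nN; first by rewrite survival0// W1.
have [h|h] := Wd z Cz; first by rewrite (le_trans h)// survival_antitone.
rewrite survivalS// (le_trans h)//; apply: le_Rintegral => //.
- exact: Wi.
- exact: integrable_survival.
- by move=> y Cy; apply: ih => //; exact: ltnW.
Qed.

End survival_lower.

(** * From the process to its kernel *)

Section mixture.
Context dW dY dZ (W : measurableType dW) (Y : measurableType dY)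
  (Z : measurableType dZ) (R : realType).
Variables (nu : {measure set W -> \bar R}) (k : W -> {measure set Y -> \bar R}).
Variables (g : W * Y -> Z) (m : {measure set Z -> \bar R}).
Local Open Scope ereal_scope.
Hypothesis mg : measurable_fun setT g.
Hypothesis mk : forall phi : Z -> \bar R, (forall z, 0 <= phi z) ->
  measurable_fun setT phi ->
  measurable_fun setT (fun w => \int[k w]_y phi (g (w, y))).
Hypothesis mE : forall A, measurable A ->
  m A = \int[nu]_w \int[k w]_y (\1_A (g (w, y)))%:E.

Let mgw w : measurable_fun setT (fun y => g (w, y)).
Proof. exact: measurable_fun_pair2. Qed.

Import HBNNSimple.

Let mixture_nnsfun (f : {nnsfun Z >-> R}) :
  \int[m]_z (f z)%:E = \int[nu]_w \int[k w]_y (f (g (w, y)))%:E.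
Proof.
have fE z : (f z)%:E = \sum_(r \in range f) (r * \1_(f @^-1` [set r]) z)%:E.
  by rewrite fimfunE -fsumEFin.
have f_ge0 r z : 0 <= (r * \1_(f @^-1` [set r]) z)%:E.
  by rewrite EFinM nnfun_muleindic_ge0.
have m1 r : measurable_fun setT (fun z => (\1_(f @^-1` [set r]) z)%:E : \bar R).
  exact/measurable_EFinP/measurable_indic.
have mr r : measurable_fun setT (fun z => (r * \1_(f @^-1` [set r]) z)%:E : \bar R).
  by apply/measurable_EFinP/measurable_funM => //; exact/measurable_EFinP/m1.
under eq_integral do rewrite fE.
rewrite ge0_integral_fsum//.
under [RHS]eq_integral => w _.
  under eq_integral do rewrite fE.
  rewrite ge0_integral_fsum//; last by move=> r; exact: measurableT_comp (mr r) (mgw w).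
  over.
rewrite /= ge0_integral_fsum//; last 2 first.
- by move=> r; exact: (mk (f_ge0 r)).
- by move=> r w _; apply: integral_ge0 => y _.
apply: eq_fsbigr => r /set_mem[z0 _ zr].
have r0 : (0 <= r)%R by rewrite -zr.
under eq_integral do rewrite EFinM.
rewrite ge0_integralZl//.
rewrite integral_indic// setIT mE//.
rewrite -ge0_integralZl//; last 2 first.
- apply: (mk (phi := fun z => (\1_(f @^-1` [set r]) z)%:E)) => //.
- by move=> w _; apply: integral_ge0.
apply: eq_integral => w _; under [RHS]eq_integral do rewrite EFinM.
by rewrite ge0_integralZl//; exact: measurableT_comp (m1 r) (mgw w).
Qed.

(** From indicators to simple functions, then monotone limits in both integrals. Measurability of
    the inner integrals is the hypothesis [mk], so [k] may be any family of measures. *)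
Lemma mixture_integral (phi : Z -> \bar R) : (forall z, 0 <= phi z) ->
  measurable_fun setT phi ->
  \int[m]_z phi z = \int[nu]_w \int[k w]_y phi (g (w, y)).
Proof.
move=> phi0 mphi; pose f := nnsfun_approx measurableT mphi.
have mf n : measurable_fun setT (fun z => (f n z)%:E) by exact/measurable_EFinP.
have f0 n z : 0 <= (f n z)%:E by rewrite lee_fin.
have ndf z a b : (a <= b)%N -> (f a z)%:E <= (f b z)%:E.
  by move=> ab; rewrite lee_fin; exact/lefP/nd_nnsfun_approx.
have cvf z : (f n z)%:E @[n --> \oo] --> phi z by exact: cvg_nnsfun_approx.
have h w : \int[k w]_y (f n (g (w, y)))%:E @[n --> \oo] -->
    \int[k w]_y phi (g (w, y)).
  rewrite [X in _ --> X](_ : _ = \int[k w]_y limn (fun n => (f n (g (w, y)))%:E)).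
    apply: cvg_monotone_convergence => //.
    - by move=> n; exact: measurableT_comp (mf n) (mgw w).
    - by move=> y _ a b; exact: ndf.
  by apply: eq_integral => y _; apply/esym/cvg_lim => //; exact: cvf.
transitivity (limn (fun n => \int[m]_z (f n z)%:E)).
  rewrite -monotone_convergence//; last by move=> z _ a b; exact: ndf.
  by apply: eq_integral => z _; apply/esym/cvg_lim => //; exact: cvf.
transitivity (limn (fun n => \int[nu]_w \int[k w]_y (f n (g (w, y)))%:E)).
  by congr (limn _); apply/funext => n; exact: mixture_nnsfun.
rewrite -monotone_convergence//.
- by apply: eq_integral => w _; apply/cvg_lim => //; exact: h.
- by move=> n; exact: (mk (f0 n)).
- by move=> n w _; exact: integral_ge0.
- move=> w _ a b ab; apply: ge0_le_integral => //.
  + exact: measurableT_comp (mf a) (mgw w).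
  + exact: measurableT_comp (mf b) (mgw w).
  + by move=> y _; exact: ndf.
Qed.

End mixture.

Section mixture_measure.
Context dW dY dZ (W : measurableType dW) (Y : measurableType dY)
  (Z : measurableType dZ) (R : realType).
Variables (nu : {measure set W -> \bar R}) (k : W -> {measure set Y -> \bar R}).
Variables (g : W * Y -> Z).
Local Open Scope ereal_scope.
Hypothesis mg : measurable_fun setT g.
Hypothesis mk : forall phi : Z -> \bar R, (forall z, 0 <= phi z) ->
  measurable_fun setT phi ->
  measurable_fun setT (fun w => \int[k w]_y phi (g (w, y))).

(** The two proofs are arguments of the term so that the measure structure, which depends on them,
    can be attached to it. *)
Definition mixture of measurable_fun setT g &
    (forall phi : Z -> \bar R, (forall z, 0 <= phi z) -> measurable_fun setT phi ->
      measurable_fun setT (fun w => \int[k w]_y phi (g (w, y)))) :=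
  fun A : set Z => \int[nu]_w \int[k w]_y (\1_A (g (w, y)))%:E.

Local Notation mix := (mixture mg mk).

Let mix0 : mix set0 = 0.
Proof. by apply: integral0_eq => w _; apply: integral0_eq => y _; rewrite indicE in_set0. Qed.

Let mix_ge0 A : 0 <= mix A.
Proof. by apply: integral_ge0 => w _; apply: integral_ge0 => y _; rewrite lee_fin. Qed.

Let mix_sigma_additive : semi_sigma_additive mix.
Proof.
move=> A mA tA mUA.
have m1 n : measurable_fun setT (fun z => (\1_(A n) z)%:E : \bar R).
  exact/measurable_EFinP/measurable_indic.
have m1g n w : measurable_fun setT (fun y => (\1_(A n) (g (w, y)))%:E : \bar R).
  by apply: (measurableT_comp (m1 n)); exact: measurable_fun_pair2.
have -> : mix (\bigcup_n A n) = \sum_(n <oo) mix (A n).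
  rewrite /mixture -integral_nneseries//.
  - apply: eq_integral => w _; rewrite -integral_nneseries//.
    by apply: eq_integral => y _; rewrite indic_bigcup.
  - by move=> n; apply: (mk (phi := fun z => (\1_(A n) z)%:E)) => // z; rewrite lee_fin.
  - by move=> n w _; apply: integral_ge0.
by apply: is_cvg_nneseries.
Qed.

HB.instance Definition _ := isMeasure.Build _ _ _ mix mix0 mix_ge0 mix_sigma_additive.

End mixture_measure.

Section kernel_at_map.
Context dW dX dY (W : measurableType dW) (X : measurableType dX)
  (Y : measurableType dY) (R : realType).
Variables (k : R.-pker X ~> Y) (f : W -> X).
Hypothesis mf : measurable_fun setT f.

(** The proof of measurability is an argument so that the kernel structure can be attached to the
    term. *)
Definition kernel_map of measurable_fun setT f : W -> {measure set Y -> \bar R} :=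
  fun w => k (f w).

Let kernel_map_measurable U : measurable U ->
  measurable_fun setT (kernel_map mf ^~ U).
Proof. by move=> mU; exact: measurableT_comp (measurable_kernel k U mU) mf. Qed.

HB.instance Definition _ :=
  isKernel.Build _ _ _ _ R (kernel_map mf) kernel_map_measurable.

Let kernel_map_prob w : kernel_map mf w setT = 1%E.
Proof. exact: prob_kernel. Qed.

HB.instance Definition _ :=
  Kernel_isProbability.Build _ _ _ _ R (kernel_map mf) kernel_map_prob.

End kernel_at_map.

Section process.
Context d (Omega : measurableType d) (R : realType) (P : probability Omega R).
Context (S : pmetricType R) (F : nat -> set (set Omega)).
Context (Ks : R.-pker strip R S ~> strip R S) (z0 : strip R S).
Context (xi : nat -> Omega -> strip R S).
Hypothesis hp : half_strip_process P F Ks z0 xi.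
Local Open Scope ereal_scope.

Lemma filtration_measurable n A : F n A -> measurable A.
Proof. by case: (process_filtration hp) => /(_ n)[_ h] _; exact: h. Qed.

Lemma measurable_process n : measurable_fun setT (xi n).
Proof.
move=> _ B mB; rewrite setTI; apply: (@filtration_measurable n).
exact: (process_adapted hp).
Qed.

Let OF n := g_sigma_algebraType (F n).

Lemma filtration_generated n : (@measurable _ (OF n)) = F n.
Proof.
by case: (process_filtration hp) => /(_ n)[sF _] _; exact: sigma_algebra_id.
Qed.

(** What is known at time n may be frozen while the next state is integrated against the kernel. On
    rectangles this is the Markov property; they are stable under intersection and generate the
    product of [F n] with the sigma-algebra of the strip, so two finite measures that agree on them
    are equal. Giving the first factor the sigma-algebra [F n] expresses adaptedness as
    measurability. *)
Lemma process_freezing n (phi : OF n * strip R S -> \bar R) :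
  (forall x, 0 <= phi x) -> measurable_fun setT phi ->
  \int[P]_w phi (w, xi n.+1 w) = \int[P]_w \int[Ks (xi n w)]_z phi (w, z).
Proof.
move=> phi0 mphi.
pose g (x : Omega * strip R S) : OF n * strip R S := x.
have mid : measurable_fun setT (fun w : Omega => w : OF n).
  move=> _ B; rewrite setTI filtration_generated; exact: filtration_measurable.
have mg : measurable_fun setT g.
  apply/measurable_fun_pairP; split.
    exact: measurableT_comp mid measurable_fst.
  exact: measurable_snd.
pose k := kernel_map Ks (measurable_process n).
have mk (psi : OF n * strip R S -> \bar R) : (forall z, 0 <= psi z) ->
    measurable_fun setT psi ->
    measurable_fun setT (fun w => \int[k w]_y psi (g (w, y))).
  move=> psi0 mpsi.
  apply: (measurable_fun_integral_finite_kernel (fun x => psi (g x)) k) => //.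
  exact: measurableT_comp.
pose h w : OF n * strip R S := (w, xi n.+1 w).
have mh : measurable_fun setT h.
  by apply/measurable_fun_pairP; split => //; exact: measurable_process.
pose m := pushforward P h.
have mE A : measurable A -> m A = mixture P mg mk A.
  pose G := [set A `*` B | A in @measurable _ (OF n) & B in @measurable _ (strip R S)].
  move=> mA; apply: (@measure_unique _ _ _ G (fun=> setT)) => //.
  - exact: measurable_prod_measurableType.
  - move=> _ _ [A1 mA1 [B1 mB1 <-]] [A2 mA2 [B2 mB2 <-]]; rewrite -setXI.
    exists (A1 `&` A2); first exact: measurableI.
    by exists (B1 `&` B2) => //; exact: measurableI.
  - by move=> _; exists setT => //; exists setT => //; rewrite setXTT.
  - by rewrite bigcup_const.
  - move=> _ [B FB [C mC <-]]; rewrite filtration_generated in FB.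
    have [_ /(_ B FB)] := process_markov hp n mC.
    have mB := filtration_measurable FB.
    rewrite integral_indic//; last first.
      by rewrite -[X in measurable X]setTI; exact: measurable_process.
    have hBC : h @^-1` (B `*` C) = xi n.+1 @^-1` C `&` B.
      by apply/seteqP; split => w [].
    move=> hK; apply: (etrans (congr1 P hBC)); rewrite -hK.
    rewrite /mixture integral_mkcond; apply: eq_integral => w _.
    rewrite patchE; case: ifPn => [wB|wB].
      transitivity (\int[Ks (xi n w)]_y (\1_C y)%:E).
        by rewrite integral_indic// setIT.
      apply: eq_integral => y _.
      rewrite !indicE; congr ((nat_of_bool _)%:R%:E).
      by apply/idP/idP; rewrite !inE /g /=; [move=> Cy; split => //; exact: set_mem|case].
    rewrite integral0_eq// => y _; rewrite indicE memNset// /g /= => -[Bw _].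
    by move: wB; rewrite notin_setE.
  - by move=> _; rewrite /m /= /pushforward preimage_setT probability_setT ltry.
have e1 := @mixture_integral _ _ _ _ _ _ _ P k g m mg mk mE phi phi0 mphi.
have e2 := ge0_integral_pushforward mh P measurableT mphi (fun y _ => phi0 y).
exact: (etrans (esym e2) (e1 mh)).
Qed.

End process.

Section process_survival.
Context d (Omega : measurableType d) (R : realType) (P : probability Omega R).
Context (S : pmetricType R) (F : nat -> set (set Omega)).
Context (Ks : R.-pker strip R S ~> strip R S) (z0 : strip R S).
Context (xi : nat -> Omega -> strip R S).
Hypothesis hp : half_strip_process P F Ks z0 xi.
Local Open Scope ereal_scope.

Lemma filtration_mono m n : (m <= n)%N -> F m `<=` F n.
Proof.
case: (process_filtration hp) => _ h /subnK <-.
elim: (n - m)%N => // i ih; rewrite addSn; exact: subset_trans ih (h _).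
Qed.

Lemma filtrationI n A B : F n A -> F n B -> F n (A `&` B).
Proof.
rewrite -(filtration_generated hp) => FA FB.
by apply: (@measurableI _ (g_sigma_algebraType (F n))).
Qed.

Definition stay (C : set (strip R S)) n := [set w | forall k, (k <= n)%N -> C (xi k w)].

Lemma stay0 C : stay C 0 = xi 0%N @^-1` C.
Proof. by apply/seteqP; split => w; [exact|move=> h k; rewrite leqn0 => /eqP ->]. Qed.

Lemma stayS C n : stay C n.+1 = stay C n `&` (xi n.+1 @^-1` C).
Proof.
apply/seteqP; split => w.
  by move=> h; split; [move=> k kn; exact/h/leqW|exact: h].
by move=> [h1 h2] k; rewrite leq_eqVlt => /predU1P[->//|]; rewrite ltnS; exact: h1.
Qed.

Lemma stay_filtration C n : measurable C -> F n (stay C n).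
Proof.
move=> mC; elim: n => [|n ih]; first by rewrite stay0; exact: (process_adapted hp).
rewrite stayS; apply: filtrationI; last exact: (process_adapted hp).
exact: filtration_mono ih.
Qed.

Lemma measurable_stay C n : measurable C -> measurable (stay C n).
Proof. by move=> mC; apply: (filtration_measurable hp (n := n)); exact: stay_filtration. Qed.

(** Induction on the remaining time [j] with [n] arbitrary: the event [stay C n] is known at time n
    and is frozen, while the factor [\1_C] at the next state extends it to [stay C n.+1]. *)
Lemma stay_survival_shift C n j : measurable C ->
  \int[P]_w (\1_(stay C n) w * survival Ks C j (xi n w))%:E = P (stay C (n + j)).
Proof.
move=> mC; elim: j n => [|j ih] n.
  rewrite addn0 -[in RHS](setIT (stay C n)) -integral_indic//; last exact: measurable_stay.
  apply: eq_integral => w _; congr _%:E; rewrite /= mulr1 !indicE.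
  have [/set_mem wn|] := boolP (w \in stay C n); last by rewrite mul0r.
  by rewrite mul1r mem_set//; exact: wn.
rewrite addnS -addSn -ih.
pose phi (x : g_sigma_algebraType (F n) * strip R S) : \bar R :=
  (\1_(stay C n) x.1 * (\1_C x.2 * survival Ks C j x.2))%:E.
have phi0 x : 0 <= phi x by rewrite lee_fin !mulr_ge0// survival_ge0.
have mphi : measurable_fun setT phi.
  apply/measurable_EFinP/measurable_funM.
    apply: (@measurableT_comp _ _ _ _ _ _ (\1_(stay C n) : g_sigma_algebraType (F n) -> R)) => //.
    by apply: measurable_indic; rewrite (filtration_generated hp); exact: stay_filtration.
  apply: (@measurableT_comp _ _ _ _ _ _ (fun z => \1_C z * survival Ks C j z)%R) => //.
  by apply: measurable_funM; [exact: measurable_indic|exact: measurable_survival].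
transitivity (\int[P]_w \int[Ks (xi n w)]_z phi (w, z)).
  apply: eq_integral => w _; rewrite /phi/=.
  have [wn|wn] := pselect (stay C n w); last first.
    rewrite indicE memNset//= mulr0n mul0r integral0_eq// => z _.
    by rewrite mul0r.
  have Cw : C (xi n w) by exact: wn.
  rewrite indicE mem_set// !mul1r indicE mem_set//= mul1r /Rintegral fineK; last first.
    by apply: integrable_fin_num => //; exact: integrable_survival.
  rewrite integral_mkcond; apply: eq_integral => z _.
  by rewrite patchE !indicE mul1r; case: ifPn => _; rewrite ?mul1r ?mul0r.
rewrite -(process_freezing hp phi0 mphi); apply: eq_integral => w _.
rewrite /phi/= stayS !indicE in_setI mulrA; congr (_ * _)%:E.
by rewrite -natrM mulnb; congr (nat_of_bool (_ && _))%:R; apply/idP/idP; rewrite !inE.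
Qed.

Lemma stay_survival C n : measurable C -> P (stay C n) = (survival Ks C n z0)%:E.
Proof.
move=> mC; rewrite -[n in LHS]add0n -stay_survival_shift//.
transitivity (\int[P]_w (cst (survival Ks C n z0)%:E) w).
  apply: eq_integral => w _; rewrite (process_init hp) stay0/=; congr _%:E.
  have [Cz|Cz] := pselect (C z0); last by rewrite survival_out// mulr0.
  by rewrite indicE mem_set ?mul1r//=; rewrite (process_init hp).
by rewrite integral_cst// [X in _ * X](_ : _ = 1) ?mule1//; exact: probability_setT.
Qed.

Definition sure n (A : set (strip R S)) := P (xi n @^-1` (~` A)) = 0.

Lemma process_next n A : measurable A ->
  \int[P]_w Ks (xi n w) A = P (xi n.+1 @^-1` A).
Proof.
move=> mA.
have [_ /(_ setT)] := process_markov hp n mA.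
have FT : F n setT by rewrite -(filtration_generated hp).
move=> /(_ FT) ->; rewrite integral_indic ?setIT//.
by rewrite -[X in measurable X]setTI; exact: (measurable_process hp).
Qed.

Lemma measurable_preimage n A : measurable A -> measurable (xi n @^-1` A).
Proof. by move=> mA; rewrite -[X in measurable X]setTI; exact: (measurable_process hp). Qed.

Lemma sure_next n A : measurable A -> sure n.+1 A ->
  sure n [set z | Ks z (~` A) = 0].
Proof.
move=> mA; rewrite /sure -process_next; last exact: measurableC.
move=> h0.
have mK : measurable_fun setT (fun z => Ks z (~` A)).
  by apply: measurable_kernel; exact: measurableC.
have mf : measurable_fun setT (fun w => Ks (xi n w) (~` A)).
  exact: measurableT_comp mK (measurable_process hp n).
have [h _] := ae_eq_integral_abs P measurableT mf.
have /h[N [mN PN NE]] : \int[P]_w `|Ks (xi n w) (~` A)| = 0.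
  by rewrite -[RHS]h0; apply: eq_integral => w _; rewrite gee0_abs.
apply/negligibleP.
  apply: measurable_preimage; apply: measurableC.
  rewrite -[X in measurable X]setTI; exact: (mK measurableT _ (emeasurable_set1 0)).
exists N; split => // w Kw; apply: NE => /= /(_ I) K0; exact: Kw.
Qed.

Lemma sure_bigcap n (A : nat -> set (strip R S)) : (forall k, measurable (A k)) ->
  (forall k, sure n (A k)) -> sure n (\bigcap_k A k).
Proof.
move=> mA sA; rewrite /sure.
have mAn k : measurable (xi n @^-1` (~` A k)).
  by apply: measurable_preimage; exact: measurableC.
apply/negligibleP.
  by apply: measurable_preimage; apply/measurableC/bigcap_measurable.
rewrite setC_bigcap preimage_bigcup; apply: negligible_bigcup => k.
by apply/(negligibleP _ (mAn k)); exact: sA.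
Qed.

Lemma sure_setI n A B : measurable A -> measurable B -> sure n A -> sure n B ->
  sure n (A `&` B).
Proof.
move=> mA mB sA sB; rewrite -bigcap2E; apply: sure_bigcap => -[|[|k]]//=.
by rewrite /sure setCT preimage_set0 measure0.
Qed.

(** The start is deterministic, so the preimage of a set at time 0 is either everything or empty. *)
Lemma sure_init A : measurable A -> sure 0 A -> A z0.
Proof.
move=> mA; rewrite /sure => h; apply: contrapT => Az.
have E : xi 0%N @^-1` (~` A) = setT.
  by apply/seteqP; split => // w _ /=; rewrite (process_init hp).
by move: h; rewrite E probability_setT => /eqP; rewrite onee_eq0.
Qed.

End process_survival.

Section abscissa.
Context (R : realType) (S : pmetricType R).

Lemma measurable_abscissa (A : set (measurableTypeR R)) : measurable A ->
  measurable [set z : strip R S | A z.1].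
Proof.
move=> mA; rewrite (_ : mkset _ = A `*` [set: borel S]); first exact: measurableX.
by apply/seteqP; split => z /=; [|case].
Qed.

Lemma measurable_abscissa_ge (x : R) : measurable [set z : strip R S | x <= z.1].
Proof.
rewrite (_ : mkset _ = [set z : strip R S | `[x, +oo[%classic z.1]); last first.
  by apply/seteqP; split => z; rewrite /= in_itv /= andbT.
exact: measurable_abscissa (measurable_itv _).
Qed.

Lemma measurable_abscissa_gt (x : R) : measurable [set z : strip R S | x < z.1].
Proof.
rewrite (_ : mkset _ = [set z : strip R S | `]x, +oo[%classic z.1]); last first.
  by apply/seteqP; split => z; rewrite /= in_itv /= andbT.
exact: measurable_abscissa (measurable_itv _).
Qed.

End abscissa.

Section good_states.
Context (R : realType) (S : pmetricType R) (Ks : R.-pker strip R S ~> strip R S).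
Variables (p xB b : R).
Local Open Scope ereal_scope.

Definition kernel_moment (z : strip R S) : \bar R :=
  \int[Ks z]_y (`|y.1 - z.1| `^ p)%:E.

Lemma measurable_kernel_moment : measurable_fun setT kernel_moment.
Proof.
apply: (measurable_fun_integral_finite_kernel
  (fun x : strip R S * strip R S => (`|x.2.1 - x.1.1| `^ p)%:E) Ks) => //.
apply/measurable_EFinP; apply: (measurableT_comp (measurable_powR p)).
apply: measurableT_comp => //; apply: measurable_funB.
- exact: measurableT_comp measurable_fst measurable_snd.
- exact: measurableT_comp measurable_fst measurable_fst.
Qed.

Lemma measurable_half_strip : measurable (@half_strip R S).
Proof. by apply: measurableX => //; exact: measurable_Rplus. Qed.

(* The moment bound is assumed along the process only, so it is transferred to
   the kernel outside a set of states that is never visited and, [reachable]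
   being absorbing, never charged by the kernel. *)
Definition moment_states : set (strip R S) :=
  @half_strip R S `&` (~` [set z | (xB <= z.1)%R] `|` [set z | kernel_moment z <= b%:E]).

Fixpoint safe_states n : set (strip R S) :=
  if n is m.+1 then safe_states m `&` [set z | Ks z (~` safe_states m) = 0]
  else moment_states.

Definition reachable : set (strip R S) := \bigcap_n safe_states n.

Lemma measurable_kernel_null A : measurable A -> measurable [set z | Ks z A = 0].
Proof.
move=> mA; rewrite -[X in measurable X]setTI.
exact: (measurable_kernel Ks A mA measurableT _ (emeasurable_set1 0)).
Qed.

Lemma measurable_moment_bound : measurable
  (~` [set z : strip R S | (xB <= z.1)%R] `|` [set z | kernel_moment z <= b%:E]).
Proof.
apply: measurableU.
  by apply: measurableC; exact: measurable_abscissa_ge.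
rewrite -[X in measurable X]setTI.
exact: (emeasurable_fun_infty_c measurableT measurable_kernel_moment).
Qed.

Lemma measurable_safe_states n : measurable (safe_states n).
Proof.
elim: n => [|n mn] /=; last first.
  by apply: measurableI => //; apply: measurable_kernel_null; exact: measurableC.
apply: measurableI; first exact: measurable_half_strip.
exact: measurable_moment_bound.
Qed.

Lemma measurable_reachable : measurable reachable.
Proof. by apply: bigcap_measurableType => n _; exact: measurable_safe_states. Qed.

Lemma reachable_half_strip z : reachable z -> half_strip z.
Proof. by move=> /(_ 0%N I)[]. Qed.

Lemma reachable_moment z : reachable z -> (xB <= z.1)%R -> kernel_moment z <= b%:E.
Proof. by move=> /(_ 0%N I)[_ [|]]. Qed.

(** A reachable state is safe at level n + 1, hence its law does not charge the complement of level
    n; these complements are countably many. *)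
Lemma reachable_absorbing z : reachable z -> Ks z (~` reachable) = 0.
Proof.
move=> zr; apply/negligibleP; first by apply: measurableC; exact: measurable_reachable.
rewrite /reachable setC_bigcap; apply: negligible_bigcup => n.
apply/negligibleP; first by apply: measurableC; exact: measurable_safe_states.
by case: (zr n.+1 I).
Qed.

End good_states.

Section process_moments.
Context d (Omega : measurableType d) (R : realType) (P : probability Omega R).
Context (S : pmetricType R) (F : nat -> set (set Omega)).
Context (Ks : R.-pker strip R S ~> strip R S) (z0 : strip R S).
Context (xi : nat -> Omega -> strip R S).
Hypothesis hp : half_strip_process P F Ks z0 xi.
Variables (p q xB Bp Bq : R).
Hypothesis hm : moment_bounds P xi F p q xB Bp Bq.
Local Open Scope ereal_scope.

(** On the event that the kernel moment is at least [b + e], the freezing lemma and the bound on the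
    conditional expectation give [(b + e) * P E <= b * P E], so the event is null. The exceptional
    set is the union of these events over [e = 1 / (j + 1)]. *)
Lemma sure_moment n : sure P xi n
  (~` [set z : strip R S | (xB <= z.1)%R] `|`
   [set z | kernel_moment Ks p z <= (Num.max Bp 0%R)%:E]).
Proof.
set b := Num.max Bp 0%R; have [[Y [mY YE] Yb] _] := hm n.
pose A e := [set z : strip R S | (xB <= z.1)%R /\ (b + e)%:E <= kernel_moment Ks p z].
have mA e : measurable (A e).
  apply: measurableI; first exact: measurable_abscissa_ge.
  rewrite -[X in measurable X]setTI; exact: (emeasurable_fun_c_infty measurableT (measurable_kernel_moment Ks p)).
have b0 : (0 <= b)%R by rewrite le_max lexx orbT.
have A0 e : (0 < e)%R -> P (xi n @^-1` A e) = 0.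
  move=> e0; set E := xi n @^-1` A e.
  have mE : measurable E by exact: measurable_preimage hp _ _ (mA e).
  pose phi (x : g_sigma_algebraType (F n) * strip R S) : \bar R :=
    (\1_E x.1 * `|x.2.1 - (xi n x.1).1| `^ p)%:E.
  have mxi : measurable_fun setT (xi n : g_sigma_algebraType (F n) -> strip R S).
    move=> _ B mB; rewrite setTI (filtration_generated hp).
    exact: (process_adapted hp).
  have FE : F n E by exact: (process_adapted hp).
  have phi0 x : 0 <= phi x by rewrite lee_fin mulr_ge0 ?powR_ge0.
  have mphi : measurable_fun setT phi.
    apply/measurable_EFinP/measurable_funM.
      apply: (@measurableT_comp _ _ _ _ _ _ (\1_E : g_sigma_algebraType (F n) -> R)) => //.
      by apply: measurable_indic; rewrite (filtration_generated hp).
    apply: (measurableT_comp (measurable_powR p)); apply: measurableT_comp => //.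
    apply: measurable_funB.
      exact: measurableT_comp measurable_fst measurable_snd.
    apply: (measurableT_comp measurable_fst).
    exact: (measurableT_comp mxi measurable_fst).
  have e1 := process_freezing hp phi0 mphi.
  have e2 : \int[P]_w phi (w, xi n.+1 w) = \int[P]_(w in E) Y w.
    rewrite YE//; rewrite [RHS]integral_mkcond; apply: eq_integral => w _.
    by rewrite patchE /phi/= indicE; case: ifPn => _; rewrite ?mul1r ?mul0r.
  have e3 : (b + e)%:E * P E <= \int[P]_w \int[Ks (xi n w)]_z phi (w, z).
    rewrite -integral_cst// integral_mkcond; apply: ge0_le_integral => //.
    - by move=> w _; apply: erestrict_ge0 => ? _; rewrite lee_fin addr_ge0 // ltW.
    - apply/(measurable_restrictT _ mE); exact: measurable_cst.
    - apply: (measurable_fun_integral_finite_kernel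
        (fun x : Omega * strip R S => phi x) (kernel_map Ks (measurable_process hp n))) => //.
      apply: (@measurableT_comp _ _ _ _ _ _ phi) => //.
      apply/measurable_fun_pairP; split; last exact: measurable_snd.
      have mid : measurable_fun setT (fun w : Omega => w : g_sigma_algebraType (F n)).
        move=> _ B; rewrite setTI (filtration_generated hp).
        exact: (filtration_measurable hp).
      exact: measurableT_comp mid measurable_fst.
    - move=> w _; rewrite patchE; case: ifPn => [wE|_]; last exact: integral_ge0.
      have [_ Ew] := set_mem wE; apply: (le_trans Ew); rewrite le_eqVlt; apply/orP; left; apply/eqP.
      apply: eq_integral => z _; by rewrite /phi/= indicE wE mul1r.
  have mYm : measurable_fun setT Y.
    move=> _ B mB; rewrite setTI; apply: (filtration_measurable hp (n := n)); exact: mY.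
  (* The version [Y] carries no sign condition, so the comparison goes through its positive part;
     this is why [b] is the maximum of [Bp] and 0. *)
  have e4 : \int[P]_(w in E) Y w <= b%:E * P E.
    apply: (@le_trans _ _ (\int[P]_(w in E) Y^\+ w)).
      by rewrite integralE geeDl// oppe_le0 integral_ge0.
    rewrite -integral_cst//; apply: ae_ge0_le_integral => //.
    - by apply/measurable_funTS/measurable_funepos.
    - by case: Yb => N [mN PN NE]; exists N; split => // w Hw; apply: NE => /= Hb; apply: Hw => /= -[xBw _];
        rewrite funeposE ge_max lee_fin b0 andbT (le_trans (Hb xBw))// lee_fin le_max lexx.
  have := le_trans e3 (le_trans _ e4); rewrite -e1 e2 => /(_ (lexx _)).
  have PEfin : P E \is a fin_num by exact: fin_num_measure.
  rewrite -(fineK PEfin) -!EFinM lee_fin => h.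
  apply/eqP; rewrite eqe eq_le fine_ge0// andbT.
  by rewrite -(pmulr_rle0 _ e0); lra.
apply/negligibleP.
  apply: (measurable_preimage hp); apply: measurableC.
  exact: measurable_moment_bound.
have : P.-negligible (\bigcup_j (xi n @^-1` A (j.+1%:R^-1)%R)).
  apply: negligible_bigcup => j; apply/negligibleP.
    exact: (measurable_preimage hp).
  by apply: A0; rewrite invr_gt0.
apply: negligibleS.
move=> w /= /not_orP[/contrapT xw /negP]; rewrite -ltNge => bk.
(* An infinite kernel moment is also caught, with [j = 0]. *)
have [j bj] : exists j, (b + j.+1%:R^-1)%R%:E <= kernel_moment Ks p (xi n w).
    move: bk; case: (kernel_moment Ks p (xi n w)) => [r| |]//.
      rewrite lte_fin => /ltr_add_invr[j bj]; exists j.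
      by rewrite lee_fin ltW.
    by move=> _; exists 0%N; rewrite leey.
by exists j.
Qed.

(** Induction on the level for all times at once: level k at time n + 1 gives the null condition of
    level k + 1 at time n. *)
Lemma sure_reachable n : sure P xi n (reachable Ks p xB (Num.max Bp 0%R)).
Proof.
set b := Num.max Bp 0%R.
apply: (sure_bigcap hp) => [k|k]; first exact: measurable_safe_states.
elim: k n => [|k ih] n /=.
  apply: (sure_setI hp); [exact: measurable_half_strip|exact: measurable_moment_bound| |].
    rewrite /sure (_ : _ @^-1` _ = set0) ?measure0//.
    apply/seteqP; split => // w /=; apply; exact: (process_half_strip hp).
  exact: sure_moment.
apply: (sure_setI hp) => //.
- exact: measurable_safe_states.
- by apply: measurable_kernel_null; apply: measurableC; exact: measurable_safe_states.
- by apply: (sure_next hp) => //; exact: measurable_safe_states.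
Qed.

End process_moments.

(** * Moments of the passage time *)

Section passage_moments.
Context d (Omega : measurableType d) (R : realType) (P : probability Omega R).
Context (S : pmetricType R) (F : nat -> set (set Omega)).
Context (Ks : R.-pker strip R S ~> strip R S) (z0 : strip R S).
Context (xi : nat -> Omega -> strip R S).
Hypothesis hp : half_strip_process P F Ks z0 xi.
Variable r : R.
Local Open Scope ereal_scope.

Definition above : set (strip R S) := [set z | (r < z.1)%R].

Local Notation alive := (stay xi above).
Local Notation tau := (passage_time xi r).

Lemma measurable_alive n : measurable (alive n).
Proof. by apply: (measurable_stay hp); exact: measurable_abscissa_gt. Qed.

(** Almost surely the process never leaves [H], so killing the kernel outside [H] as well changes
    nothing. The estimates are then needed only at states of [H]. *)
Lemma alive_reachable n (H : set (strip R S)) : measurable H ->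
  (forall k, sure P xi k H) -> P (alive n) = (survival Ks (above `&` H) n z0)%:E.
Proof.
move=> mH sH.
have mAH : measurable (above `&` H).
  by apply: measurableI => //; exact: measurable_abscissa_gt.
rewrite -(stay_survival hp n mAH); apply/eqP; rewrite eq_le; apply/andP; split; last first.
  apply: le_measure; rewrite ?inE.
  - exact: (measurable_stay hp).
  - exact: measurable_alive.
  - by move=> w h k kn; case: (h k kn).
pose N := \bigcup_k (xi k @^-1` (~` H)).
have mN k : measurable (xi k @^-1` (~` H)).
  by apply: (measurable_preimage hp); exact: measurableC.
have mNN : measurable N by exact: bigcupT_measurable.
have N0 : P N = 0.
  apply/negligibleP => //; apply: negligible_bigcup => k.
  by apply/(negligibleP _ (mN k)); exact: sH.
have mst : measurable (stay xi (above `&` H) n) by exact: (measurable_stay hp).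
apply: (@le_trans _ _ (P (stay xi (above `&` H) n `|` N))).
  apply: le_measure; rewrite ?inE; [exact: measurable_alive|exact: measurableU|].
  move=> w h; have [wN|wN] := pselect (N w); [by right|left => k kn].
  split; first exact: h.
  by apply: contrapT => Hk; apply: wN; exists k.
rewrite (le_trans (measureU2 _ mst mNN))//; set a := (X in _ + X).
by rewrite (_ : a = 0) ?adde0.
Qed.

Lemma passage_time_le w n : ~ alive n w -> tau w <= n%:R%:E.
Proof.
move=> h; have [k kn Xk] : exists2 k, (k <= n)%N & ((xi k w).1 <= r)%R.
  apply: contrapT => hk; apply: h => k kn; rewrite /above /= ltNge.
  by apply/negP => Xk; apply: hk; exists k.
apply: (@le_trans _ _ k%:R%:E); last by rewrite lee_fin ler_nat.
by apply: ereal_inf_lbound; exists k.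
Qed.

Lemma passage_time_ge w n : alive n w -> n.+1%:R%:E <= tau w.
Proof.
move=> h; apply: le_ereal_inf_tmp => _ [k /= Xk <-]; rewrite lee_fin ler_nat ltnNge.
by apply/negP => /h; rewrite /above /= ltNge Xk.
Qed.

Lemma passage_time_ge0 w : 0 <= tau w.
Proof. by apply: le_ereal_inf_tmp => _ [k /= Xk <-]; rewrite lee_fin. Qed.

Lemma measurable_passage_time : measurable_fun setT tau.
Proof.
pose u n w : \bar R := if ((xi n w).1 <= r)%R then n%:R%:E else +oo.
have mu n : measurable_fun setT (u n).
  apply: measurable_fun_ifT => //; apply: measurable_fun_ler => //.
  exact: measurableT_comp measurable_fst (measurable_process hp n).
rewrite (_ : tau = fun w => einfs (u ^~ w) 0%N); first exact: measurable_fun_einfs.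
apply/funext => w; apply/eqP; rewrite eq_le; apply/andP; split.
  apply: le_ereal_inf_tmp => _ [n /= _ <-]; rewrite /u; case: ifPn => [Xn|_]; last first.
    by rewrite leey.
  by apply: ereal_inf_lbound; exists n.
apply: le_ereal_inf_tmp => _ [n /= Xn <-]; apply: ereal_inf_lbound.
by exists n => //=; rewrite /u Xn.
Qed.

Lemma poweR_mono (s : R) (x y : \bar R) : (0 <= s)%R -> 0 <= x -> x <= y ->
  x `^ s <= y `^ s.
Proof.
move=> s0 x0 xy; apply: gt0_ler_poweR => //; rewrite in_itv /= leey andbT//.
exact: le_trans xy.
Qed.

(** Markov's inequality; being alive at the times 0, ..., n forces the passage time to be at least n
    + 1. *)
Lemma passage_moment_ge (s : R) n : (0 <= s)%R ->
  (n.+1%:R `^ s)%:E * P (alive n) <= passage_moment P xi r s.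
Proof.
move=> s0; have mt : measurable_fun setT (fun w => tau w `^ s).
  exact: measurableT_comp (measurable_poweR s) measurable_passage_time.
rewrite -integral_cst; last exact: measurable_alive.
apply: (@le_trans _ _ (\int[P]_(w in alive n) (tau w `^ s))); last first.
  apply: ge0_subset_integral => //; first exact: measurable_alive.
  by move=> w _; exact: poweR_ge0.
apply: ge0_le_integral => //.
- exact: measurable_alive.
- by move=> w _; rewrite lee_fin powR_ge0.
- exact: measurable_funTS.
- move=> w h; rewrite -poweR_EFin; apply: poweR_mono => //.
  exact: passage_time_ge.
Qed.

(** Dyadic decomposition: tau^s is at most 1 plus the sum over i of 2^((i + 1) s) on the event of
    being alive at time 2^i. The tail bound makes the expectations a geometric series of ratio 2^(s
    - t). *)
Lemma passage_moment_lty (s t K : R) : (0 < s < t)%R -> (0 <= K)%R ->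
  (forall n, P (alive n) <= (K * n.+1%:R `^ (- t))%:E) ->
  passage_moment P xi r s < +oo.
Proof.
move=> /andP[s0 st] K0 hP.
pose a i : R := ((2 ^+ i.+1) `^ s)%R.
have a0 i : (0 <= a i)%R by exact: powR_ge0.
pose g w := 1 + \sum_(i <oo) (a i)%:E * (\1_(alive (2 ^ i)) w)%:E.
have term0 i w : 0 <= (a i)%:E * (\1_(alive (2 ^ i)) w)%:E.
  by rewrite mule_ge0 ?lee_fin.
have mterm i : measurable_fun setT (fun w => (a i)%:E * (\1_(alive (2 ^ i)) w)%:E).
  apply: measurable_funeM; apply/measurable_EFinP/measurable_indic.
  exact: measurable_alive.
have tau_le1 w : tau w <= 1 -> tau w `^ s <= g w.
  move=> t1; apply: (@le_trans _ _ 1); last first.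
    by rewrite leeDl//; apply: nneseries_ge0 => i _ _.
  rewrite (_ : 1 = 1 `^ s); last by rewrite poweR_EFin powR1.
  by apply: poweR_mono => //; [exact: ltW|exact: passage_time_ge0].
have tau_g w : tau w `^ s <= g w.
  (* The passage time is infinite here, and so is [g]: each of its summands is at least 1. *)
  have [all|] := pselect (forall i, alive (2 ^ i) w).
    rewrite (_ : g w = +oo) ?leey//; apply: eq_infty => x.
    apply: (@le_trans _ _ (\sum_(0 <= i < `|Num.ceil x|%N) 1)).
      rewrite sumEFin lee_fin big_const_nat iter_addr addr0 subn0.
      by rewrite (le_trans (ceil_ge x))// -[leLHS]mulr1z /= (le_trans (ler_norm _))// -intr_norm natr_absz.
    apply: (@le_trans _ _ (\sum_(i <oo) (a i)%:E * (\1_(alive (2 ^ i)) w)%:E)); last first.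
      by rewrite leeDr.
    apply: le_trans (nneseries_lim_ge _ _); last by [].
    apply: lee_sum => i _; rewrite indicE mem_set//= mule1 lee_fin /a.
    apply: (@le_trans _ _ (1 `^ s)%R); first by rewrite powR1.
    apply: ge0_ler_powR; rewrite ?nnegrE ?exprn_ge0 ?(ltW s0)//.
    by rewrite exprn_ege1// ler1n.
  (* Take the first dyadic time at which the process is no longer alive. If it is [2 ^ j.+1], then
     the passage time is at most that and the term of index [j] alone suffices; if it is [2 ^ 0],
     the summand 1 does. *)
  move=> /existsNP h; case: (ex_minnP (P := fun i => `[< ~ alive (2 ^ i) w >])).
    by case: h => i hi; exists i; apply/asboolP.
  move=> [|j] /asboolP hj jmin.
    by apply: tau_le1; exact: (passage_time_le hj).
  have aj : alive (2 ^ j) w.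
    by apply: contrapT => /asboolP /jmin; rewrite ltnn.
  have := passage_time_le hj; rewrite natrX => tj.
  apply: (@le_trans _ _ (a j)%:E).
    rewrite /a -poweR_EFin; apply: poweR_mono => //; first exact: ltW.
    exact: passage_time_ge0.
  apply: (@le_trans _ _ (\sum_(i <oo) (a i)%:E * (\1_(alive (2 ^ i)) w)%:E)); last first.
    by rewrite leeDr.
  apply: le_trans (nneseries_lim_ge j.+1 _); last by [].
  rewrite big_nat_recr//= indicE mem_set// mule1 leeDr//.
  by apply: sume_ge0.
have mg : measurable_fun setT g.
  by apply: emeasurable_funD => //; exact: ge0_emeasurable_sum.
apply: (@le_lt_trans _ _ (\int[P]_w g w)).
  apply: ge0_le_integral => //.
  - by move=> w _; exact: poweR_ge0.
  - exact: measurableT_comp (measurable_poweR s) measurable_passage_time.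
rewrite ge0_integralD//; last 2 first.
- by move=> w _; apply: nneseries_ge0.
- by exact: ge0_emeasurable_sum.
rewrite integral_cst// mul1e integral_nneseries//.
pose rho : R := (2 `^ (s - t))%R.
have rho0 : (0 <= rho)%R by exact: powR_ge0.
have rho1 : (rho < 1)%R.
  rewrite /rho (_ : s - t = - (t - s))%R; last by ring.
  rewrite powRN invf_lt1 ?powR_gt0//.
  have ts : (0 < t - s)%R by rewrite subr_gt0.
  apply: (@le_lt_trans _ _ (1 `^ (t - s))%R); first by rewrite powR1.
  by apply: gt0_ltr_powR; rewrite ?nnegrE// ltr1n.
pose A : R := (2 `^ s * K)%R.
have A0 : (0 <= A)%R by rewrite mulr_ge0// powR_ge0.
have hterm i : \int[P]_w ((a i)%:E * (\1_(alive (2 ^ i)) w)%:E) <= (A * rho ^+ i)%:E.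
  have mi : measurable_fun setT (fun w => (\1_(alive (2 ^ i)) w)%:E : \bar R).
    by apply/measurable_EFinP/measurable_indic; exact: measurable_alive.
  rewrite ge0_integralZl ?lee_fin//.
  rewrite integral_indic ?setIT//; last exact: measurable_alive.
  apply: (@le_trans _ _ ((a i)%:E * (K * (2 ^ i).+1%:R `^ (- t))%:E)).
    by apply: lee_wpmul2l; [rewrite lee_fin a0|exact: hP].
  rewrite -EFinM lee_fin /a /A /rho.
  have p2 : (0 <= 2 ^+ i :> R)%R by rewrite exprn_ge0.
  have p2' : (0 < 2 ^+ i :> R)%R by rewrite exprn_gt0.
  have -> : ((2 `^ (s - t)) ^+ i = (2 ^+ i) `^ s * (2 ^+ i) `^ (- t) :> R)%R.
    rewrite -powRD ?(gt_eqF p2') ?implybT// -!powR_mulrn ?powR_ge0//.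
    by rewrite -!powRrM mulrC.
  have -> : ((2 ^+ i.+1) `^ s = 2 `^ s * (2 ^+ i) `^ s :> R)%R by rewrite exprS powRM.
  have -> : (2 `^ s * K * ((2 ^+ i) `^ s * (2 ^+ i) `^ (- t)) =
    2 `^ s * (2 ^+ i) `^ s * (K * (2 ^+ i) `^ (- t)) :> R)%R by ring.
  rewrite ler_wpM2l ?mulr_ge0 ?powR_ge0// ler_wpM2l//.
  rewrite !powRN lef_pV2 ?posrE ?powR_gt0//.
  apply: ge0_ler_powR; rewrite ?nnegrE//; first lra.
  by rewrite -natrX ler_nat.
apply: (@le_lt_trans _ _ (P setT + (A / (1 - rho))%:E)); last first.
  by rewrite lte_add_pinfty ?ltry// (le_lt_trans (probability_le1 _ _)) ?ltry.
rewrite leeD2l//; apply: lime_le.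
  by apply: is_cvg_nneseries => i _ _; apply: integral_ge0.
apply: nearW => n; apply: (@le_trans _ _ (\sum_(0 <= i < n) (A * rho ^+ i)%:E)).
  exact: lee_sum.
rewrite sumEFin lee_fin.
have -> : (\sum_(0 <= i < n) A * rho ^+ i = A * (1 - rho ^+ n) / (1 - rho))%R.
  have rn1 : rho != 1%R by rewrite lt_eqF.
  by have := congr1 (fun f => f n) (geometric_seriesE A rn1).
rewrite ler_wpM2r ?invr_ge0 ?subr_ge0 ?(ltW rho1)//.
by rewrite ler_piMr// gerBl exprn_ge0.
Qed.

End passage_moments.

(** * Total variation and integrals against charges *)

Lemma Rintegral_indicT d (T : measurableType d) (R : realType)
    (mu : {measure set T -> \bar R}) (D : set T) : measurable D ->
  \int[mu]_x \1_D x = fine (mu D).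
Proof. by move=> mD; rewrite /Rintegral integral_indic// setIT. Qed.

Section borel_approximation.
Context (R : realType) (S : pmetricType R).

Lemma continuous_measurable_borel (f : S -> R) : continuous f ->
  measurable_fun setT (f : borel S -> R).
Proof.
move=> /continuousP cf; apply: (measurability _ (RGenOpens.measurableE R)).
move=> _ [_ [a [b ->] <-]]; rewrite setTI; apply: sub_sigma_algebra.
exact/cf/interval_open.
Qed.

Variable mu : {measure set (borel S) -> \bar R}.
Hypothesis mu_lty : (mu setT < +oo)%E.

Let mu_fin (A : set (borel S)) : measurable A -> mu A \is a fin_num.
Proof.
move=> mA; rewrite ge0_fin_numE// (le_lt_trans _ mu_lty)//.
by apply: le_measure; rewrite ?inE.
Qed.

Definition L1_approx (B : set (borel S)) := measurable B /\
  forall e : R, 0 < e -> exists f : S -> R, [/\ continuous f,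
    forall u, 0 <= f u <= 1 & \int[mu]_u `|\1_B u - f u| < e].

Lemma integrable_indic_sub (B : set (borel S)) (f : S -> R) : measurable B ->
  continuous f -> (forall u, 0 <= f u <= 1) ->
  mu.-integrable setT (EFin \o (fun u : borel S => `|\1_B u - f u|)).
Proof.
move=> mB cf f01; apply: (@integrable_bdd _ _ _ _ _ measurableT mu_lty _ 1).
  apply: measurableT_comp => //; apply: measurable_funB; first exact: measurable_indic.
  exact: continuous_measurable_borel.
move=> u _; rewrite normr_id indicE ler_norml; case: (_ \in _) => /=; have := f01 u; lra.
Qed.

(** The points that avoid small neighbourhoods of all points outside [U] form closed sets increasing
    to [U]; Urysohn's lemma gives a function equal to 1 on such a set and to 0 off [U]. *)
Lemma L1_approx_open (U : set S) : open U -> L1_approx U.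
Proof.
move=> oU; have mU : measurable (U : set (borel S)) by exact: sub_sigma_algebra.
split=> // e e0.
pose V n : set S := \bigcup_(y in ~` U) (ball y (n.+1%:R^-1))°.
have oV n : open (V n) by apply: bigcup_open => y _; exact: open_interior.
pose C n : set (borel S) := ~` V n.
have cC n : closed (C n : set S) by exact: open_closedC.
have mC n : measurable (C n).
  by apply: measurableC; exact: sub_sigma_algebra.
have CU n : C n `<=` U.
  move=> x Cx; apply: contrapT => Ux; apply: Cx; exists x => //.
  by apply/nbhsx_ballx; rewrite invr_gt0.
have CUE : \bigcup_n C n = U.
  apply/seteqP; split => [x [n _]|x Ux]; first exact: CU.
  have /nbhs_ballP[r /= r0 hr] : nbhs x U by exact: open_nbhs_nbhs.
  have [n] := ltr_add_invr r0; rewrite add0r => nr.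
  exists n => // -[y /= Uy] /interior_subset /ball_sym yx; apply: Uy; apply: hr.
  exact: le_ball (ltW nr) _ yx.
have ndC : {homo C : n m / (n <= m)%N >-> (n <= m)%O}.
  move=> n m nm; apply/subsetPset => x Cx [y Uy Vy]; apply: Cx; exists y => //.
  apply: interiorS Vy; apply: le_ball.
  by rewrite lef_pV2 ?posrE// ler_nat.
have mUC : measurable (\bigcup_n C n) by exact: bigcupT_measurable.
have : mu (C n) @[n --> \oo] --> (fine (mu U))%:E.
  rewrite fineK ?mu_fin// -CUE; exact: nondecreasing_cvg_mu.
move=> /fine_cvgP[_].
move=> /cvgrPdist_lt/(_ e e0)[n _ /(_ n (leqnn n))] /= hn.
have [|f [cf f0 f1 f01]] := urysohn_ext_itv pseudometric_normal (open_closedC oU) (cC n) _ (@ltr01 R).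
  by apply/disjoints_subset; apply: subsetC; exact: CU.
have f01' u : 0 <= f u <= 1.
  by have := f01 (f u); rewrite /= in_itv /=; apply; exists u.
exists f; split => //.
apply: le_lt_trans hn.
have muD : mu (U `\` C n) = (mu U - mu (C n))%E.
  rewrite measureD// ?(setIidr (CU n))//.
  by rewrite ltey_eq mu_fin.
have UC : fine (mu (U `\` C n)) = fine (mu U) - fine (mu (C n)).
  by rewrite muD fineB// mu_fin.
rewrite -UC (le_trans _ (ler_norm _))//.
have mD : measurable (U `\` C n : set (borel S)) by exact: measurableD.
rewrite -Rintegral_indicT//; apply: le_Rintegral => //.
- exact: integrable_indic_sub.
- apply: (@integrable_bdd _ _ _ _ _ measurableT mu_lty _ 1).
    exact: measurable_indic.
  by move=> u _; rewrite indicE; case: (_ \in _); rewrite ?normr1 ?normr0.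
- move=> u _; rewrite !indicE.
  have [Cu|Cu] := pselect (C n u).
    rewrite (mem_set (CU _ _ Cu)) (_ : f u = 1) ?subrr ?normr0//.
    by apply: f1; exists u.
  have [Uu|Uu] := pselect (U u).
    rewrite (mem_set Uu) (@mem_set _ (U `\` C n) u)//.
    by rewrite /= ler_norml; have := f01' u; lra.
  rewrite (memNset Uu) (_ : f u = 0) ?subrr ?normr0//.
  by apply: f0; exists u.
Qed.

(** Open sets are stable under intersection and generate the Borel sets, so it is enough that the
    approximable sets form a lambda-system. This links the total variation norm, defined by
    continuous functions, to measurable test functions. *)
Lemma L1_approx_borel (B : set (borel S)) : measurable B -> L1_approx B.
Proof.
have sub : <<s setT, (@open S) >> `<=` L1_approx.
  apply: lambda_system_subset => //; first exact: openI; last exact: L1_approx_open.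
  split => //.
  - exact/L1_approx_open/openT.
  - move=> A B' B'A [mA hA] [mB hB]; split; first exact: measurableD.
    move=> e e0; have e20 : 0 < e / 2 by rewrite divr_gt0.
    have [f [cf f01 fe]] := hA _ e20; have [g [cg g01 ge]] := hB _ e20.
    (* Truncation at 0 keeps the difference in [0, 1] and does not increase the error, as [B'] is
       contained in [A]. *)
    pose h u := Num.max 0 (f u - g u).
    have ch : continuous h.
      move=> u; apply: (@continuous_max R S (fun=> 0) (fun u => f u - g u)).
        exact: cst_continuous.
      by apply: cvgB; [exact: cf|exact: cg].
    have h01 u : 0 <= h u <= 1.
      rewrite /h le_max lexx /= ge_max ler01 /=.
      have := f01 u; have := g01 u; lra.
    exists h; split => //.
    have fi := integrable_indic_sub mA cf f01; have gi := integrable_indic_sub mB cg g01.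
    apply: (@le_lt_trans _ _ (\int[mu]_u (`|\1_A u - f u| + `|\1_B' u - g u|))).
      apply: le_Rintegral => //.
      + by apply: integrable_indic_sub => //; exact: measurableD.
      + exact: integrable_add.
      + move=> u _; rewrite /h !indicE in_setD.
        have [Bu|Bu] := boolP (u \in B').
          rewrite (mem_set (B'A _ (set_mem Bu))) /=.
          have := f01 u; have := g01 u => hg hf.
          rewrite (ger0_norm (_ : 0 <= 1 - f u)) ?(ger0_norm (_ : 0 <= 1 - g u)); [|lra|lra].
          by case: (leP 0 (f u - g u)); rewrite ler_norml; lra.
        case: (u \in A) => /=; have := f01 u; have := g01 u => hg hf;
          rewrite (ler0_norm (_ : 0 - g u <= 0)); try lra.
          rewrite (ger0_norm (_ : 0 <= 1 - f u)); last lra.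
          by case: (leP 0 (f u - g u)); rewrite ler_norml; lra.
        rewrite (ler0_norm (_ : 0 - f u <= 0)); last lra.
        by case: (leP 0 (f u - g u)); rewrite ler_norml; lra.
    by rewrite RintegralD//; lra.
  - move=> A; move: (A : nat -> set (borel S)) => {}A ndA hA.
    have mA n : measurable (A n) by case: (hA n).
    have mUA : measurable (\bigcup_n A n) by exact: bigcupT_measurable.
    split => // e e0; have e20 : 0 < e / 2 by rewrite divr_gt0.
    have : mu (A n) @[n --> \oo] --> (fine (mu (\bigcup_n A n)))%:E.
      by rewrite fineK ?mu_fin//; exact: nondecreasing_cvg_mu.
    move=> /fine_cvgP[_].
    move=> /cvgrPdist_lt/(_ _ e20)[n _ /(_ n (leqnn n))] /= hn.
    have [_ /(_ _ e20)[f [cf f01 fe]]] := hA n.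
    exists f; split => //.
    set U := \bigcup_n A n in mUA hn *.
    have AU : A n `<=` U by exact: bigcup_sup.
    have mD : measurable (U `\` A n) by exact: measurableD.
    have muD : mu (U `\` A n) = (mu U - mu (A n))%E.
      rewrite measureD// ?(setIidr AU)//.
      by rewrite ltey_eq mu_fin.
    have UA : \int[mu]_u \1_(U `\` A n) u < e / 2.
      rewrite Rintegral_indicT//; apply: le_lt_trans hn.
      by rewrite (le_trans _ (ler_norm _))// (congr1 fine muD) fineB ?mu_fin.
    have ii : mu.-integrable setT (EFin \o (\1_(U `\` A n) : borel S -> R)).
      apply: (@integrable_bdd _ _ _ _ _ measurableT mu_lty _ 1).
        exact: measurable_indic.
      by move=> u _; rewrite indicE; case: (_ \in _); rewrite ?normr1 ?normr0.
    have fi := integrable_indic_sub (mA n) cf f01.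
    apply: (@le_lt_trans _ _ (\int[mu]_u (\1_(U `\` A n) u + `|\1_(A n) u - f u|))).
      apply: le_Rintegral => //.
      + exact: integrable_indic_sub.
      + exact: integrable_add.
      + move=> u _; rewrite !indicE in_setD.
        have [Au|Au] := boolP (u \in A n).
          by rewrite (mem_set (AU _ (set_mem Au))) /= add0r.
        case: (u \in U) => /=; last by rewrite lerDr.
        have := f01 u => hf; rewrite (ger0_norm (_ : 0 <= 1 - f u)); last lra.
        by rewrite (ler0_norm (_ : 0 - f u <= 0)); lra.
    by rewrite RintegralD//; lra.
exact: sub.
Qed.

End borel_approximation.

Lemma sub_swap {V : zmodType} (x y z w : V) : x + y = z + w -> w - y = x - z.
Proof. by move=> h; apply/eqP; rewrite subr_eq addrAC h addrAC subrr add0r. Qed.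

Lemma add_swap {V : zmodType} (x y z w : V) : x - y = z - w -> x + w = y + z.
Proof. by move/eqP; rewrite subr_eq => /eqP ->; rewrite addrAC subrK addrC. Qed.

Section charge_integrals.
Context d (T : measurableType d) (R : realType).
Implicit Types (nu : {charge set T -> \bar R}) (f : T -> R).

Definition charge_pos nu := jordan_pos (svalP (hahn_pair nu)).
Definition charge_neg nu := jordan_neg (svalP (hahn_pair nu)).
HB.instance Definition _ nu := Measure.on (charge_pos nu).
HB.instance Definition _ nu := Measure.on (charge_neg nu).

Lemma charge_pos_lty nu : (charge_pos nu setT < +oo)%E.
Proof. by rewrite ltey_eq fin_num_measure. Qed.

Lemma charge_neg_lty nu : (charge_neg nu setT < +oo)%E.
Proof. by rewrite ltey_eq fin_num_measure. Qed.

Lemma charge_integralE nu f :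
  charge_integral nu f = \int[charge_pos nu]_x f x - \int[charge_neg nu]_x f x.
Proof. by []. Qed.

Definition bounded_measurable f :=
  measurable_fun setT f /\ exists M, forall x, `|f x| <= M.

Lemma integrable_bm (mu : {measure set T -> \bar R}) f : (mu setT < +oo)%E ->
  bounded_measurable f -> mu.-integrable setT (EFin \o f).
Proof.
move=> mul [mf [M fM]]; apply: (@integrable_bdd _ _ _ _ _ measurableT mul _ M) => //.
Qed.

Lemma Rintegral_measure_add (m1 m2 : {measure set T -> \bar R}) f :
  m1.-integrable setT (EFin \o f) -> m2.-integrable setT (EFin \o f) ->
  \int[measure_add m1 m2]_x f x = \int[m1]_x f x + \int[m2]_x f x.
Proof.
move=> i1 i2; rewrite /Rintegral integral_measure_add//.
by rewrite fineD//; apply: integrable_fin_num.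
Qed.

Lemma eq_measure_Rintegral (m1 m2 : {measure set T -> \bar R}) f :
  (forall A, measurable A -> m1 A = m2 A) -> \int[m1]_x f x = \int[m2]_x f x.
Proof.
move=> m12; congr fine; apply: eq_measure_integral => A mA _; exact: m12.
Qed.

(** If nu = a - b with finite measures, then a + nu^- = b + nu^+ as measures, and integration
    followed by rearrangement gives the claim. The rules for differences, measures and scalings rest
    on it. *)
Lemma charge_integral_diff nu (a b : {measure set T -> \bar R}) f :
  (a setT < +oo)%E -> (b setT < +oo)%E ->
  (forall A, measurable A -> nu A = (a A - b A)%E) -> bounded_measurable f ->
  charge_integral nu f = \int[a]_x f x - \int[b]_x f x.
Proof.
move=> al bl nuE bf.
have fin (m : {measure set T -> \bar R}) A : (m setT < +oo)%E -> measurable A ->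
    m A \is a fin_num.
  move=> ml mA; rewrite ge0_fin_numE// (le_lt_trans _ ml)//.
  by apply: le_measure; rewrite ?inE.
have := @eq_measure_Rintegral (measure_add a (charge_neg nu)) (measure_add b (charge_pos nu)) f.
rewrite !Rintegral_measure_add; try by apply: integrable_bm => //;
  [exact: charge_neg_lty|exact: charge_pos_lty].
all: try exact: integrable_bm bf.
- move=> h; rewrite charge_integralE.
  apply: sub_swap; apply: h => A mA; rewrite /measure_add/= /msum !big_ord_recl !big_ord0/= !adde0.
  have := jordan_decomp (svalP (hahn_pair nu)) mA; rewrite nuE// /cadd/= cscaleN1/=.
  rewrite -/(charge_pos nu) -/(charge_neg nu).
  have := fin a A al mA; have := fin b A bl mA.
  have := fin (charge_pos nu) A (charge_pos_lty nu) mA.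
  have := fin (charge_neg nu) A (charge_neg_lty nu) mA.
  move=> /fineK <- /fineK <- /fineK <- /fineK <-.
  rewrite -!EFinB -!EFinD => -[h']; congr _%:E.
  exact: add_swap.
- by apply: integrable_bm bf; exact: charge_pos_lty.
- by apply: integrable_bm bf; exact: charge_neg_lty.
Qed.

Lemma charge_integral_sub nu1 nu2 f : bounded_measurable f ->
  charge_integral (charge_sub nu1 nu2) f =
  charge_integral nu1 f - charge_integral nu2 f.
Proof.
move=> bf.
have lp nu : (charge_pos nu).-integrable setT (EFin \o f).
  by apply: integrable_bm bf; exact: charge_pos_lty.
have ln nu : (charge_neg nu).-integrable setT (EFin \o f).
  by apply: integrable_bm bf; exact: charge_neg_lty.
rewrite (@charge_integral_diff _ (measure_add (charge_pos nu1) (charge_neg nu2))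
  (measure_add (charge_neg nu1) (charge_pos nu2))) //.
- rewrite (Rintegral_measure_add (lp nu1) (ln nu2)) (Rintegral_measure_add (ln nu1) (lp nu2)).
  by rewrite !charge_integralE; ring.
- rewrite /measure_add/= /msum !big_ord_recl !big_ord0/= !adde0.
  by apply: lte_add_pinfty; [exact: charge_pos_lty|exact: charge_neg_lty].
- rewrite /measure_add/= /msum !big_ord_recl !big_ord0/= !adde0.
  by apply: lte_add_pinfty; [exact: charge_neg_lty|exact: charge_pos_lty].
- move=> A mA; rewrite /measure_add/= /msum !big_ord_recl !big_ord0/= !adde0.
  rewrite /charge_sub /cadd/= /copp/=.
  rewrite (jordan_decomp (svalP (hahn_pair nu1)) mA) (jordan_decomp (svalP (hahn_pair nu2)) mA).
  rewrite /cadd/= !cscaleN1/=.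
  rewrite -!/(charge_pos _) -!/(charge_neg _).
  have fp nu : charge_pos nu A \is a fin_num by exact: fin_num_measure.
  have fn nu : charge_neg nu A \is a fin_num by exact: fin_num_measure.
  rewrite -(fineK (fp nu1)) -(fineK (fn nu1)) -(fineK (fp nu2)) -(fineK (fn nu2)).
  by rewrite -?EFinD -?EFinB -?EFinD -?EFinB; congr _%:E; ring.
Qed.

Lemma charge_integral_measure nu (m : {measure set T -> \bar R}) f :
  (m setT < +oo)%E -> (forall A, measurable A -> nu A = m A) ->
  bounded_measurable f -> charge_integral nu f = \int[m]_x f x.
Proof.
move=> ml numE bf; rewrite (@charge_integral_diff _ m mzero)//.
- by rewrite [X in _ - X](_ : _ = 0) ?subr0// /Rintegral integral_measure_zero.
- by rewrite /mzero ltry.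
- by move=> A mA; rewrite /mzero sube0 numE.
Qed.

Lemma charge_integral_scale (r : R) nu f : 0 <= r -> bounded_measurable f ->
  charge_integral (cscale r nu) f = r * charge_integral nu f.
Proof.
move=> r0 bf.
have lp : (charge_pos nu).-integrable setT (EFin \o f).
  by apply: integrable_bm bf; exact: charge_pos_lty.
have ln : (charge_neg nu).-integrable setT (EFin \o f).
  by apply: integrable_bm bf; exact: charge_neg_lty.
have Es (m : {measure set T -> \bar R}) : (m setT < +oo)%E ->
    \int[mscale (NngNum r0) m]_x f x = r * \int[m]_x f x.
  move=> ml; have [mf [M fM]] := bf.
  have msl : (mscale (NngNum r0) m setT < +oo)%E.
    by rewrite /mscale/= lte_mul_pinfty.
  (* A shift by the bound reduces to a nonnegative integrand. *)
  pose g x := f x + M.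
  have mg : measurable_fun setT g by exact: measurable_funD.
  have g0 x : 0 <= g x by have := fM x; rewrite /g ler_norml; lra.
  have bg : bounded_measurable g.
    split => //; exists (`|M| + `|M|) => x; rewrite (le_trans (ler_normD _ _))//.
    by rewrite lerD2r (le_trans (fM x))// ler_norm.
  have fE (m' : {measure set T -> \bar R}) : (m' setT < +oo)%E ->
      \int[m']_x f x = \int[m']_x g x - M * fine (m' setT).
    move=> ml'; have gi := integrable_bm ml' bg; have fi := integrable_bm ml' bf.
    by rewrite RintegralD ?Rintegral_cst ?addrK//; exact: integrable_cst_fin.
  rewrite (fE _ msl) (fE _ ml) {1}/Rintegral ge0_integral_mscale//; last 2 first.
  - exact/measurable_EFinP.
  - by move=> x _; rewrite lee_fin.
  have gi := integrable_fin_num measurableT (integrable_bm ml bg).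
  rewrite fineM//= fineM//; last by rewrite ge0_fin_numE.
  by rewrite /Rintegral/=; ring.
rewrite (@charge_integral_diff _ (mscale (NngNum r0) (charge_pos nu))
  (mscale (NngNum r0) (charge_neg nu)))//.
- by rewrite !Es ?charge_pos_lty ?charge_neg_lty// charge_integralE; ring.
- by rewrite /mscale/= lte_mul_pinfty// ?charge_pos_lty.
- by rewrite /mscale/= lte_mul_pinfty// ?charge_neg_lty.
- move=> A mA; rewrite /mscale/= /cscale.
  rewrite (jordan_decomp (svalP (hahn_pair nu)) mA) /cadd/= !cscaleN1/=.
  rewrite -!/(charge_pos _) -!/(charge_neg _).
  have fp : charge_pos nu A \is a fin_num by exact: fin_num_measure.
  have fn : charge_neg nu A \is a fin_num by exact: fin_num_measure.
  set pA := fine (charge_pos nu A); set nA := fine (charge_neg nu A).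
  have -> : mscale (NngNum r0) (charge_pos nu) A = (r * pA)%:E.
    by rewrite EFinM /pA fineK.
  have -> : mscale (NngNum r0) (charge_neg nu) A = (r * nA)%:E.
    by rewrite EFinM /nA fineK.
  transitivity (r%:E * (pA - nA)%:E)%E; first by rewrite EFinB /pA /nA !fineK.
  by rewrite -EFinM -EFinB mulrBr.
Qed.

(** The total mass of the variation measure |nu|. *)
Definition charge_mass nu := fine (charge_pos nu setT) + fine (charge_neg nu setT).

Lemma charge_integral_le_mass nu f : measurable_fun setT f ->
  (forall x, `|f x| <= 1) -> charge_integral nu f <= charge_mass nu.
Proof.
move=> mf f1; rewrite charge_integralE /charge_mass.
have bf : bounded_measurable f by split => //; exists 1.
have lp := integrable_bm (charge_pos_lty nu) bf.
have ln := integrable_bm (charge_neg_lty nu) bf.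
have cst (m : {measure set T -> \bar R}) : fine (m setT) = \int[m]_x 1.
  by rewrite Rintegral_cst// mul1r.
apply: lerD.
  rewrite cst; apply: le_Rintegral => //.
    by apply: (integrable_cst_fin measurableT); exact: charge_pos_lty.
  by move=> x _; rewrite (le_trans (ler_norm _)).
rewrite -mulN1r -RintegralZl// cst; apply: le_Rintegral => //.
- exact: integrable_scale.
- by apply: (integrable_cst_fin measurableT); exact: charge_neg_lty.
- by move=> x _; rewrite mulN1r (le_trans (ler_norm _))// normrN.
Qed.

End charge_integrals.

Section total_variation_bounds.
Context (R : realType) (S : pmetricType R).
Implicit Types (nu : {charge set (borel S) -> \bar R}) (f : S -> R).

Lemma bounded_continuous_bm f (M : R) : continuous f -> (forall u, `|f u| <= M) ->
  bounded_measurable (f : borel S -> R).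
Proof.
by move=> cf fM; split; [exact: continuous_measurable_borel|exists M].
Qed.

Lemma tv_norm_lty nu : (tv_norm nu < +oo)%E.
Proof.
apply: (@le_lt_trans _ _ (charge_mass nu)%:E); last by rewrite ltry.
apply: ge_ereal_sup => _ [f [cf f1] <-]; rewrite lee_fin.
by apply: charge_integral_le_mass => //; exact: continuous_measurable_borel.
Qed.

(** The function equal to 1 on the positive set of the Hahn decomposition and to -1 on the negative
    set has integral |nu|(S); it is replaced by a continuous function close to it in L1(|nu|). *)
Lemma tv_norm_ge_mass nu : ((charge_mass nu)%:E <= tv_norm nu)%E.
Proof.
apply/lee_addgt0Pr => e e0.
pose mu := measure_add (charge_pos nu) (charge_neg nu).
have muE A : mu A = (charge_pos nu A + charge_neg nu A)%E.
  by rewrite /mu /measure_add/= /msum !big_ord_recl !big_ord0/= adde0.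
have mul : (mu setT < +oo)%E.
  by rewrite muE lte_add_pinfty ?charge_pos_lty ?charge_neg_lty.
pose PN := hahn_pair nu; pose P := (sval PN).1; pose N := (sval PN).2.
have [[mP _] [mN _] PUN PIN] := svalP PN.
have e20 : 0 < e / 2 by rewrite divr_gt0.
have [_ /(_ _ e20)[f [cf f01 fe]]] := L1_approx_borel mul mP.
(* [f] approximates the indicator of [P], so [g] approximates the sign; the factor 2 explains
   [e / 2]. *)
pose g u := 2 * f u - 1.
have cg : continuous g.
  move=> u; apply: cvgB; last exact: cst_continuous.
  by apply: cvgM; [exact: cst_continuous|exact: cf].
have g1 u : `|g u| <= 1 by rewrite /g ler_norml; have := f01 u; lra.
have f1 u : `|f u| <= 1 by rewrite ler_norml; have := f01 u; lra.
apply: (@le_trans _ _ ((charge_integral nu g)%:E + e%:E)%E); last first.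
  by rewrite leeD2r//; apply: ereal_sup_ubound; exists g.
rewrite -EFinD lee_fin charge_integralE.
have bf := bounded_continuous_bm cf f1.
have ind : bounded_measurable (\1_P : borel S -> R).
  split; first exact: measurable_indic.
  by exists 1 => u; rewrite indicE; case: (_ \in _); rewrite ?normr1 ?normr0.
have lp := integrable_bm (charge_pos_lty nu).
have ln := integrable_bm (charge_neg_lty nu).
have gE (m : {measure set (borel S) -> \bar R}) : (m setT < +oo)%E ->
    \int[m]_u g u = 2 * \int[m]_u f u - fine (m setT).
  move=> ml; have fi := integrable_bm ml bf.
  rewrite RintegralB//.
  - by rewrite RintegralZl// Rintegral_cst// mul1r.
  - exact: integrable_scale.
  - exact: integrable_cst_fin.
rewrite !gE ?charge_pos_lty ?charge_neg_lty//.
have dE (m : {measure set (borel S) -> \bar R}) : (m setT < +oo)%E ->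
    `|\int[m]_u \1_P u - \int[m]_u f u| <= \int[m]_u `|\1_P u - f u|.
  move=> ml; rewrite -RintegralB//; [|exact: integrable_bm|exact: integrable_bm].
  apply: le_normr_Rintegral => //; apply: integrable_sub => //; exact: integrable_bm.
have := dE _ (charge_pos_lty nu); have := dE _ (charge_neg_lty nu).
rewrite !Rintegral_indicT//.
have -> : fine (charge_pos nu P) = fine (charge_pos nu setT).
  rewrite /charge_pos !jordan_posE !cjordan_posE /crestr0 !mem_set// /crestr setIid setTI.
  by [].
have -> : fine (charge_neg nu P) = 0.
  rewrite /charge_neg !jordan_negE !cjordan_negE /crestr0 !mem_set// /crestr.
  by rewrite -/PN -/P -/N PIN charge0 oppe0.
rewrite /charge_mass; move: fe; rewrite Rintegral_measure_add; first last.
- by apply: (@integrable_indic_sub _ _ _ (charge_neg_lty nu)).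
- by apply: (@integrable_indic_sub _ _ _ (charge_pos_lty nu)).
set dp := \int[charge_pos nu]_u _; set dn := \int[charge_neg nu]_u _.
set fp := \int[charge_pos nu]_u f u; set fn := \int[charge_neg nu]_u f u.
set tp := fine _; set tn := fine _.
rewrite !ler_norml => h1 h2 h3; clear -h1 h2 h3.
lra.
Qed.

(** Extends the bound from continuous to bounded measurable functions, through the mass. Normalising
    by [M + 1] rather than [M] avoids a division by 0; the sign [s] yields the absolute value. *)
Lemma tv_norm_charge_integral nu (f : borel S -> R) (c M : R) :
  (tv_norm nu <= c%:E)%E -> measurable_fun setT f ->
  (forall u, `|f u| <= M) -> `|charge_integral nu f| <= (M + 1) * c.
Proof.
move=> nuc mf fM.
have M1 : 0 < M + 1 by rewrite ltr_wpDl// (le_trans _ (fM point)).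
have bf : bounded_measurable f by split => //; exists M.
have key (s : R) : `|s| = 1 -> s * charge_integral nu f <= (M + 1) * c.
  move=> s1.
  have -> : s * charge_integral nu f = (M + 1) * charge_integral nu (fun u => s / (M + 1) * f u).
    rewrite !charge_integralE !RintegralZl//.
    - by field; rewrite gt_eqF.
    - by apply: integrable_bm bf; exact: charge_neg_lty.
    - by apply: integrable_bm bf; exact: charge_pos_lty.
  rewrite ler_wpM2l ?(ltW M1)//.
  rewrite -lee_fin; apply: le_trans nuc; apply: le_trans (tv_norm_ge_mass nu).
  rewrite lee_fin; apply: charge_integral_le_mass.
    by apply: measurable_funM => //; exact: measurable_cst.
  move=> u; rewrite !normrM s1 mul1r normfV (gtr0_norm M1) mulrC ler_pdivrMr//.
  by rewrite mul1r (le_trans (fM u))// lerDl.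
rewrite ler_norml; apply/andP; split.
  by rewrite lerNl -mulN1r key// normrN1.
by rewrite -[leLHS]mul1r key// normr1.
Qed.

End total_variation_bounds.

(** * Uniform averaging *)

(** Compactness of the segment provides a cluster point, and along an ultrafilter a cluster point is
    a limit. *)
Lemma ultra_bounded_cvg (R : realType) (T : Type) (G : set_system T) (a : T -> R) (M : R) :
  UltraFilter G -> (forall n, `|a n| <= M) -> cvg (a n @[n --> G]).
Proof.
move=> UG aM.
have [x [_ clx]] : `[- M, M]%classic `&` cluster (a n @[n --> G]) !=set0.
  apply: segment_compact; apply: (@filterE T G) => n /=.
  by rewrite in_itv /= -ler_norml; exact: aM.
apply/cvg_ex; exists x => V Vx.
have [//|nV] := in_ultra_setVsetC (a @^-1` V) UG.
have [y [nVy Vy]] := clx (~` V) V nV Vx.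
by [].
Qed.

Section bounded_measurable_theory.
Context d (T : measurableType d) (R : realType).
Implicit Types f g : T -> R.

Lemma bm_cst (c : R) : bounded_measurable (fun _ : T => c).
Proof. by split; [exact: measurable_cst|exists `|c|]. Qed.

Lemma bm_indic (A : set T) : measurable A -> bounded_measurable (\1_A : T -> R).
Proof.
move=> mA; split; first exact: measurable_indic.
by exists 1 => u; rewrite indicE; case: (_ \in _); rewrite ?normr1 ?normr0.
Qed.

Lemma bm_lin (a : R) f g : bounded_measurable f -> bounded_measurable g ->
  bounded_measurable (fun u => a * f u + g u).
Proof.
move=> [mf [M fM]] [mg [N gN]]; split.
  by apply: measurable_funD => //; apply: measurable_funM => //; exact: measurable_cst.
exists (`|a| * M + N) => u; rewrite (le_trans (ler_normD _ _))// normrM lerD//.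
by rewrite ler_wpM2l.
Qed.

Lemma bm_mul f g : bounded_measurable f -> bounded_measurable g ->
  bounded_measurable (fun u => f u * g u).
Proof.
move=> [mf [M fM]] [mg [N gN]]; split; first exact: measurable_funM.
by exists (M * N) => u; rewrite normrM ler_pM.
Qed.

Lemma bm_add f g : bounded_measurable f -> bounded_measurable g ->
  bounded_measurable (fun u => f u + g u).
Proof.
by move=> bf bg; have := bm_lin 1 bf bg; under eq_fun do rewrite mul1r.
Qed.

Lemma bm_scale (a : R) f : bounded_measurable f -> bounded_measurable (fun u => a * f u).
Proof.
by move=> bf; have := bm_lin a bf (bm_cst 0); under eq_fun do rewrite addr0.
Qed.

Lemma bm_sub f g : bounded_measurable f -> bounded_measurable g ->
  bounded_measurable (fun u => f u - g u).
Proof.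
move=> bf bg; have := bm_lin (-1) bg bf.
by under eq_fun do rewrite mulN1r addrC.
Qed.

Lemma bm_sum (n : nat) (f : nat -> T -> R) : (forall i, bounded_measurable (f i)) ->
  bounded_measurable (fun u => \sum_(i < n) f i u).
Proof.
move=> bf; elim: n => [|n ih].
  by under eq_fun do rewrite big_ord0; exact: bm_cst.
by under eq_fun do rewrite big_ord_recr/=; exact: bm_add.
Qed.

(* Halving: [D f = D (2 f - 1_{f >= 1/2}) / 2] when [D = I - J] vanishes on
   indicators, so that [D f] is at most [2^-n] for every [n]. *)
Lemma bm_functional_ext (I J : (T -> R) -> R) :
  (forall a f g, bounded_measurable f -> bounded_measurable g ->
     I (fun u => a * f u + g u) = a * I f + I g) ->
  (forall a f g, bounded_measurable f -> bounded_measurable g ->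
     J (fun u => a * f u + g u) = a * J f + J g) ->
  (forall f, bounded_measurable f -> (forall u, 0 <= f u <= 1) -> 0 <= I f <= 1) ->
  (forall f, bounded_measurable f -> (forall u, 0 <= f u <= 1) -> 0 <= J f <= 1) ->
  (forall A, measurable A -> I (\1_A) = J (\1_A)) ->
  forall f, bounded_measurable f -> I f = J f.
Proof.
move=> Il Jl I01 J01 IJ.
have half n f : bounded_measurable f -> (forall u, 0 <= f u <= 1) ->
    `|I f - J f| <= 2^-1 ^+ n.
  elim: n f => [|n ih] f bf f01.
    rewrite expr0 ler_norml; have := I01 f bf f01; have := J01 f bf f01; lra.
  pose A := [set u | 2^-1 <= f u].
  have mA : measurable A.
    have := bf.1 measurableT _ (measurable_itv `[2^-1, +oo[).
    by rewrite setTI (_ : f @^-1` _ = A)//; apply/seteqP; split => u;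
      rewrite /A /= in_itv /= andbT.
  pose g u := 2 * f u + (-1) * \1_A u.
  have bA := bm_indic mA.
  have bA' := bm_scale (-1) bA.
  have bg : bounded_measurable g by exact: bm_lin.
  have g01 u : 0 <= g u <= 1.
    rewrite /g indicE; have := f01 u; have [Au|Au] := boolP (u \in A).
      by have := set_mem Au; rewrite /A /=; lra.
    by move: Au; rewrite notin_setE /A /= => /negP; rewrite -ltNge /=; lra.
  have := ih g bg g01; rewrite Il// Jl//.
  have E (L : (T -> R) -> R) : (forall a f g, bounded_measurable f -> bounded_measurable g ->
      L (fun u => a * f u + g u) = a * L f + L g) ->
      L (fun u => -1 * \1_A u) = - L (\1_A).
    move=> Ll; have := Ll (-1) _ _ bA (bm_cst 0).
    under eq_fun do rewrite addr0.
    move=> ->; have := Ll 1 _ _ (bm_cst 0) (bm_cst 0).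
    under eq_fun do rewrite mulr0 addr0.
    by move=> h; lra.
  rewrite !E// (IJ _ mA) exprS => h.
  rewrite ler_norml; move: h; rewrite ler_norml; lra.
have unit f : bounded_measurable f -> (forall u, 0 <= f u <= 1) -> I f = J f.
  move=> bf f01; apply/eqP; rewrite -subr_eq0 -normr_le0.
  apply/ler_addgt0Pl => e e0; rewrite addr0.
  have : (fun n => (2^-1 : R) ^+ n) @ \oo --> (0 : R).
    by apply: cvg_expr; rewrite ger0_norm ?invr_ge0// invf_lt1// ltr1n.
  move=> /cvgrPdist_lt/(_ e e0)[n _ /(_ n (leqnn n))] /=.
  rewrite sub0r normrN => h; apply: ltW; apply: le_lt_trans (half n f bf f01) _.
  exact: le_lt_trans (ler_norm _) h.
move=> f bf; have [mf [M fM]] := bf.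
pose N := `|M| + 1.
have N0 : 0 < N by rewrite /N ltr_wpDl.
have fN u : `|f u| <= N by rewrite (le_trans (fM u))// /N (le_trans (ler_norm _))// lerDl.
pose g u := (2 * N)^-1 * f u + 2^-1.
have b2 := bm_cst (2^-1 : R).
have bg : bounded_measurable g by exact: bm_lin.
have g01 u : 0 <= g u <= 1.
  have := fN u; rewrite /g ler_norml => /andP[h1 h2].
  have -> : (2 * N)^-1 * f u + 2^-1 = (f u + N) / (2 * N) by field; rewrite gt_eqF.
  rewrite divr_ge0 ?mulr_ge0 ?(ltW N0)//=; last lra.
  by rewrite ler_pdivrMr ?mulr_gt0//; lra.
have fE : f = (fun u => (2 * N) * g u + (- N)).
  by apply/funext => u; rewrite /g; field; rewrite gt_eqF.
have cE : I (fun=> 1) = J (fun=> 1).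
  by apply: unit; [exact: bm_cst|move=> u; rewrite lexx ler01].
have IJN : I (fun=> - N) = J (fun=> - N).
  have := Il (- N - 1) _ _ (bm_cst 1) (bm_cst 1).
  have := Jl (- N - 1) _ _ (bm_cst 1) (bm_cst 1).
  have -> : (fun _ : T => (- N - 1) * 1 + 1) = (fun _ : T => - N).
    by apply/funext => _; ring.
  by move=> -> ->; rewrite cE.
rewrite fE Il//; last exact: bm_cst.
by rewrite Jl//; [rewrite IJN (unit g bg g01)|exact: bm_cst].
Qed.

Lemma Rintegral_lin (mu : {measure set T -> \bar R}) (a : R) f g :
  (mu setT < +oo)%E -> bounded_measurable f -> bounded_measurable g ->
  \int[mu]_u (a * f u + g u) = a * \int[mu]_u f u + \int[mu]_u g u.
Proof.
move=> ml bf bg; have fi := integrable_bm ml bf; have gi := integrable_bm ml bg.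
by rewrite RintegralD// ?RintegralZl//; exact: integrable_scale.
Qed.

Lemma Rintegral_between (mu : {measure set T -> \bar R}) f (m M : R) :
  mu setT = 1%E -> bounded_measurable f -> (forall u, m <= f u <= M) ->
  m <= \int[mu]_u f u <= M.
Proof.
move=> m1 bf fM; have ml : (mu setT < +oo)%E by rewrite m1 ltry.
have fi := integrable_bm ml bf.
rewrite -[X in X <= _](Rintegral_cst1 measurableT m1).
rewrite -[X in _ && (_ <= X)](Rintegral_cst1 measurableT m1).
by apply/andP; split; apply: le_Rintegral => //;
  first [exact: integrable_cst_fin|move=> u _; case/andP: (fM u)].
Qed.

End bounded_measurable_theory.

Section functional_measure.
Context d (T : measurableType d) (R : realType).
Variable I : (T -> R) -> R.
Hypothesis I_lin : forall a f g, bounded_measurable f -> bounded_measurable g ->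
  I (fun u => a * f u + g u) = a * I f + I g.
Hypothesis I_between : forall f m M, bounded_measurable f ->
  (forall u, m <= f u <= M) -> m <= I f <= M.
Hypothesis I_additive : forall A : (set T)^nat, (forall n, measurable (A n)) ->
  trivIset setT A ->
  (fun n => \sum_(i < n) I (\1_(A i))) @ \oo --> I (\1_(\bigcup_n A n)).

(* The maximum only matters on sets that are not measurable. *)
Definition functional_measure (A : set T) : \bar R := (Num.max (I (\1_A)) 0)%:E.

Let muE A : measurable A -> functional_measure A = (I (\1_A))%:E.
Proof.
move=> mA; rewrite /functional_measure max_l//.
have /(_ 0 1) := @I_between _ _ _ (bm_indic R mA); case/(_ _)/andP => // u.
by rewrite indicE; case: (_ \in _); rewrite ?lexx ?ler01.
Qed.

Let I0 : I (fun=> 0) = 0.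
Proof.
by apply/esym/le_anti; apply: I_between => [|u]; [exact: bm_cst|rewrite lexx].
Qed.

Let mu0 : functional_measure set0 = 0%E.
Proof. by rewrite muE// indic0 I0. Qed.

Let mu_ge0 A : (0 <= functional_measure A)%E.
Proof. by rewrite lee_fin le_max lexx orbT. Qed.

Let mu_sigma_additive : semi_sigma_additive functional_measure.
Proof.
move=> A mA tA mUA; rewrite muE//.
rewrite (_ : (fun n => _) = EFin \o (fun n => \sum_(i < n) I (\1_(A i)))).
  by apply: cvg_EFin; [exact: nearW|exact: I_additive].
apply/funext => n /=; rewrite big_mkord -sumEFin.
by apply: eq_bigr => i _; exact: muE.
Qed.

HB.instance Definition _ := isMeasure.Build _ _ _ functional_measure
  mu0 mu_ge0 mu_sigma_additive.

Let mu1 : functional_measure setT = 1%E.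
Proof.
rewrite muE// indicT; congr _%:E; apply/esym/le_anti; apply: I_between => [|u].
  exact: bm_cst.
by rewrite lexx.
Qed.

HB.instance Definition _ := Measure_isProbability.Build _ _ _ functional_measure mu1.

Lemma functional_probability : exists nu : probability T R,
  forall f, bounded_measurable f -> \int[nu]_u f u = I f.
Proof.
have ml : (functional_measure setT < +oo)%E by rewrite mu1 ltry.
exists functional_measure; apply: bm_functional_ext.
- by move=> a f g bf bg; apply: Rintegral_lin => //; exact: ml.
- exact: I_lin.
- by move=> f bf; apply: Rintegral_between => //; exact: mu1.
- by move=> f bf; exact: I_between.
- by move=> A mA; rewrite Rintegral_indicT//; exact: congr1 (muE mA).
Qed.

End functional_measure.

(** The inequality at [u] holds on a neighbourhood by continuity and for all later indices by
    monotonicity; compactness makes the index uniform. *)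
Lemma dini (R : realType) (T : topologicalType) (a : nat -> T -> R) (eps : R) :
  compact [set: T] -> (forall n, continuous (a n)) ->
  (forall n m u, (n <= m)%N -> a m u <= a n u) ->
  (forall u, exists n, a n u < eps) -> exists n, forall u, a n u < eps.
Proof.
move=> /compact_near_coveringP cT ca adec asmall.
have [u _|N _ /(_ N (leqnn N)) h] := cT nat \oo (fun n u => a n u < eps) _.
  have [n an] := asmall u.
  have := cvgr_lt _ (ca n u) _ an => nan.
  exists ([set v | a n v < eps], [set m | (n <= m)%N]).
    by split; [exact: nan|exists n].
  by move=> [v m] /= [vn nm]; exact: le_lt_trans (adec _ _ _ nm) vn.
by exists N => u; exact: h.
Qed.

Lemma cvge0_near_lt (R : realType) (T : Type) (F : set_system T) (f : T -> \bar R) (eta : R) :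
  Filter F -> f x @[x --> F] --> 0%E -> 0 < eta -> \forall x \near F, (f x < eta%:E)%E.
Proof.
move=> FF f0 e0; have /f0 // : nbhs 0%E [set y : \bar R | (y < eta%:E)%E].
by apply: open_ereal_lt'; rewrite lte_fin.
Qed.

(** Compactness along the filter [+oo]: the finitely many local bounds of a subcover are replaced by
    one larger bound. *)
Lemma compact_locally_bounded (R : realType) (T : topologicalType) (Q : R -> T -> Prop) :
  compact [set: T] -> (forall a b u, a <= b -> Q a u -> Q b u) ->
  (forall u : T, exists M, \forall v \near u, Q M v) -> exists M, forall u, Q M u.
Proof.
move=> /compact_near_coveringP cT Qmono loc.
have [u _|M [_ /(_ (M + 1)) h]] := cT R +oo Q _.
  have [N hN] := loc u.
  exists (Q N, [set M | N < M]); first by split; [exact: hN|exists N; split; rewrite ?num_real].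
  by move=> [v M] /= [vN NM]; exact: Qmono (ltW NM) vN.
by exists (M + 1) => u; apply: h => //; rewrite ltrDl.
Qed.

Lemma compact_continuous_bounded (R : realType) (T : topologicalType) (f : T -> R) :
  compact [set: T] -> continuous f -> exists M, forall u, `|f u| <= M.
Proof.
move=> cT cf; apply: (@compact_locally_bounded R T (fun M u => `|f u| <= M)) => //.
  by move=> a b u ab /le_trans; exact.
move=> u; exists (`|f u| + 1).
have /cvgrPdist_lt/(_ 1 ltr01) := cf u; apply: filterS => v fuv.
rewrite -lerBlDl (le_trans _ (ltW fuv))// distrC.
exact: le_trans (lerB_dist _ _) _.
Qed.

Section tv_continuity.
Context (R : realType) (S : pmetricType R).
Variable nu : S -> {charge set (borel S) -> \bar R}.
Hypothesis nu_continuous : tv_continuous nu.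

(** The neighbourhood does not depend on the test function nor on its bound, which makes the local
    bounds below uniform. *)
Lemma tv_continuous_near u (eta : R) : 0 < eta -> \forall v \near u,
  forall (f : borel S -> R) M, measurable_fun setT f -> (forall w, `|f w| <= M) ->
  `|charge_integral (nu v) f - charge_integral (nu u) f| <= (M + 1) * eta.
Proof.
move=> eta0; have eta20 : 0 < 2^-1 * eta by rewrite mulr_gt0 ?invr_gt0.
have near_u := cvge0_near_lt (nbhs_filter u) (nu_continuous u) eta20.
apply: filterS near_u => v.
rewrite /tv_dist => /ltW; rewrite EFinM lee_pmul2l// => h f M mf fM.
have bf : bounded_measurable f by split => //; exists M.
by rewrite -charge_integral_sub//; exact: tv_norm_charge_integral h mf fM.
Qed.

Lemma tv_continuous_charge_integral f : bounded_measurable (f : borel S -> R) ->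
  continuous (fun u => charge_integral (nu u) f).
Proof.
move=> [mf [M fM]] u.
have M1 : 0 < M + 1 by rewrite ltr_wpDl// (le_trans _ (fM point)).
apply/cvgrPdist_le => e e0.
have /(tv_continuous_near u) : 0 < e / (M + 1) by rewrite divr_gt0.
apply: filterS => v /(_ f M mf fM).
by rewrite distrC mulrCA divff ?gt_eqF// mulr1.
Qed.

Lemma tv_continuous_bounded : compact [set: S] ->
  exists2 c, 0 <= c & forall u (f : borel S -> R) M, measurable_fun setT f ->
    (forall w, `|f w| <= M) -> `|charge_integral (nu u) f| <= (M + 1) * c.
Proof.
move=> cS; pose Q c u := forall (f : borel S -> R) M, measurable_fun setT f ->
    (forall w, `|f w| <= M) -> `|charge_integral (nu u) f| <= (M + 1) * c.
have Qmono a b u : a <= b -> Q a u -> Q b u.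
  move=> ab Qa f M mf fM; rewrite (le_trans (Qa f M mf fM))// ler_wpM2l//.
  by rewrite addr_ge0// (le_trans _ (fM point)).
have [|c Qc] := compact_locally_bounded cS Qmono.
  move=> u; exists (fine (tv_norm (nu u)) + 1).
  have := tv_continuous_near u (@ltr01 R); apply: filterS => v h f M mf fM.
  have := h f M mf fM; rewrite mulr1.
  have fin : tv_norm (nu u) \is a fin_num.
    by rewrite fin_real// tv_norm_lty andbT (lt_le_trans _ (tv_norm_ge_mass _))// ltNyr.
  have : (tv_norm (nu u) <= (fine (tv_norm (nu u)))%:E)%E by rewrite (fineK fin).
  move=> /tv_norm_charge_integral -/(_ _ _ mf fM) h1 h2.
  rewrite -[X in `|X|](subrK (charge_integral (nu u) f)) (le_trans (ler_normD _ _))//.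
  by rewrite mulrDr mulr1 addrC lerD.
by exists `|c| => // u; exact: Qmono (ler_norm c) (Qc u).
Qed.

End tv_continuity.

Section averaging.
Context (R : realType) (S : pmetricType R) (K : R.-pker borel S ~> borel S).
Implicit Types f g : S -> R.

Definition kernel_op f (u : S) : R := \int[K u]_v f v.

Lemma kernel_op_lty u : (K u setT < +oo)%E.
Proof. by rewrite prob_kernel ltry. Qed.

Lemma kernel_op_between f m M : bounded_measurable (f : borel S -> R) ->
  (forall u, m <= f u <= M) -> forall u, m <= kernel_op f u <= M.
Proof. by move=> bf fM u; apply: Rintegral_between => //; exact: prob_kernel. Qed.

Lemma kernel_op_lin a f g : bounded_measurable (f : borel S -> R) ->
  bounded_measurable (g : borel S -> R) ->
  kernel_op (fun u => a * f u + g u) = (fun u => a * kernel_op f u + kernel_op g u).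
Proof.
by move=> bf bg; apply/funext => u; apply: Rintegral_lin => //; exact: kernel_op_lty.
Qed.

Hypothesis K_continuous : tv_continuous (kernel_at K).

(** The strong Feller property: continuity in total variation makes [K f] continuous even if [f] is
    only measurable. Dini's theorem can therefore be applied to indicators. *)
Lemma kernel_op_continuous f : bounded_measurable (f : borel S -> R) ->
  continuous (kernel_op f).
Proof.
move=> bf; have -> : kernel_op f = fun u => charge_integral (kernel_at K u) f.
  by apply/funext => u; rewrite (@charge_integral_measure _ _ _ _ (K u))// kernel_op_lty.
exact: tv_continuous_charge_integral.
Qed.

Lemma kernel_op_bm f : bounded_measurable (f : borel S -> R) ->
  bounded_measurable (kernel_op f : borel S -> R).
Proof.
move=> bf; have [mf [M fM]] := bf.
apply: (@bounded_continuous_bm _ _ _ M); first exact: kernel_op_continuous.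
by move=> u; rewrite ler_norml; apply: kernel_op_between => // v; rewrite -ler_norml.
Qed.

Lemma iter_kernel_op_bm n f : bounded_measurable (f : borel S -> R) ->
  bounded_measurable (iter n kernel_op f : borel S -> R).
Proof. by move=> bf; elim: n => //= n; exact: kernel_op_bm. Qed.

Lemma iter_kernel_op_between n f m M : bounded_measurable (f : borel S -> R) ->
  (forall u, m <= f u <= M) -> forall u, m <= iter n kernel_op f u <= M.
Proof.
move=> bf fM; elim: n => //= n; apply: kernel_op_between.
exact: iter_kernel_op_bm.
Qed.

Lemma iter_kernel_op_lin n a f g : bounded_measurable (f : borel S -> R) ->
  bounded_measurable (g : borel S -> R) ->
  iter n kernel_op (fun u => a * f u + g u) =
  (fun u => a * iter n kernel_op f u + iter n kernel_op g u).
Proof.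
move=> bf bg; elim: n => //= n ->.
by rewrite kernel_op_lin//; exact: iter_kernel_op_bm.
Qed.

(** The sum starts at [K f] and not at [f], so that bounds on [kernel_op f] alone control the
    averages. *)
Definition cesaro n f (u : S) : R :=
  n.+1%:R^-1 * \sum_(i < n.+1) iter i.+1 kernel_op f u.

Lemma cesaro_between n f m M : bounded_measurable (f : borel S -> R) ->
  (forall u, m <= kernel_op f u <= M) -> forall u, m <= cesaro n f u <= M.
Proof.
move=> bf fM u; have bk := kernel_op_bm bf.
have h i : m <= iter i.+1 kernel_op f u <= M.
  by rewrite iterSr; apply: iter_kernel_op_between.
rewrite /cesaro; apply/andP; split.
  rewrite ler_pdivlMl// mulr_natl -[X in _ *+ X]card_ord -sumr_const.
  by apply: ler_sum => i _; have /andP[] := h i.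
rewrite ler_pdivrMl// mulr_natl -[X in _ *+ X]card_ord -sumr_const.
by apply: ler_sum => i _; have /andP[] := h i.
Qed.

Lemma cesaro_lin n a f g u : bounded_measurable (f : borel S -> R) ->
  bounded_measurable (g : borel S -> R) ->
  cesaro n (fun u => a * f u + g u) u = a * cesaro n f u + cesaro n g u.
Proof.
move=> bf bg; rewrite /cesaro mulrCA -mulrDr; congr (_ * _).
by rewrite mulr_sumr -big_split; apply: eq_bigr => i _; rewrite (iter_kernel_op_lin i.+1).
Qed.

(** Telescoping leaves two boundary terms, each bounded by [M]. *)
Lemma cesaro_kernel_op n f M u : bounded_measurable (f : borel S -> R) ->
  (forall u, `|f u| <= M) ->
  `|cesaro n (kernel_op f) u - cesaro n f u| <= n.+1%:R^-1 * (2 * M).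
Proof.
move=> bf fM; rewrite /cesaro -mulrBr normrM ger0_norm ?invr_ge0// ler_wpM2l ?invr_ge0//.
have -> : \sum_(i < n.+1) iter i.+1 kernel_op (kernel_op f) u
    - \sum_(i < n.+1) iter i.+1 kernel_op f u
    = iter n.+2 kernel_op f u - iter 1 kernel_op f u.
  rewrite -sumrB -(telescope_sumr (fun i => iter i.+1 kernel_op f u))// big_mkord.
  by apply: eq_bigr => i _; rewrite -iterSr.
have h k : `|iter k kernel_op f u| <= M.
  by rewrite ler_norml; apply: iter_kernel_op_between => // v; rewrite -ler_norml.
by rewrite (le_trans (ler_normB _ _))// mulr_natl mulr2n lerD.
Qed.

Hypothesis compact_S : compact [set: S].

(** For each [u] the tails decrease to 0 because [K u] is a measure; their images under [K] are
    continuous, so Dini's theorem makes the convergence uniform. *)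
Lemma indic_tail_small (A : (set (borel S))^nat) (e : R) : (forall n, measurable (A n)) ->
  trivIset setT A -> 0 < e ->
  exists n, forall m u, (n <= m)%N ->
    0 <= kernel_op (fun v => \1_(\bigcup_n A n) v - \sum_(i < m) \1_(A i) v) u <= e.
Proof.
move=> mA tA e0; have mU : measurable (\bigcup_n A n) by exact: bigcupT_measurable.
have bs n : bounded_measurable (fun v : borel S => \sum_(i < n) \1_(A i) v : R).
  by apply: (@bm_sum _ _ _ n (fun i => \1_(A i))) => i; exact: bm_indic.
have br n : bounded_measurable
    (fun v : borel S => \1_(\bigcup_n A n) v - \sum_(i < n) \1_(A i) v : R).
  by apply: bm_sub => //; exact: bm_indic.
have rmono n m u : (n <= m)%N ->
    kernel_op (fun v => \1_(\bigcup_n A n) v - \sum_(i < m) \1_(A i) v) u <=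
    kernel_op (fun v => \1_(\bigcup_n A n) v - \sum_(i < n) \1_(A i) v) u.
  move=> nm; apply: le_Rintegral => //.
  - by apply: integrable_bm => //; exact: kernel_op_lty.
  - by apply: integrable_bm => //; exact: kernel_op_lty.
  - move=> v _; rewrite lerD2l lerN2.
    by rewrite -(subnKC nm) big_split_ord/= lerDl sumr_ge0.
suff [n small] : exists n, forall u,
    kernel_op (fun v => \1_(\bigcup_n A n) v - \sum_(i < n) \1_(A i) v) u < e.
  exists n => m u nm; rewrite (le_trans (rmono _ _ u nm) (ltW (small u))) andbT.
  apply: Rintegral_ge0 => v _; rewrite subr_ge0 -lee_fin indic_bigcup// -sumEFin.
  rewrite -(big_mkord xpredT (fun i => (\1_(A i) v)%:E)).
  by apply: nneseries_lim_ge => i _ _; rewrite lee_fin.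
apply: (@dini _ _ (fun n => kernel_op (fun v => \1_(\bigcup_n A n) v - \sum_(i < n) \1_(A i) v))) => //.
- by move=> n; exact: kernel_op_continuous.
- move=> u; have rE n : kernel_op (fun v => \1_(\bigcup_n A n) v - \sum_(i < n) \1_(A i) v) u
      = fine (K u (\bigcup_n A n)) - \sum_(i < n) fine (K u (A i)).
    rewrite /kernel_op RintegralB//.
    + rewrite Rintegral_indicT ?kernel_op_lty//; congr (_ - _).
      elim: n => [|n ih].
        under eq_Rintegral do rewrite big_ord0.
        by rewrite Rintegral_cst1 ?big_ord0// prob_kernel.
      under eq_Rintegral do rewrite big_ord_recr/=.
      rewrite RintegralD//.
      * by rewrite ih big_ord_recr/= Rintegral_indicT// kernel_op_lty.
      * by apply: integrable_bm; [exact: kernel_op_lty|exact: bs].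
      * by apply: integrable_bm; [exact: kernel_op_lty|exact: bm_indic].
    + by apply: integrable_bm; [exact: kernel_op_lty|exact: bm_indic].
    + by apply: integrable_bm; [exact: kernel_op_lty|exact: bs].
  have fin B : measurable B -> K u B \is a fin_num.
    move=> mB; rewrite ge0_fin_numE// (le_lt_trans _ (kernel_op_lty u))//.
    by apply: le_measure; rewrite ?inE.
  have := @measure_semi_sigma_additive _ _ _ (K u) A mA tA mU.
  rewrite -(fineK (fin _ mU)) => /fine_cvgP[_] /cvgrPdist_lt/(_ e e0)[n _ /(_ n (leqnn n))].
  rewrite /= => h; exists n; rewrite rE; apply: le_lt_trans (ler_norm _) _.
  rewrite (_ : \sum_(i < n) fine _ = fine (\sum_(0 <= i < n) K u (A i)))//.
  by rewrite big_mkord sum_fine// => i _; exact: fin.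
Qed.


Variable pi0 : probability (borel S) R.
Hypothesis pi0_invariant : unique_invariant K pi0.

(* Otherwise an ultrafilter limit of [cesaro n] along points where the averages
   stay away from the limit would be another invariant probability; it is
   countably additive by Dini's theorem. *)
Lemma averaging f (eps : R) : bounded_measurable (f : borel S -> R) -> 0 < eps ->
  exists n, forall u, `|cesaro n f u - \int[pi0]_u f u| <= eps.
Proof.
move=> bf eps0; apply: contrapT => no.
have /choice[u_ hu] : forall n, exists u, eps < `|cesaro n f u - \int[pi0]_u f u|.
  move=> n; apply: contrapT => non; apply: no; exists n => u.
  by rewrite leNgt; apply/negP => h; apply: non; exists u.
have [G [UG sG]] := ultraFilterLemma eventually_filter.
pose I g := lim (cesaro n g (u_ n) @[n --> G]).
have I_cvg g : bounded_measurable (g : borel S -> R) -> cesaro n g (u_ n) @[n --> G] --> I g.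
  move=> bg; have [mg [M gM]] := bg.
  apply: (@ultra_bounded_cvg _ _ _ (fun n => cesaro n g (u_ n)) M) => // n.
  rewrite ler_norml; apply: cesaro_between => // v; apply: kernel_op_between => // w.
  by rewrite -ler_norml.
have I_between' g m M : bounded_measurable (g : borel S -> R) ->
    (forall u, m <= kernel_op g u <= M) -> m <= I g <= M.
  move=> bg gM; apply/andP; split.
    apply: (cvgr_to_ge (I_cvg g bg)); apply: nearW => n.
    by have /andP[] := cesaro_between n bg gM (u_ n).
  apply: (cvgr_to_le (I_cvg g bg)); apply: nearW => n.
  by have /andP[] := cesaro_between n bg gM (u_ n).
have I_lin a g h : bounded_measurable (g : borel S -> R) ->
    bounded_measurable (h : borel S -> R) ->
    I (fun u => a * g u + h u) = a * I g + I h.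
  move=> bg bh; apply/cvg_lim => //; under eq_cvg do rewrite cesaro_lin//.
  by apply: cvgD; [apply: cvgMr; exact: I_cvg|exact: I_cvg].
have I_sum n (g : nat -> S -> R) : (forall i, bounded_measurable (g i : borel S -> R)) ->
    I (fun u => \sum_(i < n) g i u) = \sum_(i < n) I (g i).
  move=> bg; elim: n => [|n ih].
    rewrite big_ord0 (_ : (fun u => _) = (fun=> 0)); last first.
      by apply/funext => u; rewrite big_ord0.
    apply/esym/le_anti; apply: I_between' => [|u]; first exact: bm_cst.
    by apply: kernel_op_between => [|v]; [exact: bm_cst|rewrite lexx].
  rewrite big_ord_recr/= -ih -[X in X + _]mul1r addrC -[RHS]addrC -I_lin//.
    by congr I; apply/funext => u; rewrite big_ord_recr/= mul1r.
  exact: bm_sum.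
have [||nu nuE] := @functional_probability _ (borel S) R I I_lin.
- by move=> g m M bg gM; apply: I_between' => //; exact: kernel_op_between.
(* Countable additivity of the limit functional: the tails are small uniformly in the phase after
   one application of [K], hence in every average, whatever the points [u_ n] are. *)
- move=> A mA tA; apply/cvgrPdist_le => e e0.
  have [n small] := indic_tail_small mA tA e0; near=> m.
  have mU : measurable (\bigcup_n A n) by exact: bigcupT_measurable.
  rewrite -(I_sum m (fun i => \1_(A i))) => [|i]; last exact: bm_indic.
  have bs : bounded_measurable (fun v : borel S => \sum_(i < m) \1_(A i) v : R).
    by apply: (@bm_sum _ _ _ m (fun i => \1_(A i))) => i; exact: bm_indic.
  have bU := @bm_indic _ _ R _ mU.
  rewrite [X in `|X|](_ : _ = I (fun v => \1_(\bigcup_n A n) v - \sum_(i < m) \1_(A i) v)).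
    have nm : (n <= m)%N by near: m; exact: nbhs_infty_ge.
    have /andP[h0 he] : 0 <= I (fun v => \1_(\bigcup_n A n) v - \sum_(i < m) \1_(A i) v) <= e.
      by apply: I_between' => [|u]; [exact: bm_sub|exact: small].
    by rewrite ger0_norm.
  rewrite -mulN1r addrC -I_lin//; congr I; apply/funext => v.
  by rewrite mulN1r addrC.
have I_op g : bounded_measurable (g : borel S -> R) -> I (kernel_op g) = I g.
  move=> bg; have [mg [M gM]] := bg; apply/cvg_lim => //.
  have M0 : 0 <= M by apply: le_trans (gM point).
  have -> : (fun n => cesaro n (kernel_op g) (u_ n)) =
      (fun n => cesaro n g (u_ n) + (cesaro n (kernel_op g) (u_ n) - cesaro n g (u_ n))).
    by apply/funext => n; rewrite addrC subrK.
  rewrite -[I g]addr0; apply: cvgD; first exact: I_cvg.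
  suff h : (fun n => cesaro n (kernel_op g) (u_ n) - cesaro n g (u_ n)) @ \oo --> (0 : R).
    by move=> A /h hA; exact: sG.
  apply/norm_cvg0P; apply: (@squeeze_cvgr _ _ _ _ (fun=> 0) (fun n => n.+1%:R^-1 * (2 * M))).
  - by apply: nearW => n; rewrite normr_ge0/= cesaro_kernel_op.
  - exact: cvg_cst.
  - rewrite -[X in _ --> X](mul0r (2 * M)); apply: cvgMl; exact: cvg_harmonic.
have nu_inv : Defs.invariant K nu.
  move=> B mB; have bB := @bm_indic _ _ R _ mB; have bKB := kernel_op_bm bB.
  have finK u : K u B \is a fin_num.
    rewrite ge0_fin_numE// (le_lt_trans _ (kernel_op_lty u))//.
    by apply: le_measure; rewrite ?inE.
  have KE u : K u B = (kernel_op (\1_B) u)%:E.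
    by rewrite /kernel_op Rintegral_indicT ?kernel_op_lty// fineK.
  under eq_integral do rewrite KE.
  have nul : (nu setT < +oo)%E by rewrite probability_setT ltry.
  have finB : nu B \is a fin_num by exact: fin_num_measure.
  rewrite -[LHS]fineK// -(@Rintegral_indicT _ _ _ nu)// nuE// -I_op// -nuE//.
  rewrite /Rintegral fineK//; apply: integrable_fin_num => //.
  exact: integrable_bm bKB.
have piE : \int[pi0]_u f u = I f.
  by rewrite -nuE//; apply: eq_measure_Rintegral => A mA; exact/esym/(pi0_invariant.2 nu nu_inv).
(* By uniqueness the limit of the bad averages is the mean under [pi0], yet each of them is more
   than [eps] away from it. *)
have /cvgrPdist_lt/(_ _ eps0) near_G := I_cvg f bf.
have [n] := @filter_ex _ G _ _ near_G.
by rewrite -piE distrC ltNge (ltW (hu n)).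
Unshelve. all: by end_near. Qed.

End averaging.

(** * Approximate solutions of the Poisson equation *)

Section corrector.
Context (R : realType) (S : pmetricType R) (K : R.-pker borel S ~> borel S).
Hypothesis K_continuous : tv_continuous (kernel_at K).
Hypothesis compact_S : compact [set: S].
Variable pi0 : probability (borel S) R.
Hypothesis pi0_invariant : unique_invariant K pi0.
Implicit Types f g : S -> R.

Let coboundary f := exists2 g : borel S -> R, bounded_measurable g &
  forall u, f u = kernel_op K g u - g u.

Let coboundary_lin a f f' : coboundary f -> coboundary f' ->
  coboundary (fun u => a * f u + f' u).
Proof.
move=> [g bg fg] [g' bg' fg']; exists (fun u => a * g u + g' u); first exact: bm_lin.
by move=> u; rewrite fg fg' kernel_op_lin//; ring.
Qed.

Let coboundary_iter i f : bounded_measurable (f : borel S -> R) ->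
  coboundary (fun u => iter i (kernel_op K) f u - f u).
Proof.
move=> bf; elim: i => [|i [g bg ih]].
  exists (fun=> 0); first exact: bm_cst.
  by move=> u; rewrite /= subrr subr0 /kernel_op Rintegral_cst1// prob_kernel.
have bi := iter_kernel_op_bm K_continuous i bf.
exists (fun u => 1 * g u + iter i (kernel_op K) f u); first exact: bm_lin.
by move=> u; rewrite kernel_op_lin//=; have := ih u; lra.
Qed.

(** Each K^i f - f is a coboundary, by telescoping, hence so is the Cesaro average minus f. Adding
    this coboundary to f turns f into the average, which is uniformly close to the mean. *)
Lemma approximate_corrector f (eps : R) : bounded_measurable (f : borel S -> R) -> 0 < eps ->
  exists2 g : borel S -> R, bounded_measurable g &
    forall u, `|f u + (kernel_op K g u - g u) - \int[pi0]_u f u| <= eps.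
Proof.
move=> bf e0; have [n hn] := averaging K_continuous compact_S pi0_invariant bf e0.
suff [g bg gE] : coboundary (fun u => cesaro K n f u - f u).
  by exists g => // u; rewrite -gE [f u + _]addrC subrK.
have -> : (fun u => cesaro K n f u - f u) =
    (fun u => n.+1%:R^-1 * \sum_(i < n.+1) (iter i.+1 (kernel_op K) f u - f u) + 0).
  apply/funext => u; rewrite addr0 sumrB mulrBr sumr_const card_ord -[f u *+ _]mulr_natl.
  by rewrite mulKf.
have c0 : coboundary (fun=> 0).
  by exists (fun=> 0); [exact: bm_cst|move=> u; rewrite subr0 /kernel_op Rintegral_cst1// prob_kernel].
apply: coboundary_lin => //; elim: n.+1 => [|m ih].
  by under eq_fun do rewrite big_ord0.
under eq_fun do rewrite big_ord_recr.
have := coboundary_lin 1 ih (coboundary_iter m.+1 bf).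
by under eq_fun do rewrite mul1r.
Qed.

End corrector.

(** * The Lyapunov function *)

Section asymptotics.
Context (R : realType) (S : pmetricType R).
Variable H : set (strip R S).
Implicit Types F G : strip R S -> R.

(** A uniform o(1) over the states of [H] as the abscissa grows. Since [x1] is at least 1,
    identities that divide by the abscissa may be used to rewrite such quantities. *)
Definition negligible_at_infinity F := forall eps, 0 < eps ->
  exists2 x1, 1 <= x1 & forall z, H z -> x1 <= z.1 -> `|F z| <= eps.

Definition bounded_at_infinity F := exists M,
  exists2 x1, 1 <= x1 & forall z, H z -> x1 <= z.1 -> `|F z| <= M.

Local Notation neg := negligible_at_infinity.
Local Notation bnd := bounded_at_infinity.

Lemma neg_bnd F : neg F -> bnd F.
Proof. by move=> nF; exists 1; exact: nF. Qed.

Lemma bnd_bounded F M : (forall z, `|F z| <= M) -> bnd F.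
Proof. by move=> FM; exists M, 1. Qed.

Lemma neg_ext F G : (forall z, H z -> 1 <= z.1 -> F z = G z) -> neg F -> neg G.
Proof.
move=> FG nF e /nF[x1 x11 h]; exists x1 => // z Hz xz.
by rewrite -FG// ?h// (le_trans x11).
Qed.

Lemma bnd_ext F G : (forall z, H z -> 1 <= z.1 -> F z = G z) -> bnd F -> bnd G.
Proof.
move=> FG [M [x1 x11 h]]; exists M, x1 => // z Hz xz.
by rewrite -FG// ?h// (le_trans x11).
Qed.

Lemma neg_le F G : (forall z, H z -> 1 <= z.1 -> `|F z| <= `|G z|) -> neg G -> neg F.
Proof.
move=> FG nG e /nG[x1 x11 h]; exists x1 => // z Hz xz.
by rewrite (le_trans (FG _ Hz _)) ?h// (le_trans x11).
Qed.

Lemma neg_add F G : neg F -> neg G -> neg (fun z => F z + G z).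
Proof.
move=> nF nG e e0; have e20 : 0 < e / 2 by rewrite divr_gt0.
have [x1 x11 hF] := nF _ e20; have [x2 x21 hG] := nG _ e20.
exists (Num.max x1 x2) => [|z Hz]; first by rewrite le_max x11.
rewrite ge_max => /andP[/(hF _ Hz) h1 /(hG _ Hz) h2].
by rewrite (le_trans (ler_normD _ _))// [e]splitr lerD.
Qed.

Lemma bnd_add F G : bnd F -> bnd G -> bnd (fun z => F z + G z).
Proof.
move=> [M [x1 x11 hF]] [N [x2 x21 hG]]; exists (M + N).
exists (Num.max x1 x2) => [|z Hz]; first by rewrite le_max x11.
rewrite ge_max => /andP[/(hF _ Hz) h1 /(hG _ Hz) h2].
by rewrite (le_trans (ler_normD _ _))// lerD.
Qed.

Lemma bnd_mul F G : bnd F -> bnd G -> bnd (fun z => F z * G z).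
Proof.
move=> [M [x1 x11 hF]] [N [x2 x21 hG]]; exists (M * N).
exists (Num.max x1 x2) => [|z Hz]; first by rewrite le_max x11.
rewrite ge_max => /andP[/(hF _ Hz) h1 /(hG _ Hz) h2].
by rewrite normrM ler_pM.
Qed.

Lemma neg_mul F G : neg F -> bnd G -> neg (fun z => F z * G z).
Proof.
move=> nF [M [x2 x21 hG]] e e0.
have N0 : 0 < `|M| + 1 by rewrite ltr_wpDl.
have [x1 x11 hF] := nF (e / (`|M| + 1)) (divr_gt0 e0 N0).
exists (Num.max x1 x2) => [|z Hz]; first by rewrite le_max x11.
rewrite ge_max => /andP[/(hF _ Hz) h1 /(hG _ Hz) h2].
rewrite normrM (le_trans (ler_pM _ _ h1 h2))// -mulrA ger_pMr//.
by rewrite mulrC ler_pdivrMr// mul1r (le_trans (ler_norm _))// lerDl.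
Qed.

Lemma neg_inv : neg (fun z => z.1^-1).
Proof.
move=> e e0; exists (Num.max 1 e^-1) => [|z _]; first by rewrite le_max lexx.
rewrite ge_max => /andP[x1 xe]; have x0 : 0 < z.1 by exact: lt_le_trans x1.
by rewrite gtr0_norm ?invr_gt0// -[leRHS]invrK lef_pV2// ?posrE// invr_gt0.
Qed.

Lemma neg_inv_add1 : neg (fun z => (1 + z.1)^-1).
Proof.
move=> e /neg_inv[x1 x11 h]; exists x1 => // z Hz xz.
have x0 : 0 < z.1 by rewrite (lt_le_trans _ xz)// (lt_le_trans ltr01).
apply: le_trans (h z Hz xz).
by rewrite !gtr0_norm ?invr_gt0 ?addr_gt0// lef_pV2 ?posrE ?addr_gt0// lerDr.
Qed.

End asymptotics.

Section lyapunov_function.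
Context (R : realType) (S : pmetricType R).

Lemma measurable_first : measurable_fun setT (fst : strip R S -> R).
Proof. exact: measurable_fst. Qed.

Lemma measurable_phase (f : S -> R) : measurable_fun setT (f : borel S -> R) ->
  measurable_fun setT (fun z : strip R S => f z.2).
Proof. by move=> mf; exact: measurableT_comp mf measurable_snd. Qed.

Variables (psi g : S -> R) (c : R).

(* The absolute value only makes the denominator positive off the half-strip. *)
Definition lyapunov (z : strip R S) : R :=
  z.1 + psi z.2 + c + g z.2 * (1 + `|z.1|)^-1.

Lemma measurable_lyapunov : measurable_fun setT (psi : borel S -> R) ->
  measurable_fun setT (g : borel S -> R) -> measurable_fun setT lyapunov.
Proof.
move=> mpsi mg; apply: measurable_funD.
  apply: measurable_funD; last exact: measurable_cst.
  by apply: measurable_funD; [exact: measurable_first|exact: measurable_phase].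
apply: measurable_funM; first exact: measurable_phase.
apply: (@measurableT_comp _ _ _ _ _ _ (fun y : R => (1 + `|y|)^-1)); last exact: measurable_first.
apply: continuous_measurable_fun => y.
apply: cvgV; first by rewrite gt_eqF// ltr_pwDl.
by apply: cvgD; [exact: cvg_cst|exact: norm_continuous].
Qed.

End lyapunov_function.

Section increments.
Context (R : realType).
Implicit Types a b x X M : R.

Lemma norm_le_sqr x : `|x| <= 1 + x ^+ 2.
Proof.
rewrite -[x ^+ 2]real_normK ?num_real//.
by have := sqr_ge0 (`|x| - 1); have := normr_ge0 x; nra.
Qed.

(** Trades the weight at the new abscissa for the weight at the old one at the price of a factor 1 +
    |X - x|, for jumps of any size. *)
Lemma near_ratio x X : 0 <= x -> 0 <= X -> 1 + x <= (1 + X) * (1 + `|X - x|).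
Proof.
move=> x0 X0; have h : x <= X + `|X - x|.
  by rewrite -lerBlDl (le_trans (ler_norm _))// distrC.
have h2 : 0 <= X * `|X - x| by rewrite mulr_ge0.
by clear -h h2; nra.
Qed.

Lemma weight_bound a x X M : 0 <= x -> 0 <= X -> `|a| <= M ->
  `|a * (1 + X)^-1| <= M * (1 + `|X - x|) / (1 + x).
Proof.
move=> x0 X0 aM; have x1 : 0 < 1 + x by rewrite ltr_pwDl.
have X1 : 0 < 1 + X by rewrite ltr_pwDl.
rewrite normrM (gtr0_norm (_ : 0 < (1 + X)^-1)) ?invr_gt0// -mulrA ler_pM//.
  by rewrite invr_ge0 ltW.
by rewrite ler_pdivlMr// mulrC ler_pdivrMr// mulrC near_ratio.
Qed.

(** The left-hand side is exactly a / (1 + X) times (x - X) / (1 + x), so the error has the order (1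
    + x)^-2 and remains negligible after multiplication by x. *)
Lemma weight_increment a b x X M : 0 <= x -> 0 <= X -> `|a| <= M ->
  `|(a * (1 + X)^-1 - b * (1 + x)^-1) - (a - b) * (1 + x)^-1| <=
  M * (1 + 2 * (X - x) ^+ 2) / (1 + x) ^+ 2.
Proof.
move=> x0 X0 aM; have x1 : 0 < 1 + x by rewrite ltr_pwDl.
have X1 : 0 < 1 + X by rewrite ltr_pwDl.
have -> : (a * (1 + X)^-1 - b * (1 + x)^-1) - (a - b) * (1 + x)^-1 =
    a * (1 + X)^-1 * ((x - X) / (1 + x)) by field; rewrite !gt_eqF.
have M0 : 0 <= M by apply: le_trans aM.
rewrite normrM (le_trans (ler_pM _ _ (weight_bound x0 X0 aM) (lexx _)))// normrM.
rewrite (gtr0_norm (_ : 0 < (1 + x)^-1)) ?invr_gt0// [`|x - X|]distrC.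
have -> : M * (1 + `|X - x|) / (1 + x) * (`|X - x| / (1 + x)) =
    M * ((1 + `|X - x|) * `|X - x|) / (1 + x) ^+ 2 by field; rewrite gt_eqF.
rewrite ler_pM2r ?invr_gt0 ?exprn_gt0// ler_wpM2l//.
by rewrite -[(X - x) ^+ 2]real_normK ?num_real//; have := sqr_ge0 (`|X - x| - 1); nra.
Qed.

(* [s] stands for the increment of [psi]. *)
Lemma square_increment a b s x X M : 0 <= x -> 0 <= X ->
  `|a| <= M -> `|b| <= M -> `|s| <= 2 * M ->
  `|(X - x + s + (a * (1 + X)^-1 - b * (1 + x)^-1)) ^+ 2 - (X - x + s) ^+ 2| <=
  16 * M * (1 + 2 * M) * (1 + (X - x) ^+ 2) / (1 + x).
Proof.
move=> x0 X0 aM bM sM; have x1 : 0 < 1 + x by rewrite ltr_pwDl.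
have M0 : 0 <= M by apply: le_trans aM.
set w := a * (1 + X)^-1 - b * (1 + x)^-1; set D := X - x.
have -> : (D + s + w) ^+ 2 - (D + s) ^+ 2 = w * (2 * (D + s) + w) by ring.
have bw : `|b * (1 + x)^-1| <= M / (1 + x).
  by rewrite normrM (gtr0_norm (_ : 0 < (1 + x)^-1)) ?invr_gt0// ler_pM2r ?invr_gt0.
have w1 : `|w| <= M * (2 + `|D|) / (1 + x).
  rewrite (le_trans (ler_normB _ _))//.
  rewrite (le_trans (lerD (weight_bound x0 X0 aM) bw))// -mulrDl ler_pM2r ?invr_gt0//.
  by rewrite -/D le_eqVlt; apply/orP; left; apply/eqP; ring.
have w2 : `|w| <= M * (2 + `|D|).
  rewrite (le_trans w1)// ler_pdivrMr// ler_peMr ?lerDl//.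
  by rewrite mulr_ge0// addr_ge0.
have t : `|2 * (D + s) + w| <= 2 * `|D| + 4 * M + M * (2 + `|D|).
  rewrite (le_trans (ler_normD _ _))// lerD// normrM ger0_norm//.
  have := ler_normD D s; lra.
rewrite normrM (le_trans (ler_pM _ _ w1 t))//.
rewrite mulrAC ler_pM2r ?invr_gt0//.
have := normr_ge0 D; rewrite -[D ^+ 2]real_normK ?num_real//; set r := `|D| => r0.
have h1 : 0 <= (1 - r) ^+ 2 by exact: sqr_ge0.
have h2 : M * (2 + r) * (2 * r + 4 * M + M * (2 + r)) <=
    M * (2 * (1 + r)) * (4 * (1 + 2 * M) * (1 + r)).
  have Mr : 0 <= M * (2 + r) by rewrite mulr_ge0// addr_ge0.
  apply: ler_pM => //.
  - by rewrite !addr_ge0// ?mulr_ge0// addr_ge0.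
  - by rewrite ler_wpM2l//; lra.
  - have Mr0 : 0 <= M * r by rewrite mulr_ge0.
    by clear -M0 r0 Mr0; lra.
rewrite (le_trans h2)//.
have -> : M * (2 * (1 + r)) * (4 * (1 + 2 * M) * (1 + r)) =
   8 * M * (1 + 2 * M) * (1 + r) ^+ 2 by ring.
have -> : 16 * M * (1 + 2 * M) * (1 + r ^+ 2) = 8 * M * (1 + 2 * M) * (2 * (1 + r ^+ 2)) by ring.
rewrite ler_wpM2l ?mulr_ge0 ?addr_ge0 ?mulr_ge0//.
by clear -h1; nra.
Qed.

End increments.

Lemma Rintegral_dist_le d (T : measurableType d) (R : realType)
    (mu : {measure set T -> \bar R}) (D : set T) (f g b : T -> R) : measurable D ->
  mu.-integrable D (EFin \o f) -> mu.-integrable D (EFin \o g) ->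
  mu.-integrable D (EFin \o b) -> (forall x, D x -> `|f x - g x| <= b x) ->
  `|\int[mu]_(x in D) f x - \int[mu]_(x in D) g x| <= \int[mu]_(x in D) b x.
Proof.
move=> mD fi gi bi fg; have di := integrable_sub mD fi gi.
rewrite -RintegralB// (le_trans (le_normr_Rintegral _ _))//.
apply: le_Rintegral => //; exact: integrable_norm di.
Qed.

Section expected_increments.
Context (R : realType) (S : pmetricType R).
Variables (psi g : S -> R) (c M : R).
Hypotheses (psi_meas : measurable_fun setT (psi : borel S -> R))
  (g_meas : measurable_fun setT (g : borel S -> R)).
Hypotheses (psiM : forall u, `|psi u| <= M) (gM : forall u, `|g u| <= M).
Variables (mu : {measure set (strip R S) -> \bar R}) (x : R) (u : S).
Local Notation H := (@half_strip R S).
Local Notation Ex f := (Rintegral mu H f).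
Hypotheses (mu1 : mu H = 1%E) (x0 : 0 <= x).
Hypothesis dev2 : mu.-integrable H (EFin \o (fun y => (y.1 - x) ^+ 2)).

Let mH := @measurable_half_strip R S.
Let mul : (mu H < +oo)%E. Proof. by rewrite mu1 ltry. Qed.
Let M0 : 0 <= M. Proof. exact: le_trans (psiM point). Qed.

Let dev_measurable : measurable_fun H (fun y => y.1 - x).
Proof.
apply: measurable_funB; last exact: measurable_cst.
by apply: measurable_funTS; exact: measurable_first.
Qed.

Lemma phase_integrable (f : S -> R) N : measurable_fun setT (f : borel S -> R) ->
  (forall v, `|f v| <= N) -> mu.-integrable H (EFin \o (fun y => f y.2)).
Proof.
move=> mf fN; apply: (integrable_bdd mH mul (M := N)) => //.
exact: measurable_funTS (measurable_phase mf).
Qed.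

Lemma dev_integrable : mu.-integrable H (EFin \o (fun y => y.1 - x)).
Proof.
apply: (@integrable_dom _ _ _ _ _ mH _ (fun y => 1 + (y.1 - x) ^+ 2)) => //.
  by move=> y _; exact: norm_le_sqr.
by apply: integrable_add => //; exact: integrable_cst_fin.
Qed.

Lemma dev_phase_integrable (f : S -> R) N : measurable_fun setT (f : borel S -> R) ->
  (forall v, `|f v| <= N) -> mu.-integrable H (EFin \o (fun y => (y.1 - x) * f y.2)).
Proof.
move=> mf fN.
apply: (@integrable_dom _ _ _ _ _ mH _ (fun y => N * `|y.1 - x|)).
- apply: measurable_funM => //; exact: measurable_funTS (measurable_phase mf).
- by move=> y _; rewrite normrM mulrC ler_wpM2r.
- by apply: integrable_scale => //; exact: integrable_norm dev_integrable.
Qed.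

Local Notation Z := (lyapunov psi g c).
Local Notation z := ((x, u) : strip R S).

Let incrementE y : H y -> Z y - Z z =
  y.1 - x + (psi y.2 - psi u) + (g y.2 * (1 + y.1)^-1 - g u * (1 + x)^-1).
Proof.
by case: y => X v [X0 _]; rewrite /lyapunov /= !ger0_norm//; ring.
Qed.

Let increment_measurable : measurable_fun H (fun y => Z y - Z z).
Proof.
apply: measurable_funB; last exact: measurable_cst.
exact: measurable_funTS (measurable_lyapunov _ _ _).
Qed.

Let psi_dist v : `|psi v - psi u| <= 2 * M.
Proof. by rewrite (le_trans (ler_normB _ _))// mulr_natl mulr2n lerD. Qed.

Lemma increment_le y : H y -> `|Z y - Z z| <= `|y.1 - x| + 4 * M.
Proof.
move=> Hy; rewrite incrementE//; have [y0 _] := Hy.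
have h a X : 0 <= X -> `|a| <= M -> `|a * (1 + X)^-1| <= M.
  move=> X0 aM; have X1 : 0 < 1 + X by rewrite ltr_pwDl.
  rewrite normrM (gtr0_norm (_ : 0 < (1 + X)^-1)) ?invr_gt0// ler_pdivrMr//.
  by rewrite (le_trans aM)// ler_peMr// lerDl.
have h1 := h _ _ y0 (gM y.2); have h2 := h _ _ x0 (gM u).
rewrite (le_trans (ler_normD _ _))// (le_trans (lerD (ler_normD _ _) (ler_normB _ _)))//.
have h3 := psi_dist y.2; rewrite -addrA lerD2l.
have -> : 4 * M = 2 * M + (M + M) by ring.
by rewrite lerD// lerD.
Qed.

Lemma increment_integrable : mu.-integrable H (EFin \o (fun y => Z y - Z z)).
Proof.
apply: (@integrable_dom _ _ _ _ _ mH _ (fun y => `|y.1 - x| + 4 * M)) => //.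
- exact: increment_le.
- apply: integrable_add => //; last exact: integrable_cst_fin.
  exact: integrable_norm dev_integrable.
Qed.

Lemma increment2_integrable : mu.-integrable H (EFin \o (fun y => (Z y - Z z) ^+ 2)).
Proof.
apply: (@integrable_dom _ _ _ _ _ mH _ (fun y => 2 * (y.1 - x) ^+ 2 + 2 * (4 * M) ^+ 2)).
- exact: measurable_funX.
- move=> y Hy; rewrite normrX -[(y.1 - x) ^+ 2]real_normK ?num_real//.
  rewrite (@le_trans _ _ ((`|y.1 - x| + 4 * M) ^+ 2))//.
    by rewrite lerXn2r ?nnegrE ?addr_ge0 ?mulr_ge0// increment_le.
  by have := sqr_ge0 (`|y.1 - x| - 4 * M); lra.
- apply: integrable_add => //; last exact: integrable_cst_fin.
  exact: integrable_scale.
Qed.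

(** The error must be of the order x^-2, because the mean increment is going to be multiplied by Z;
    for the square of the increment the order x^-1 is enough. *)
Lemma expected_increment :
  `|Ex (fun y => Z y - Z z) - (Ex (fun y => y.1 - x) + Ex (fun y => psi y.2) - psi u
     + (Ex (fun y => g y.2) - g u) * (1 + x)^-1)| <=
  M * (1 + 2 * Ex (fun y => (y.1 - x) ^+ 2)) / (1 + x) ^+ 2.
Proof.
have ipsi := phase_integrable psi_meas psiM; have ig := phase_integrable g_meas gM.
have ic k := integrable_cst_fin mH mul k.
have i1 := integrable_add mH (integrable_add mH dev_integrable ipsi) (ic (- psi u)).
have i2 := integrable_scale mH (1 + x)^-1 (integrable_add mH ig (ic (- g u))).
have i3 := integrable_scale mH (M / (1 + x) ^+ 2) (integrable_add mH (ic 1) (integrable_scale mH 2 dev2)).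
have -> : Ex (fun y => y.1 - x) + Ex (fun y => psi y.2) - psi u
     + (Ex (fun y => g y.2) - g u) * (1 + x)^-1 =
    Ex (fun y => y.1 - x + psi y.2 + (- psi u) + (1 + x)^-1 * (g y.2 + (- g u))).
  rewrite (RintegralD mH i1 i2) (RintegralD mH (integrable_add mH dev_integrable ipsi) (ic _)).
  rewrite (RintegralD mH dev_integrable ipsi) (RintegralZl _ mH (integrable_add mH ig (ic _))).
  by rewrite (RintegralD mH ig (ic _)) !Rintegral_cst1// [_ * (1 + x)^-1]mulrC.
have -> : M * (1 + 2 * Ex (fun y => (y.1 - x) ^+ 2)) / (1 + x) ^+ 2 =
    Ex (fun y => M / (1 + x) ^+ 2 * (1 + 2 * (y.1 - x) ^+ 2)).
  rewrite (RintegralZl _ mH (integrable_add mH (ic 1) (integrable_scale mH 2 dev2))).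
  rewrite (RintegralD mH (ic 1) (integrable_scale mH 2 dev2)) (RintegralZl _ mH dev2).
  by rewrite Rintegral_cst1// mulrAC.
apply: (Rintegral_dist_le mH increment_integrable (integrable_add mH i1 i2) i3).
move=> y Hy; rewrite incrementE//; have [y0 _] := Hy.
have := weight_increment (g u) x0 y0 (gM y.2).
rewrite [M / _ * _]mulrAC; apply: le_trans.
by apply: eq_ler; congr `|_|; ring.
Qed.

Lemma expected_square :
  `|Ex (fun y => (Z y - Z z) ^+ 2) - (Ex (fun y => (y.1 - x) ^+ 2)
     + 2 * Ex (fun y => (y.1 - x) * psi y.2) - 2 * psi u * Ex (fun y => y.1 - x)
     + Ex (fun y => psi y.2 ^+ 2) - 2 * psi u * Ex (fun y => psi y.2) + psi u ^+ 2)| <=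
  16 * M * (1 + 2 * M) * (1 + Ex (fun y => (y.1 - x) ^+ 2)) / (1 + x).
Proof.
have ipsi := phase_integrable psi_meas psiM.
have ipsi2 : mu.-integrable H (EFin \o (fun y => psi y.2 ^+ 2)).
  apply: (@phase_integrable (fun v => psi v ^+ 2) (M ^+ 2)); first exact: measurable_funX.
  by move=> v; rewrite normrX lerXn2r ?nnegrE.
have idp := dev_phase_integrable psi_meas psiM.
have ic k := integrable_cst_fin mH mul k.
have s k f (i : mu.-integrable H (EFin \o f)) := integrable_scale mH k i.
have a5 := integrable_add mH (s (- (2 * psi u)) _ ipsi) (ic (psi u ^+ 2)).
have a4 := integrable_add mH ipsi2 a5.
have a3 := integrable_add mH (s (- (2 * psi u)) _ dev_integrable) a4.
have a2 := integrable_add mH (s 2 _ idp) a3.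
have a1 := integrable_add mH dev2 a2.
have i3 := s (16 * M * (1 + 2 * M) / (1 + x)) _ (integrable_add mH (ic 1) dev2).
have -> : Ex (fun y => (y.1 - x) ^+ 2)
     + 2 * Ex (fun y => (y.1 - x) * psi y.2) - 2 * psi u * Ex (fun y => y.1 - x)
     + Ex (fun y => psi y.2 ^+ 2) - 2 * psi u * Ex (fun y => psi y.2) + psi u ^+ 2 =
   Ex (fun y => (y.1 - x) ^+ 2 + (2 * ((y.1 - x) * psi y.2) + (- (2 * psi u) * (y.1 - x)
      + (psi y.2 ^+ 2 + (- (2 * psi u) * psi y.2 + psi u ^+ 2))))).
  rewrite (RintegralD mH dev2 a2) (RintegralD mH (s _ _ idp) a3).
  rewrite (RintegralD mH (s _ _ dev_integrable) a4) (RintegralD mH ipsi2 a5).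
  rewrite (RintegralD mH (s _ _ ipsi) (ic _)) Rintegral_cst1//.
  rewrite (RintegralZl _ mH idp) (RintegralZl _ mH dev_integrable) (RintegralZl _ mH ipsi).
  by ring.
rewrite [leRHS](_ : _ =
    Ex (fun y => 16 * M * (1 + 2 * M) / (1 + x) * (1 + (y.1 - x) ^+ 2))); last first.
  rewrite (RintegralZl _ mH (integrable_add mH (ic 1) dev2)).
  by rewrite (RintegralD mH (ic 1) dev2) Rintegral_cst1// mulrAC.
apply: (Rintegral_dist_le mH increment2_integrable a1 i3).
move=> y Hy; rewrite incrementE//; have [y0 _] := Hy.
have := square_increment x0 y0 (gM y.2) (gM u) (psi_dist y.2).
rewrite [X in _ -> _ <= X]mulrAC; apply: le_trans.
by apply: eq_ler; congr `|_|; ring.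
Qed.

Lemma increment_powR_integrable p : 0 <= p ->
  mu.-integrable H (EFin \o (fun y => `|y.1 - x| `^ p)) ->
  mu.-integrable H (EFin \o (fun y => `|Z y - Z z| `^ p)) /\
  \int[mu]_(y in H) `|Z y - Z z| `^ p <=
    2 `^ p * (\int[mu]_(y in H) `|y.1 - x| `^ p + (4 * M) `^ p).
Proof.
move=> p0 ip; have ic k := integrable_cst_fin mH mul k.
have i2 := integrable_scale mH (2 `^ p) (integrable_add mH ip (ic ((4 * M) `^ p))).
have pw y : H y -> `|Z y - Z z| `^ p <= 2 `^ p * (`|y.1 - x| `^ p + (4 * M) `^ p).
  move=> Hy; have M40 : 0 <= 4 * M by rewrite mulr_ge0.
  apply: (@le_trans _ _ ((2 * Num.max `|y.1 - x| (4 * M)) `^ p)).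
    apply: ge0_ler_powR; rewrite ?nnegrE ?mulr_ge0 ?le_max ?normr_ge0//.
    rewrite (le_trans (increment_le Hy))// [leRHS]mulr_natl mulr2n.
    by rewrite lerD// le_max lexx ?orbT.
  have m0 : 0 <= Num.max `|y.1 - x| (4 * M) by rewrite le_max normr_ge0.
  rewrite (powRM _ (ler0n _ 2) m0); apply: ler_wpM2l; first exact: powR_ge0.
  by have [_|_] := leP `|y.1 - x| (4 * M); [rewrite lerDr powR_ge0|rewrite lerDl powR_ge0].
have i1 : mu.-integrable H (EFin \o (fun y => `|Z y - Z z| `^ p)).
  apply: (integrable_dom mH _ _ i2).
    apply: (measurableT_comp (measurable_powR p)).
    exact: measurableT_comp.
  by move=> y Hy; rewrite ger0_norm ?powR_ge0//; exact: pw.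
split => //; apply: le_trans (le_Rintegral mH i1 i2 pw) _.
rewrite (RintegralZl _ mH (integrable_add mH ip (ic _))) (RintegralD mH ip (ic _)).
by rewrite Rintegral_cst1.
Qed.

End expected_increments.

(** * Asymptotics of the half-strip kernel *)

(** On the nonnegative half-line the negative part of [y - x] is at most [x], so a finite deviation
    forces the positive part to be integrable too; the conditional mean then exists as a real
    number. *)
Lemma mean_of_deviation (R : realType) (nu : {measure set (measurableTypeR R) -> \bar R})
    (x l eta : R) : nu (@Rplus R) = 1%E -> 0 <= x ->
  (`|\int[nu]_(y in @Rplus R) (y - x)%:E - l%:E| <= eta%:E)%E ->
  exists2 r, (\int[nu]_(y in @Rplus R) y%:E = r%:E)%E & `|r - (x + l)| <= eta.
Proof.
move=> nu1 x0 dev; have mR := @measurable_Rplus R.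
have mid : measurable_fun (@Rplus R) (fun y : measurableTypeR R => y%:E).
  exact/measurable_EFinP.
have mdev : measurable_fun (@Rplus R) (fun y : measurableTypeR R => (y - x)%:E).
  by apply/measurable_EFinP; apply: measurable_funB.
have nul : (nu (@Rplus R) < +oo)%E by rewrite nu1 ltry.
have ic := integrable_cst_fin mR nul x.
have iid : nu.-integrable (@Rplus R) (EFin \o (fun y => y)).
  apply/integrableP; split => //.
  set f := fun y : measurableTypeR R => (y - x)%:E.
  have fpl : (\int[nu]_(y in @Rplus R) f^\+ y < +oo)%E.
    move: dev; rewrite integralE -/f.
    have : (\int[nu]_(y in @Rplus R) f^\- y <= x%:E)%E.
      apply: (@le_trans _ _ (\int[nu]_(y in @Rplus R) x%:E)%E); last first.
        by rewrite integral_cst// nu1 mule1.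
      apply: ge0_le_integral => //.
      - exact: measurable_funeneg.
      - by move=> y y0; rewrite funenegE ge_max -EFinN !lee_fin x0 andbT opprB lerBlDr lerDl.
    case: (\int[nu]_(y in @Rplus R) f^\+ y)%E => [r _ _| |//]; first by rewrite ltry.
    by case: (\int[nu]_(y in @Rplus R) f^\- y)%E.
  apply: (@le_lt_trans _ _ (\int[nu]_(y in @Rplus R) (f^\+ y + x%:E))%E).
    apply: ge0_le_integral => //.
    - exact: measurableT_comp.
    - by apply: emeasurable_funD => //; exact: measurable_funepos.
    - move=> y y0; rewrite /= ger0_norm//.
      by rewrite -leeBlDr// -EFinB funeposE le_max lexx.
  rewrite ge0_integralD//; last exact: measurable_funepos.
  by rewrite integral_cst// nu1 mule1 lte_add_pinfty// ltry.
have rE : (\int[nu]_(y in @Rplus R) y%:E = (\int[nu]_(y in @Rplus R) y)%R%:E)%E.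
  by rewrite /Rintegral fineK//; exact: integrable_fin_num iid.
exists (\int[nu]_(y in @Rplus R) y) => //.
have dE : (\int[nu]_(y in @Rplus R) (y - x)%:E = (\int[nu]_(y in @Rplus R) y - x)%R%:E)%E.
  rewrite -[X in (_ - X)%:E](Rintegral_cst1 mR nu1 x) -RintegralB//.
  rewrite /Rintegral fineK//; apply: integrable_fin_num => //.
  exact: integrable_sub.
by move: dev; rewrite dE -EFinB lee_fin opprD addrA.
Qed.

Section disintegration.
Context (R : realType) (S : pmetricType R) (Ks : R.-pker strip R S ~> strip R S).
Variable L : R.-pker (strip R S * borel S) ~> measurableTypeR R.
Hypothesis Ks_half_strip : half_strip_kernel Ks.
Hypothesis L_conditional : conditional_law Ks L.
Local Notation H := (@half_strip R S).
Local Notation Rp := (@Rplus R).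
Variable z : strip R S.
Hypothesis Hz : H z.

Let mz : measurable_fun setT (fun v : borel S => (z, v)).
Proof. exact: measurable_pair1. Qed.

Let conditional_kernel := kernel_map L mz.

Let swap_pair (x : borel S * measurableTypeR R) : strip R S := (x.2, x.1).

Let swap_pair_measurable : measurable_fun setT swap_pair.
Proof. by apply/measurable_fun_pairP; split; [exact: measurable_snd|exact: measurable_fst]. Qed.

Lemma measurable_conditional_integral (phi : strip R S -> \bar R) :
  (forall y, (0 <= phi y)%E) -> measurable_fun setT phi ->
  measurable_fun setT (fun v : borel S => \int[L (z, v)]_y phi (y, v))%E.
Proof.
move=> phi0 mphi.
apply: (measurable_fun_integral_finite_kernel (fun x => phi (swap_pair x)) conditional_kernel) => //.
exact: measurableT_comp.
Qed.

Let patch_section (f : strip R S -> \bar R) y v :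
  (f \_ H) (y, v) = ((fun y => f (y, v)) \_ Rp) y.
Proof.
rewrite !patchE; congr (if _ then _ else _).
by apply/idP/idP; rewrite !inE; [case|split].
Qed.

(** [mixture_integral] for the law of the next phase followed by the conditional law of the
    abscissa. The sign of [f] is known on the half-strip only, so [f] is replaced by 0 elsewhere. *)
Lemma disintegration (f : strip R S -> \bar R) : (forall y, H y -> (0 <= f y)%E) ->
  measurable_fun setT f ->
  measurable_fun setT (fun v : borel S => \int[L (z, v)]_(y in Rp) f (y, v))%E /\
  (\int[Ks z]_(y in H) f y =
   \int[modulation_law Ks z]_v \int[L (z, v)]_(y in Rp) f (y, v))%E.
Proof.
move=> f0 mf; set phi := f \_ H.
have phi0 y : (0 <= phi y)%E by rewrite /phi patchE; case: ifPn => // /set_mem; exact: f0.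
have mphi : measurable_fun setT phi.
  by apply/(measurable_restrictT _ (@measurable_half_strip R S)); exact: measurable_funTS.
have inner v : (\int[L (z, v)]_(y in Rp) f (y, v) = \int[L (z, v)]_y phi (y, v))%E.
  by rewrite integral_mkcond; apply: eq_integral => y _; rewrite /phi patch_section.
split; first by under eq_fun do rewrite inner; exact: measurable_conditional_integral.
rewrite integral_mkcond -/phi; under [RHS]eq_integral do rewrite inner.
apply: (@mixture_integral _ _ _ _ _ _ _ (modulation_law Ks z) conditional_kernel swap_pair).
- exact: swap_pair_measurable.
- exact: measurable_conditional_integral.
- move=> A mA; rewrite ((L_conditional Hz).2 A mA); apply: eq_integral => v _.
  rewrite -[RHS]/(\int[L (z, v)]_y (\1_A (y, v))%:E)%E.
  have mAv : measurable [set y : measurableTypeR R | A (y, v)].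
    by rewrite -[X in measurable X]setTI; exact: (measurable_pair2 v measurableT mA).
  transitivity (\int[L (z, v)]_y (\1_[set y | A (y, v)] y)%:E)%E.
    by rewrite integral_indic// setIT.
  by apply: eq_integral => y _; rewrite !indicE; congr (_%:R%:E); apply/idP/idP; rewrite !inE.
- exact: phi0.
- exact: mphi.
Qed.

Lemma modulation_mass : modulation_law Ks z setT = 1%E.
Proof. exact: Ks_half_strip. Qed.

Let mH := @measurable_half_strip R S.
Let mass1 := Ks_half_strip Hz.

Lemma phase_expectation (f : S -> R) : bounded_measurable (f : borel S -> R) ->
  \int[Ks z]_(y in H) f y.2 = \int[modulation_law Ks z]_v f v.
Proof.
move=> bf; have [mf [M fM]] := bf; pose f' v := f v + M.
have f'0 v : 0 <= f' v by have := fM v; rewrite /f' ler_norml; lra.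
have bf' : bounded_measurable (f' : borel S -> R) by apply: bm_add => //; exact: bm_cst.
have ml : (modulation_law Ks z setT < +oo)%E by rewrite modulation_mass ltry.
have hl : (Ks z H < +oo)%E by rewrite mass1 ltry.
have -> : f = (fun v => f' v - M) by apply/funext => v; rewrite /f' addrK.
have [mf' [M' fM']] := bf'.
have i1 : (Ks z).-integrable H (EFin \o (fun y => f' y.2)) by exact: phase_integrable fM'.
have i2 := integrable_bm ml bf'.
rewrite (RintegralB mH i1 (integrable_cst_fin mH hl M)).
rewrite (RintegralB measurableT i2 (integrable_cst_fin measurableT ml M)).
rewrite (Rintegral_cst1 mH mass1) (Rintegral_cst1 measurableT modulation_mass).
congr (_ - _); congr fine.
have [y _||_ ->] := disintegration (f := fun y => (f' y.2)%:E).
- by rewrite lee_fin.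
- by apply/measurable_EFinP; exact: measurable_phase.
apply: eq_integral => v _.
rewrite /= integral_cst; last exact: measurable_Rplus.
by rewrite [X in (_ * X)%E](_ : _ = 1%E) ?mule1//; exact: (L_conditional Hz).1.
Qed.

(** A nonnegative weight makes the integrand nonnegative on the half-strip, as the disintegration
    demands. Signed weights are obtained afterwards by subtracting a constant weight. *)
Lemma conditional_mean (W l : S -> R) (N eta : R) :
  measurable_fun setT (W : borel S -> R) -> (forall v, 0 <= W v <= N) ->
  bounded_measurable (l : borel S -> R) ->
  (forall v, (`|conditional_drift L z.1 z.2 v - (l v)%:E| <= eta%:E)%E) ->
  `|\int[Ks z]_(y in H) (y.1 * W y.2) -
    \int[modulation_law Ks z]_v ((z.1 + l v) * W v)| <= eta * N.
Proof.
move=> mW WN [ml' [B lB]] drift; have [z0 _] := Hz.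
pose m v := fine (\int[L (z, v)]_(y in Rp) y%:E)%E.
have mE v : (\int[L (z, v)]_(y in Rp) y%:E = (m v)%:E)%E /\ `|m v - (z.1 + l v)| <= eta.
  have := drift v; rewrite /conditional_drift -surjective_pairing => dr.
  by have [r rE re] := mean_of_deviation ((L_conditional Hz).1 v) z0 dr; rewrite /m rE.
have bW : bounded_measurable (W : borel S -> R).
  by split => //; exists N => v; have /andP[W0 WvN] := WN v; rewrite ger0_norm.
have N0 : 0 <= N by have /andP[W0] := WN point; exact: le_trans.
have [y Hy||mint intE] := disintegration (f := fun y => (y.1 * W y.2)%:E).
- by have [y0 _] := Hy; have /andP[W0 _] := WN y.2; rewrite lee_fin mulr_ge0.
- apply/measurable_EFinP; apply: measurable_funM; first exact: measurable_first.
  exact: measurable_phase.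
have inner v : (\int[L (z, v)]_(y in Rp) (y * W v)%:E = (m v * W v)%:E)%E.
  under eq_integral do rewrite EFinM.
  rewrite ge0_integralZr//; [by rewrite (mE v).1|exact: measurable_Rplus|].
  by rewrite lee_fin; have /andP[] := WN v.
have ml : (modulation_law Ks z setT < +oo)%E by rewrite modulation_mass ltry.
have bm1 : bounded_measurable (fun v : borel S => m v * W v).
  split.
    by apply/measurable_EFinP; move: mint; congr measurable_fun; apply/funext => v; exact: inner.
  exists ((eta + (`|z.1| + B)) * N) => v; rewrite normrM.
  have /andP[W0 WvN] := WN v; rewrite [`|W v|]ger0_norm// ler_pM//.
  rewrite -[m v](subrK (z.1 + l v)) (le_trans (ler_normD _ _))// lerD ?(mE v).2//.
  by rewrite (le_trans (ler_normD _ _))// lerD.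
have bm2 : bounded_measurable (fun v : borel S => (z.1 + l v) * W v).
  apply: bm_mul => //; apply: bm_add; first exact: bm_cst.
  by split => //; exists B.
have -> : \int[Ks z]_(y in H) (y.1 * W y.2) = \int[modulation_law Ks z]_v (m v * W v).
  by congr fine; rewrite intE; apply: eq_integral => v _; exact: inner.
have dist v : setT v -> `|m v * W v - (z.1 + l v) * W v| <= eta * N.
  have /andP[W0 WvN] := WN v => _.
  by rewrite -mulrBl normrM [`|W v|]ger0_norm// ler_pM//; exact: (mE v).2.
have := le_Rintegral_dist measurableT ml (integrable_bm ml bm1) (integrable_bm ml bm2) dist.
move/le_trans; apply; rewrite [X in _ * X](_ : _ = 1) ?mulr1//.
by rewrite -[RHS]/(fine 1%E); congr fine; exact: modulation_mass.
Qed.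

End disintegration.

Lemma near_pinfty_ge (R : realType) (Q : R -> Prop) : (\forall x \near +oo, Q x) ->
  exists2 x1, 1 <= x1 & forall x, x1 <= x -> Q x.
Proof.
move=> [N [_ h]]; exists (Num.max 1 (N + 1)) => [|x]; first by rewrite le_max lexx.
by rewrite ge_max => /andP[_ Nx]; apply: h; rewrite (lt_le_trans _ Nx)// ltrDl.
Qed.

Lemma abse_sub_le_fine (R : realType) (a : \bar R) (r c : R) :
  (`|a - r%:E| <= c%:E)%E -> `|fine a - r| <= c.
Proof. by case: a => [a| |] //; rewrite -EFinB lee_fin. Qed.

Lemma ereal_sup_cvg0 (R : realType) (T : Type) (a : R -> T -> \bar R) (eps : R) :
  ereal_sup [set a x u | u in setT] @[x --> +oo] --> 0%E -> 0 < eps ->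
  exists2 x1, 1 <= x1 & forall x u, x1 <= x -> (a x u <= eps%:E)%E.
Proof.
move=> a0 e0; have [x1 x11 h] := near_pinfty_ge (cvge0_near_lt _ a0 e0).
exists x1 => // x u /h /ltW; apply: le_trans.
by apply: ereal_sup_ubound; exists u.
Qed.

Lemma ereal_sup_rate0 (R : realType) (T : Type) (a : R -> T -> \bar R) (eps : R) :
  (x%:E * ereal_sup [set a x u | u in setT])%E @[x --> +oo] --> 0%E -> 0 < eps ->
  exists2 x1, 1 <= x1 & forall x u, x1 <= x -> (a x u <= (eps / x)%:E)%E.
Proof.
move=> a0 e0; have [x1 x11 h] := near_pinfty_ge (cvge0_near_lt _ a0 e0).
exists x1 => // x u x1x; have x0 : 0 < x by rewrite (lt_le_trans ltr01)// (le_trans x11).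
apply: (@le_trans _ _ (ereal_sup [set a x u | u in setT])).
  by apply: ereal_sup_ubound; exists u.
by rewrite mulrC EFinM lee_pdivlMl//; exact/ltW/h.
Qed.

(** Subtracts [M] times the estimate for the weight 1 from the estimate for the weight psi + M: the
    terms of size x cancel. Here [A] is the mean of dX psi, [B] that of psi, [D] that of dX, and
    [G], [I] are the means of lambda psi and of lambda. *)
Lemma covariance_arith (R : realType) (A B D G I x M eta : R) : 0 <= M ->
  `|A + (x * B + (M * D + M * x)) - (x * B + (M * x + (G + M * I)))| <= eta * (2 * M) ->
  `|D + x - (x + I)| <= eta -> `|A - G| <= eta * (3 * M).
Proof.
move=> M0 h1 h2.
have -> : A - G = (A + (x * B + (M * D + M * x)) - (x * B + (M * x + (G + M * I))))
    - M * (D + x - (x + I)) by ring.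
rewrite (le_trans (ler_normB _ _))// normrM (ger0_norm M0).
rewrite (le_trans (lerD h1 (ler_wpM2l M0 h2)))//.
by apply: eq_ler; ring.
Qed.

Section kernel_asymptotics.
Context (R : realType) (S : pmetricType R) (Ks : R.-pker strip R S ~> strip R S).
Variable L : R.-pker (strip R S * borel S) ~> measurableTypeR R.
Variables (K : R.-pker borel S ~> borel S) (Gamma : S -> {charge set (borel S) -> \bar R}).
Variables (p b : R) (d e sigma2 : S -> R) (lambda : S -> S -> R) (psi : S -> R).
Hypotheses (compact_S : compact [set: S]) (Ks_half_strip : half_strip_kernel Ks)
  (L_conditional : conditional_law Ks L) (K_continuous : tv_continuous (kernel_at K))
  (Gamma_continuous : tv_continuous Gamma) (p_gt2 : 2 < p).
Hypothesis asymptotic_markov :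
  (x%:E * ereal_sup [set tv_norm
     (charge_sub (charge_sub (modulation_law Ks (x, u)) (kernel_at K u))
                 (cscale x^-1 (Gamma u))) | u in [set: S]])%E @[x --> +oo] --> 0%E.
Hypotheses (e_continuous : continuous e) (sigma2_continuous : continuous sigma2).
Hypothesis first_moment : (x%:E * ereal_sup
     [set `|drift_moment Ks 1 x u - (d u + e u / x)%:E| | u in [set: S]])%E
    @[x --> +oo] --> 0%E.
Hypothesis second_moment :
  ereal_sup [set `|drift_moment Ks 2 x u - (sigma2 u)%:E|%E | u in [set: S]]
    @[x --> +oo] --> 0%E.
Hypotheses
  (lambda_measurable : forall u, measurable_fun setT (lambda u : borel S -> R))
  (lambda_bounded : forall u, exists M, forall v, `|lambda u v| <= M)
  (lambda_continuous : forall u,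
    ereal_sup [set (`|lambda u' v - lambda u v|)%:E | v in [set: S]]
      @[u' --> u] --> 0%E)
  (drift_limit :
    ereal_sup [set `|conditional_drift L x uv.1 uv.2
                     - (lambda uv.1 uv.2)%:E|%E | uv in [set: S * S]]
      @[x --> +oo] --> 0%E)
  (psi_continuous : continuous psi)
  (psi_poisson : forall u, \int[K u]_v (psi u - psi v) = d u).
Local Notation H := (@half_strip R S).

Definition good_states : set (strip R S) :=
  [set z | half_strip z /\ (kernel_moment Ks p z <= b%:E)%E].

Local Notation neg := (negligible_at_infinity good_states).
Local Notation bnd := (bounded_at_infinity good_states).
Local Notation Ex z f := (Rintegral (Ks z) H f).

Let mH := @measurable_half_strip R S.

Lemma good_moment z : good_states z ->
  (Ks z).-integrable H (EFin \o (fun y => `|y.1 - z.1| `^ p)) /\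
  \int[Ks z]_(y in H) `|y.1 - z.1| `^ p <= b.
Proof.
move=> [Hz zb].
have mdev : measurable_fun setT (fun y : strip R S => `|y.1 - z.1| `^ p).
  apply: (measurableT_comp (measurable_powR p)); apply: measurableT_comp => //.
  by apply: measurable_funB; [exact: measurable_first|exact: measurable_cst].
have le : (\int[Ks z]_(y in H) (`|y.1 - z.1| `^ p)%:E <= b%:E)%E.
  apply: le_trans zb; apply: ge0_subset_integral => //.
  exact/measurable_EFinP.
have i : (Ks z).-integrable H (EFin \o (fun y => `|y.1 - z.1| `^ p)).
  apply/integrableP; split; first exact/measurable_EFinP/measurable_funTS.
  under eq_integral do rewrite /= ger0_norm ?powR_ge0//.
  exact: le_lt_trans le (ltry b).
split => //; rewrite -lee_fin /Rintegral fineK//.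
exact: integrable_fin_num i.
Qed.

Let dev_measurable z : measurable_fun H (fun y : strip R S => y.1 - z).
Proof.
apply: measurable_funTS.
by apply: measurable_funB; [exact: measurable_first|exact: measurable_cst].
Qed.

Lemma good_dev2 z : good_states z ->
  (Ks z).-integrable H (EFin \o (fun y => (y.1 - z.1) ^+ 2)).
Proof.
move=> gz; have [i _] := good_moment gz; have Hz := gz.1.
apply: (integrable_dev2 mH (Ks_half_strip Hz) p_gt2 _ i).
by apply: measurable_funTS; exact: measurable_first.
Qed.

Let gt0_of (z : strip R S) (x1 : R) : 1 <= x1 -> x1 <= z.1 -> 0 < z.1.
Proof. by move=> x11 xz; rewrite (lt_le_trans ltr01)// (le_trans x11). Qed.

Lemma drift_asymptotics :
  neg (fun z => z.1 * Ex z (fun y => y.1 - z.1) - z.1 * d z.2 - e z.2).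
Proof.
move=> eps e0; have [x1 x11 h] := ereal_sup_rate0 first_moment e0.
exists x1 => // -[x u] _ /= x1x; have x0 : 0 < x := @gt0_of (x, u) _ x11 x1x.
have := abse_sub_le_fine (h x u x1x).
rewrite -[fine _]/(Ex (x, u) (fun y => y.1 - x)) => hh.
rewrite [X in `|X|](_ : _ = x * (Ex (x, u) (fun y => y.1 - x) - (d u + e u / x))).
  rewrite normrM (gtr0_norm x0) (le_trans (ler_wpM2l (ltW x0) hh))//.
  by rewrite mulrCA divff ?mulr1// gt_eqF.
by field; rewrite gt_eqF.
Qed.

Lemma variance_asymptotics : neg (fun z => Ex z (fun y => (y.1 - z.1) ^+ 2) - sigma2 z.2).
Proof.
move=> eps e0; have [x1 x11 h] := ereal_sup_cvg0 second_moment e0.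
by exists x1 => // -[x u] _ /= x1x; exact: abse_sub_le_fine (h x u x1x).
Qed.

(** The test function may depend on the current phase, as lambda psi does; this is harmless because
    the total variation bound is uniform over test functions. *)
Lemma phase_asymptotics (f : S -> S -> R) M :
  (forall u, measurable_fun setT (f u : borel S -> R)) -> (forall u v, `|f u v| <= M) ->
  neg (fun z => z.1 * (Ex z (fun y => f z.2 y.2) - kernel_op K (f z.2) z.2)
                - charge_integral (Gamma z.2) (f z.2)).
Proof.
move=> mf fM eps e0; have M1 : 0 < M + 1 by rewrite ltr_wpDl// (le_trans _ (fM point point)).
have [x1 x11 h] := ereal_sup_rate0 asymptotic_markov (divr_gt0 e0 M1).
exists x1 => // -[x u] [Hz _] /= x1x; have x0 : 0 < x := @gt0_of (x, u) _ x11 x1x.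
have bf : bounded_measurable (f u : borel S -> R) by split => //; exists M.
have := tv_norm_charge_integral (h x u x1x) (mf u) (fM u).
rewrite !charge_integral_sub// charge_integral_scale ?invr_ge0 ?(ltW x0)//.
have -> : charge_integral (modulation_law Ks (x, u)) (f u) = Ex (x, u) (fun y => f u y.2).
  rewrite (phase_expectation Ks_half_strip L_conditional Hz bf).
  apply: charge_integral_measure => //.
  apply: le_lt_trans (ltry 1); rewrite le_eqVlt; apply/orP; left; apply/eqP.
  exact: modulation_mass.
have -> : charge_integral (kernel_at K u) (f u) = kernel_op K (f u) u.
  by apply: charge_integral_measure => //; exact: kernel_op_lty.
move=> hh; set E := Ex _ _ in hh *; set k := kernel_op _ _ _ in hh *.
rewrite [X in `|X|](_ : _ = x * (E - k - x^-1 * charge_integral (Gamma u) (f u))).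
  rewrite normrM (gtr0_norm x0) (le_trans (ler_wpM2l (ltW x0) hh))//.
  by rewrite [leLHS](_ : _ = eps)//; field; rewrite !gt_eqF.
by field; rewrite gt_eqF.
Qed.

Lemma phase_limit (f : S -> S -> R) M :
  (forall u, measurable_fun setT (f u : borel S -> R)) -> (forall u v, `|f u v| <= M) ->
  neg (fun z => Ex z (fun y => f z.2 y.2) - kernel_op K (f z.2) z.2).
Proof.
move=> mf fM; have [c c0 Gc] := tv_continuous_bounded Gamma_continuous compact_S.
have bG : bnd (fun z => charge_integral (Gamma z.2) (f z.2)).
  by apply: (bnd_bounded _ (M := (M + 1) * c)) => z; exact: Gc.
have n := phase_asymptotics mf fM.
have := neg_mul (neg_inv good_states) (bnd_add (neg_bnd n) bG).
apply: neg_ext => z _ z1; rewrite subrK mulrA mulVf ?mul1r//.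
by rewrite gt_eqF// (lt_le_trans ltr01).
Qed.

Lemma lambda_uniformly_bounded : exists M, forall u v, `|lambda u v| <= M.
Proof.
apply: (@compact_locally_bounded R S (fun M u => forall v, `|lambda u v| <= M)) => //.
  by move=> a a' u aa' h v; exact: le_trans (h v) aa'.
move=> u; have [M lM] := lambda_bounded u; exists (M + 1).
have near_u := cvge0_near_lt (nbhs_filter u) (@lambda_continuous u) (@ltr01 R).
apply: filterS near_u => u' h v.
have : ((`|lambda u' v - lambda u v|)%:E <= 1%:E)%E.
  by apply: le_trans (ltW h); apply: ereal_sup_ubound; exists v.
rewrite lee_fin => h'; rewrite -[lambda u' v](subrK (lambda u v)) addrC.
by rewrite (le_trans (ler_normD _ _))// lerD.
Qed.

(** Given the next phase v, the mean jump is close to lambda u v, so E[dX psi] is close to the mean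
    of lambda psi under the law of the next phase; that law in turn is close to [K]. *)
Lemma covariance_asymptotics :
  neg (fun z => Ex z (fun y => (y.1 - z.1) * psi y.2)
                - kernel_op K (fun v => lambda z.2 v * psi v) z.2).
Proof.
have [Mp psiM] := compact_continuous_bounded compact_S psi_continuous.
have [Ml lM] := lambda_uniformly_bounded.
have Mp0 : 0 <= Mp by apply: le_trans (psiM point).
have mpsi : measurable_fun setT (psi : borel S -> R) by exact: continuous_measurable_borel.
have bpsi : bounded_measurable (psi : borel S -> R) by split => //; exists Mp.
have n : neg (fun z => Ex z (fun y => lambda z.2 y.2 * psi y.2)
    - kernel_op K (fun v => lambda z.2 v * psi v) z.2).
  apply: (phase_limit (f := fun u v => lambda u v * psi v) (M := Ml * Mp)).
    by move=> u; exact: measurable_funM.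
  by move=> u v; rewrite normrM ler_pM.
suff n' : neg (fun z => Ex z (fun y => (y.1 - z.1) * psi y.2)
    - Ex z (fun y => lambda z.2 y.2 * psi y.2)).
  by apply: neg_ext (neg_add n' n) => z _ _; rewrite addrA subrK.
move=> eps e0; have N0 : 0 < 3 * Mp + 1 by rewrite ltr_wpDl// mulr_ge0.
pose eta := eps / (3 * Mp + 1).
have eta0 : 0 < eta by rewrite divr_gt0.
have [x1 x11 h] := ereal_sup_cvg0 drift_limit eta0.
exists x1 => // -[x u] gz /= x1x; have Hz := gz.1.
have mass := Ks_half_strip Hz; have hl : (Ks (x, u) H < +oo)%E by rewrite mass ltry.
have bl : bounded_measurable (lambda u : borel S -> R) by split => //; exists Ml.
have dr v : (`|conditional_drift L (x, u).1 (x, u).2 v - (lambda u v)%:E| <= eta%:E)%E.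
  exact: (h x (u, v) x1x).
(* The shift makes the weight nonnegative; the weight 1 in [h2] removes its effect. *)
pose W v := psi v + Mp.
have W0 v : 0 <= W v <= 2 * Mp by have := psiM v; rewrite /W ler_norml; lra.
have bW : bounded_measurable (W : borel S -> R) by apply: bm_add => //; exact: bm_cst.
have h1 := conditional_mean Ks_half_strip L_conditional Hz bW.1 W0 bl dr.
have one1 : forall v : S, 0 <= (1 : R) <= 1 by move=> v; rewrite ler01 lexx.
have h2 := conditional_mean Ks_half_strip L_conditional Hz
  (measurable_cst (1 : R)) one1 bl dr.
have ml : (modulation_law Ks (x, u) setT < +oo)%E.
  apply: le_lt_trans (ltry 1); rewrite le_eqVlt; apply/orP; left; apply/eqP.
  exact: modulation_mass.
have m1 : modulation_law Ks (x, u) setT = 1%E by exact: modulation_mass.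
have idev := dev_integrable mass (good_dev2 gz).
have idp := dev_phase_integrable mass (good_dev2 gz) mpsi psiM.
have ip := phase_integrable mass mpsi psiM.
have ic k := integrable_cst_fin mH hl k.
have E1 : Ex (x, u) (fun y => y.1 * W y.2) = Ex (x, u) (fun y => (y.1 - x) * psi y.2)
    + (x * Ex (x, u) (fun y => psi y.2) + (Mp * Ex (x, u) (fun y => y.1 - x) + Mp * x)).
  have a3 := integrable_add mH (integrable_scale mH Mp idev) (ic (Mp * x)).
  have a2 := integrable_add mH (integrable_scale mH x ip) a3.
  have -> : (fun y : strip R S => y.1 * W y.2) = (fun y =>
      (y.1 - x) * psi y.2 + (x * psi y.2 + (Mp * (y.1 - x) + Mp * x))).
    by apply/funext => y; rewrite /W; ring.
  rewrite (RintegralD mH idp a2) (RintegralD mH (integrable_scale mH x ip) a3).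
  rewrite (RintegralD mH (integrable_scale mH Mp idev) (ic _)) (RintegralZl _ mH ip).
  by rewrite (RintegralZl _ mH idev) (Rintegral_cst1 mH mass).
have E2 : Ex (x, u) (fun y => y.1 * 1) = Ex (x, u) (fun y => y.1 - x) + x.
  have -> : (fun y : strip R S => y.1 * 1) = (fun y => (y.1 - x) + x).
    by apply/funext => y; rewrite mulr1 subrK.
  by rewrite (RintegralD mH idev (ic _)) (Rintegral_cst1 mH mass).
have blp : bounded_measurable (fun v : borel S => lambda u v * psi v) by exact: bm_mul.
have F1 : \int[modulation_law Ks (x, u)]_v ((x + lambda u v) * W v) =
    x * \int[modulation_law Ks (x, u)]_v psi v + (Mp * x +
    (\int[modulation_law Ks (x, u)]_v (lambda u v * psi v) +
     Mp * \int[modulation_law Ks (x, u)]_v lambda u v)).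
  have -> : (fun v : borel S => (x + lambda u v) * W v) = (fun v => x * psi v +
      (Mp * lambda u v + (1 * (lambda u v * psi v) + Mp * x))).
    by apply/funext => v; rewrite /W; ring.
  have b1 := bm_lin 1 blp (bm_cst (borel S) (Mp * x)).
  rewrite (Rintegral_lin x ml bpsi (bm_lin Mp bl b1)) (Rintegral_lin Mp ml bl b1).
  rewrite (Rintegral_lin 1 ml blp (bm_cst (borel S) (Mp * x))) (Rintegral_cst1 measurableT m1).
  by ring.
have F2 : \int[modulation_law Ks (x, u)]_v ((x + lambda u v) * 1) =
    x + \int[modulation_law Ks (x, u)]_v lambda u v.
  have -> : (fun v : borel S => (x + lambda u v) * 1) = (fun v => 1 * lambda u v + x).
    by apply/funext => v; ring.
  rewrite (Rintegral_lin 1 ml bl (bm_cst (borel S) x)) (Rintegral_cst1 measurableT m1).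
  by rewrite mul1r addrC.
have P1 := phase_expectation Ks_half_strip L_conditional Hz bpsi.
have P2 := phase_expectation Ks_half_strip L_conditional Hz blp.
move: h1 h2; rewrite /= E1 E2 F1 F2 mulr1 P1 P2 => h1 h2.
rewrite (le_trans (covariance_arith Mp0 h1 h2))//.
by rewrite /eta mulrAC ler_pdivrMr// ler_wpM2l ?(ltW e0)// lerDl.
Qed.

Variable theta : R.
Variable pi0 : probability (borel S) R.
Hypothesis pi0_invariant : unique_invariant K pi0.

Let cov u := kernel_op K (fun v => lambda u v * psi v) u.
Let gam u := charge_integral (Gamma u) psi.
Let potential u := 2 * (e u + gam u) + (2 * theta - 1) * (sigma2 u + 2 * cov u).

Lemma bounded_psi : exists2 M, 0 <= M & forall u, `|psi u| <= M.
Proof.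
have [M psiM] := compact_continuous_bounded compact_S psi_continuous.
by exists M => //; exact: le_trans (psiM point).
Qed.

Lemma measurable_psi : measurable_fun setT (psi : borel S -> R).
Proof. exact: continuous_measurable_borel. Qed.

(** Two perturbations of size [eps / 2]: the integrand moves uniformly with the phase, and the
    kernel moves in total variation with the integrand fixed. *)
Let cov_continuous : continuous cov.
Proof.
have [M M0 psiM] := bounded_psi; have [N lN] := lambda_uniformly_bounded.
have mf u : measurable_fun setT (fun v : borel S => lambda u v * psi v).
  by apply: measurable_funM => //; exact: measurable_psi.
have bf u : bounded_measurable (fun v : borel S => lambda u v * psi v).
  by split => //; exists (N * M) => v; rewrite normrM ler_pM.
move=> u; apply/cvgrPdist_le => eps e0.
have eta0 : 0 < eps / (2 * (M + 1)) by rewrite divr_gt0 ?mulr_gt0// ltr_wpDl.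
have e20 : 0 < eps / 2 by rewrite divr_gt0.
have near1 := cvge0_near_lt (nbhs_filter u) (@lambda_continuous u) eta0.
have /cvgrPdist_le/(_ _ e20) near2 := kernel_op_continuous K_continuous (bf u) (x := u).
apply: filterS2 near1 near2 => v h1 h2.
have h3 : `|kernel_op K (fun w => lambda u w * psi w) v - cov v| <= eps / 2.
  have dist w : setT w -> `|lambda u w * psi w - lambda v w * psi w| <= eps / (2 * (M + 1)) * M.
    move=> _; rewrite -mulrBl normrM distrC ler_pM//.
    rewrite -lee_fin; apply: le_trans (ltW h1).
    by apply: ereal_sup_ubound; exists w.
  have := le_Rintegral_dist measurableT (kernel_op_lty K v)
    (integrable_bm (kernel_op_lty K v) (bf u)) (integrable_bm (kernel_op_lty K v) (bf v)) dist.
  move/le_trans; apply; rewrite prob_kernel mulr1 mulrAC ler_pdivrMr ?mulr_gt0 ?ltr_wpDl//.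
  by rewrite -[eps / 2 * _]mulrA [2^-1 * _]mulrA mulVf// mul1r ler_wpM2l ?(ltW e0)// lerDl.
rewrite [eps]splitr -[cov u](subrK (kernel_op K (fun w => lambda u w * psi w) v)) -addrA.
by rewrite (le_trans (ler_normD _ _))// lerD.
Qed.

Lemma continuous_bm (f : S -> R) : continuous f -> bounded_measurable (f : borel S -> R).
Proof.
move=> cf; have [M fM] := compact_continuous_bounded compact_S cf.
exact: bounded_continuous_bm fM.
Qed.

Let bpsi : bounded_measurable (psi : borel S -> R) := continuous_bm psi_continuous.

Let bgam : bounded_measurable (gam : borel S -> R).
Proof. by apply: continuous_bm; exact: tv_continuous_charge_integral. Qed.

Let b1 : bounded_measurable (fun u : borel S => e u + gam u).
Proof. by apply: bm_add => //; exact: continuous_bm. Qed.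

Let b2 : bounded_measurable (fun u : borel S => sigma2 u + 2 * cov u).
Proof. by apply: bm_add; [|apply: bm_scale]; exact: continuous_bm. Qed.

Let bpot : bounded_measurable (potential : borel S -> R).
Proof. by apply: bm_lin => //; exact: bm_scale. Qed.

Lemma potential_mean :
  \int[pi0]_u potential u = delta_tilde K pi0 Gamma e sigma2 lambda psi theta.
Proof.
have ml : (pi0 setT < +oo)%E by rewrite probability_setT ltry.
rewrite /potential (Rintegral_lin 2 ml b1 (bm_scale (2 * theta - 1) b2)).
congr (_ + _); have := Rintegral_lin (2 * theta - 1) ml b2 (bm_cst (borel S) (0 : R)).
under [in X in X -> _]eq_Rintegral do rewrite addr0.
by move=> ->; rewrite (Rintegral_cst1 measurableT (probability_setT pi0)) addr0.
Qed.

Let bnd_phase (f : S -> R) : bounded_measurable (f : borel S -> R) -> bnd (fun z => f z.2).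
Proof. by move=> [_ [M fM]]; apply: (bnd_bounded _ (M := M)) => z; exact: fM. Qed.

Let bnd_cst (a : R) : bnd (fun=> a).
Proof. by apply: (bnd_bounded _ (M := `|a|)). Qed.

Let poisson u : kernel_op K psi u = psi u - d u.
Proof.
have Ku : K u setT = 1%E by exact: prob_kernel.
have iK := integrable_bm (kernel_op_lty K u) bpsi.
have := psi_poisson u.
rewrite (RintegralB measurableT (integrable_cst_fin measurableT (kernel_op_lty K u) (psi u)) iK).
rewrite (Rintegral_cst1 measurableT Ku) -/(kernel_op K psi u) => <-.
by rewrite opprB addrC subrK.
Qed.

Section with_corrector.
Variables (g : S -> R) (c M : R).
Hypotheses (bg : bounded_measurable (g : borel S -> R)).
Hypotheses (psiM : forall u, `|psi u| <= M) (gM : forall u, `|g u| <= M).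
Local Notation Z := (lyapunov psi g c).
Local Notation dev z := (Ex z (fun y => y.1 - z.1)).
Local Notation var z := (Ex z (fun y => (y.1 - z.1) ^+ 2)).
Local Notation mix z := (Ex z (fun y => (y.1 - z.1) * psi y.2)).
Local Notation phase f z := (Ex z (fun y => f y.2)).
Local Notation inc z := (Ex z (fun y => Z y - Z z)).
Local Notation inc2 z := (Ex z (fun y => (Z y - Z z) ^+ 2)).

Let gt0_good (z : strip R S) : 1 <= z.1 -> 0 < z.1. Proof. exact: lt_le_trans. Qed.
Let gt0_good1 (z : strip R S) : 1 <= z.1 -> 0 < 1 + z.1.
Proof. by move=> z1; rewrite addr_gt0// gt0_good. Qed.

Let bsigma2 := continuous_bm sigma2_continuous.
Let be := continuous_bm e_continuous.
Let bpsi2 : bounded_measurable (fun v : borel S => psi v ^+ 2).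
Proof. by under eq_fun do rewrite expr2; exact: bm_mul. Qed.

Let bvar : bnd (fun z => var z).
Proof.
apply: (bnd_ext _ (bnd_add (neg_bnd variance_asymptotics) (bnd_phase bsigma2))).
by move=> z _ _; rewrite subrK.
Qed.

Let nphase (f : S -> R) : bounded_measurable (f : borel S -> R) ->
  neg (fun z => phase f z - kernel_op K f z.2).
Proof. by move=> [mf [N fN]]; exact: (phase_limit (f := fun=> f) (fun=> mf) (fun=> fN)). Qed.

Let ndev : neg (fun z => dev z - d z.2).
Proof.
have bb := bnd_add (neg_bnd drift_asymptotics) (bnd_phase be).
apply: neg_ext (neg_mul (neg_inv good_states) bb) => z _ z1.
by rewrite subrK -mulrBr mulrA mulVf ?mul1r// gt_eqF// gt0_good.
Qed.

(** The Poisson equation at work: x E[dX] gives x d + e, and x times the mean increment of psi gives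
    - x d + Gamma psi, so the terms of size x cancel. *)
Let ninc : neg (fun z => z.1 * inc z -
  (e z.2 + gam z.2 + (kernel_op K g z.2 - g z.2))).
Proof.
have n3 : neg (fun z => z.1 * (phase psi z - kernel_op K psi z.2) - gam z.2).
  by apply: (phase_asymptotics (f := fun=> psi)) => // _; exact: measurable_psi.
have n7 : neg (fun z => z.1 * (inc z - (dev z + phase psi z - psi z.2
    + (phase g z - g z.2) * (1 + z.1)^-1))).
  have bb := bnd_mul (bnd_cst M) (bnd_add (bnd_cst 1) (bnd_mul (bnd_cst 2) bvar)).
  apply: neg_le (neg_mul (neg_inv_add1 good_states) bb) => z gz z1.
  have x0 := ltW (gt0_good z1).
  have := expected_increment c measurable_psi bg.1 psiM gM z.2
    (Ks_half_strip gz.1) x0 (good_dev2 gz).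
  rewrite -surjective_pairing => h.
  rewrite normrM (ger0_norm x0) (le_trans (ler_wpM2l x0 h))//.
  rewrite (le_trans _ (ler_norm _))// expr2 invfM.
  set w := (1 + z.1)^-1; set A := M * _.
  have A0 : 0 <= A.
    rewrite mulr_ge0 ?addr_ge0 ?mulr_ge0// ?(le_trans _ (psiM point))//.
    by apply: Rintegral_ge0 => y _; exact: sqr_ge0.
  have w0 : 0 <= w by rewrite invr_ge0 ltW// gt0_good1.
  have xw : z.1 * w <= 1 by rewrite /w ler_pdivrMr ?gt0_good1// mul1r lerDr.
  have -> : z.1 * (A * (w * w)) = (w * A) * (z.1 * w) by ring.
  by rewrite ler_piMr// mulr_ge0.
have b8 : bnd (fun z => z.1 * (1 + z.1)^-1).
  exists 1, 1 => // z _ z1; rewrite ger0_norm.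
    by rewrite ler_pdivrMr ?gt0_good1// mul1r lerDr.
  by rewrite mulr_ge0 ?invr_ge0 ?ltW ?gt0_good ?gt0_good1.
have n9 := neg_mul (neg_inv_add1 good_states)
  (bnd_phase (bm_sub bg (kernel_op_bm K_continuous bg))).
apply: neg_ext (neg_add (neg_add (neg_add n7 drift_asymptotics) n3)
  (neg_add (neg_mul (nphase bg) b8) n9)) => z _ z1.
rewrite poisson; move: (inc z) (dev z) (phase psi z) (phase g z) (kernel_op K g z.2).
by move=> I D P G k; field; rewrite gt_eqF// gt0_good1.
Qed.

Let binc : bnd (fun z => z.1 * inc z).
Proof.
have bb := bnd_phase (bm_add b1 (bm_sub (kernel_op_bm K_continuous bg) bg)).
by apply: (bnd_ext _ (bnd_add (neg_bnd ninc) bb)) => z _ _; rewrite subrK.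
Qed.

Let bZ : bnd (fun z => Z z - z.1).
Proof.
exists (M + `|c| + M), 1 => // z _ z1; rewrite /lyapunov.
have -> : z.1 + psi z.2 + c + g z.2 * (1 + `|z.1|)^-1 - z.1 =
  psi z.2 + c + g z.2 * (1 + `|z.1|)^-1 by ring.
rewrite (le_trans (ler_normD _ _))// lerD//.
  by rewrite (le_trans (ler_normD _ _))// lerD.
have x1 : 1 <= 1 + `|z.1| by rewrite lerDl.
have x0 : 0 < 1 + `|z.1| by exact: lt_le_trans x1.
rewrite normrM (gtr0_norm (_ : 0 < (1 + `|z.1|)^-1)) ?invr_gt0//.
rewrite ler_pdivrMr// (le_trans (gM _))// ler_peMr//.
exact: le_trans (gM point).
Qed.

(** Z - x is bounded and E[dZ] is of the order 1/x, so the factor x may be replaced by Z. *)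
Let ninc' : neg (fun z => (Z z - z.1) * inc z).
Proof.
apply: neg_ext (neg_mul (neg_inv good_states) (bnd_mul bZ binc)) => z _ z1.
by rewrite mulrCA [z.1^-1 * _]mulrA mulVf ?mul1r// gt_eqF// gt0_good.
Qed.

(** The cross terms - 2 psi d and - 2 psi K psi = - 2 psi (psi - d) combine so that d disappears and
    K psi^2 - psi^2 is left. *)
Let ninc2 : neg (fun z => inc2 z - (sigma2 z.2 + 2 * cov z.2 +
  (kernel_op K (fun v => psi v ^+ 2) z.2 - psi z.2 ^+ 2))).
Proof.
have n8 : neg (fun z => inc2 z - (var z + 2 * mix z - 2 * psi z.2 * dev z
    + phase (fun v => psi v ^+ 2) z - 2 * psi z.2 * phase psi z + psi z.2 ^+ 2)).
  have bb := bnd_mul (bnd_cst (16 * M * (1 + 2 * M))) (bnd_add (bnd_cst 1) bvar).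
  apply: neg_le (neg_mul (neg_inv_add1 good_states) bb) => z gz z1.
  have := expected_square c measurable_psi bg.1 psiM gM z.2
    (Ks_half_strip gz.1) (ltW (gt0_good z1)) (good_dev2 gz).
  rewrite -surjective_pairing => /le_trans; apply.
  by rewrite (le_trans _ (ler_norm _))// mulrC.
have bp := bnd_mul (bnd_cst (-2)) (bnd_phase bpsi).
apply: neg_ext (neg_add n8 (neg_add (neg_add variance_asymptotics
  (neg_mul covariance_asymptotics (bnd_cst 2)))
  (neg_add (neg_add (neg_mul ndev bp) (neg_mul (nphase bpsi) bp)) (nphase bpsi2)))).
move=> z _ _; rewrite poisson /cov.
by ring.
Qed.

Lemma corrected_drift : neg (fun z => 2 * Z z * inc z + (2 * theta - 1) * inc2 z -
  (potential z.2 + 2 * (kernel_op K g z.2 - g z.2) +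
   (2 * theta - 1) * (kernel_op K (fun v => psi v ^+ 2) z.2 - psi z.2 ^+ 2))).
Proof.
apply: neg_ext (neg_add (neg_mul (neg_add ninc ninc') (bnd_cst 2))
  (neg_mul ninc2 (bnd_cst (2 * theta - 1)))) => z _ _.
by rewrite /potential; ring.
Qed.

Lemma corrected_drift_bounded : bnd (fun z => Z z * inc z) /\ bnd (fun z => inc2 z).
Proof.
split.
  by apply: (bnd_ext _ (bnd_add binc (neg_bnd ninc'))) => z _ _; ring.
have bk := kernel_op_bm K_continuous bpsi2.
apply: (bnd_ext _ (bnd_add (neg_bnd ninc2) (bnd_phase (bm_add b2 (bm_sub bk bpsi2))))).
by move=> z _ _; rewrite subrK.
Qed.

End with_corrector.

Lemma lyapunov_drift eps : 0 < eps ->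
  exists (Z : strip R S -> R) (c B x1 : R),
  [/\ measurable_fun setT Z, 0 <= B, 1 <= x1,
      forall z, H z -> 1 <= Z z /\ `|Z z - z.1| <= c &
      forall z, good_states z -> x1 <= z.1 ->
      [/\ (Ks z).-integrable H (EFin \o (fun y => `|Z y - Z z| `^ p)),
          \int[Ks z]_(y in H) `|Z y - Z z| `^ p <= B,
          \int[Ks z]_(y in H) (Z y - Z z) ^+ 2 <= B,
          `|Z z * \int[Ks z]_(y in H) (Z y - Z z)| <= B &
          `|2 * Z z * \int[Ks z]_(y in H) (Z y - Z z) +
            (2 * theta - 1) * \int[Ks z]_(y in H) (Z y - Z z) ^+ 2 -
            delta_tilde K pi0 Gamma e sigma2 lambda psi theta| <= eps]].
Proof.
move=> e0; have e20 : 0 < eps / 2 by rewrite divr_gt0.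
have [G bG hG] := approximate_corrector K_continuous compact_S pi0_invariant bpot e20.
have bpsi2 : bounded_measurable (fun v : borel S => psi v ^+ 2).
  by under eq_fun do rewrite expr2; exact: bm_mul.
(* The first half of [eps] is spent on the corrector [G] and the second on the asymptotics. The
   coefficients of [g] make twice its coboundary equal to that of [G] minus [2 * theta - 1] times
   that of psi^2. *)
pose g v := 2^-1 * G v + (- (theta - 2^-1)) * psi v ^+ 2.
have bg : bounded_measurable (g : borel S -> R) by apply: bm_lin => //; exact: bm_scale.
have gE u : 2 * (kernel_op K g u - g u) + (2 * theta - 1) *
    (kernel_op K (fun v => psi v ^+ 2) u - psi u ^+ 2) = kernel_op K G u - G u.
  have -> : kernel_op K g u =
      2^-1 * kernel_op K G u + - (theta - 2^-1) * kernel_op K (fun v => psi v ^+ 2) u.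
    rewrite /g kernel_op_lin//; last exact: bm_scale.
    by rewrite {2}/kernel_op (RintegralZl _ measurableT (integrable_bm (kernel_op_lty K u) bpsi2)).
  rewrite /g; move: (kernel_op K G u) (kernel_op K _ u) => x y.
  by have h2 : 2 != 0 :> R by []; field.
have [Mp Mp0 psiMp] := bounded_psi; have [_ [Mg gMg]] := bg.
have Mg0 : 0 <= Mg by apply: le_trans (gMg point).
(* On the half-strip psi and the weighted [g] are each at least [- M], so this [c] gives Z >= 1 +
   x. *)
pose M := Mp + Mg; pose c := 1 + 2 * M.
have psiM u : `|psi u| <= M by rewrite (le_trans (psiMp u))// lerDl.
have gM u : `|g u| <= M by rewrite (le_trans (gMg u))// lerDr.
have M0 : 0 <= M by rewrite addr_ge0.
have [x2 x21 h2] := corrected_drift c bg psiM gM e20.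
have [[B3 [x3 x31 h3]] [B4 [x4 x41 h4]]] := corrected_drift_bounded c bg psiM gM.
exists (lyapunov psi g c), (1 + 4 * M).
exists (`|B3| + `|B4| + 2 `^ p * (`|b| + (4 * M) `^ p)).
exists (Num.max x2 (Num.max x3 x4)).
have B50 : 0 <= 2 `^ p * (`|b| + (4 * M) `^ p).
  by rewrite mulr_ge0 ?addr_ge0 ?powR_ge0.
split.
- exact: measurable_lyapunov measurable_psi bg.1.
- by rewrite addr_ge0// addr_ge0.
- by rewrite le_max x21.
- move=> z [z0 _]; rewrite /lyapunov (ger0_norm z0).
  have x0 : 0 < 1 + z.1 by rewrite ltr_pwDl.
  have h : `|g z.2 * (1 + z.1)^-1| <= M.
    rewrite normrM (gtr0_norm (_ : 0 < (1 + z.1)^-1)) ?invr_gt0// ler_pdivrMr//.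
    by rewrite (le_trans (gM _))// ler_peMr// lerDl.
  move: h (psiM z.2); rewrite !ler_norml => /andP[h5 h6] /andP[h7 h8].
  have z0' : 0 <= z.1 by [].
  split.
    have : 1 + 2 * M + (- M + - M) <= z.1 + (1 + 2 * M) + (psi z.2 + g z.2 * (1 + z.1)^-1).
      by apply: lerD; [rewrite lerDr|exact: lerD].
    rewrite (_ : 1 + 2 * M + _ = 1); last by ring.
    by move/le_trans; apply; rewrite le_eqVlt; apply/orP; left; apply/eqP; rewrite /c; ring.
  rewrite [X in _ <= X <= _](_ : _ = 1 + 2 * M + (psi z.2 + g z.2 * (1 + z.1)^-1)); last first.
    by rewrite /c; ring.
  apply/andP; split.
    apply: (@le_trans _ _ (1 + 2 * M + (- M + - M))); last by rewrite lerD// lerD.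
    rewrite (_ : 1 + 2 * M + _ = 1); last by ring.
    by rewrite (@le_trans _ _ 0)// oppr_le0 addr_ge0// mulr_ge0.
  apply: (@le_trans _ _ (1 + 2 * M + (M + M))); first by rewrite lerD// lerD.
  by apply: eq_ler; ring.
- move=> z gz; rewrite !ge_max => /andP[z2 /andP[z3 z4]].
  have x0 : 0 <= z.1 by rewrite (le_trans ler01)// (le_trans x21).
  have [ip ipb] := good_moment gz.
  have p0 : 0 <= p by apply: ltW; apply: lt_trans p_gt2.
  have := increment_powR_integrable c measurable_psi bg.1 psiM gM z.2
    (Ks_half_strip gz.1) x0 p0 ip.
  rewrite -surjective_pairing => -[jp jpb]; split => //.
  + rewrite (le_trans jpb)// (@le_trans _ _ (2 `^ p * (`|b| + (4 * M) `^ p)))//.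
      by rewrite ler_wpM2l ?powR_ge0// lerD2r (le_trans ipb)// ler_norm.
    by rewrite lerDr addr_ge0.
  + rewrite (le_trans (ler_norm _))// (le_trans (h4 z gz z4))// (le_trans (ler_norm _))//.
    by rewrite -addrA addrCA lerDl addr_ge0.
  + rewrite (le_trans (h3 z gz z3))// (le_trans (ler_norm _))//.
    by rewrite -addrA lerDl addr_ge0.
  + have h6 := h2 z gz z2; rewrite -(addrA (potential z.2)) gE in h6.
    have h5 := hG z.2; rewrite potential_mean in h5; move: h5 h6.
    set F := 2 * _ * _ + _; set Q := potential _ + _; set D := delta_tilde _ _ _ _ _ _ _ _.
    move=> h5 h6; have -> : F - D = (F - Q) + (Q - D) by rewrite addrA subrK.
    by rewrite [eps]splitr (le_trans (ler_normD _ _))// lerD.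
Qed.

End kernel_asymptotics.

(** * Bounds on the survival probabilities *)

Section lyapunov_survival.
Context (R : realType) (S : pmetricType R) (Ks : R.-pker strip R S ~> strip R S).
Variables (p xB b theta eps : R) (Z : strip R S -> R) (c B x1 : R).
Hypotheses (Ks_half_strip : half_strip_kernel Ks) (p_gt2 : 2 < p) (eps_gt0 : 0 < eps)
  (theta_gt0 : 0 < theta) (x1_ge1 : 1 <= x1).
Hypotheses (mZ : measurable_fun setT Z) (B_ge0 : 0 <= B).
Local Notation H := (@half_strip R S).
Local Notation good := (reachable Ks p xB b).
Local Notation C r := (above r `&` good).
Local Notation Ex z f := (Rintegral (Ks z) H f).
Hypothesis Z_abscissa : forall z, H z -> 1 <= Z z /\ `|Z z - z.1| <= c.
Hypothesis Z_step : forall z, good_states Ks p b z -> x1 <= z.1 ->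
  [/\ (Ks z).-integrable H (EFin \o (fun y => `|Z y - Z z| `^ p)),
      Ex z (fun y => `|Z y - Z z| `^ p) <= B,
      Ex z (fun y => (Z y - Z z) ^+ 2) <= B &
      `|Z z * Ex z (fun y => Z y - Z z)| <= B].
Local Notation drift t z := (2 * Z z * Ex z (fun y => Z y - Z z) +
  (2 * t - 1) * Ex z (fun y => (Z y - Z z) ^+ 2)).

Let mH := @measurable_half_strip R S.
Let mG := @measurable_reachable R S Ks p xB b.

Let mC r : measurable (C r).
Proof. by apply: measurableI => //; exact: measurable_abscissa_gt. Qed.

Let CH r : C r `<=` H.
Proof. by move=> z [_]; exact: reachable_half_strip. Qed.

Let mZH : measurable_fun H Z. Proof. exact: measurable_funTS. Qed.

Let Z_ge0 z : H z -> 0 <= Z z.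
Proof. by move=> /Z_abscissa[Z1 _]; exact: le_trans Z1. Qed.

Let C_good r z : xB <= r -> x1 <= r -> C r z -> good_states Ks p b z /\ x1 <= z.1.
Proof.
rewrite /above => xBr x1r [/= rz Gz]; have rz' := ltW rz.
split; last exact: le_trans rz'.
by split; [exact: reachable_half_strip Gz|apply: (reachable_moment Gz); exact: le_trans rz'].
Qed.

Let Z_gt r z : C r z -> r - c <= Z z.
Proof.
move=> Cz; have [_] := Z_abscissa (CH Cz); have [rz _] := Cz.
by rewrite ler_norml => /andP[h _]; rewrite -lerBrDr in h *; rewrite /above /= in rz; lra.
Qed.

(** Verifies the drift condition of [survival_tail] for all the powers [s - j], on the reachable
    states above a high enough level. *)
Lemma survival_upper s : 0 < s -> s <= theta -> 2 * s <= p ->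
  (forall z, good_states Ks p b z -> x1 <= z.1 -> drift theta z <= - eps) ->
  exists2 r1, 0 <= r1 & forall r, r1 <= r ->
    exists2 k, 0 <= k & forall n z, C r z ->
      survival Ks (C r) n z <= k * Z z `^ (2 * s) * n.+1%:R `^ (- s).
Proof.
move=> s0 st sp down.
have [N sN] : exists N : nat, s <= N%:R.
  by exists (Num.truncn s).+1; rewrite ltW// truncnS_gt.
(* Finitely many exponents occur, so one level [A] serves them all. *)
have [A hA] : exists A, forall j : nat, (j < N)%N -> 0 < s - j%:R ->
    forall z, good_states Ks p b z -> x1 <= z.1 -> A <= Z z ->
    (Ks z).-integrable H (EFin \o (fun y => Z y `^ (2 * (s - j%:R)))) /\
    Ex z (fun y => Z y `^ (2 * (s - j%:R))) <= Z z `^ (2 * (s - j%:R)) -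
      2 * (s - j%:R) * eps / 4 * Z z `^ (2 * (s - j%:R) - 2).
  elim: N {sN} => [|N [A hA]]; first by exists 0.
  have [t0|t0] := ltP 0 (s - N%:R); last first.
    exists A => j; rewrite ltnS leq_eqVlt => /predU1P[->|jN]; last exact: hA.
    by rewrite ltNge t0.
  have Np : 0 < 2 * (s - N%:R) <= p.
    rewrite mulr_gt0//= (le_trans _ sp)// ler_wpM2l// gerBl//.
  have [a0 a01 h] := powR_drift_down p_gt2 Np eps_gt0 B_ge0.
  exists (Num.max A a0) => j; rewrite ltnS leq_eqVlt => /predU1P[->|jN] tj z gz zx; last first.
    by rewrite ge_max => /andP[Az _]; exact: hA.
  rewrite ge_max => /andP[_ az]; have [i1 i2 i3 i4] := Z_step gz zx.
  apply: (h _ _ (Ks z) H Z (Z z) mH (Ks_half_strip gz.1) mZH Z_ge0 az i1 i3 i2).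
  (* The exponent [s - j] is at most [theta] and the second moment is nonnegative, so the drift
     bound for [theta] carries over. *)
  apply: le_trans (down z gz zx); rewrite lerD2l ler_wpM2r//.
    by apply: Rintegral_ge0 => y _; exact: sqr_ge0.
  by rewrite lerD2r ler_wpM2l// (le_trans _ st)// gerBl.
exists (`|xB| + x1 + `|A| + `|c|).
  by rewrite !addr_ge0// (le_trans ler01).
move=> r r1r.
have [xBr x1r Acr] : [/\ xB <= r, x1 <= r & A <= r - c].
  have := ler_norm xB; have := ler_norm A; have := ler_norm c.
  have := normr_ge0 xB; have := normr_ge0 A; have := normr_ge0 c.
  by have x10 := x1_ge1; move=> h1 h2 h3 h4 h5 h6; split; lra.
apply: (survival_tail (mC r)) => // [z /CH/Z_abscissa[]//|j tj].
have jN : (j < N)%N by rewrite -(ltr_nat R) (lt_le_trans _ sN)// -subr_gt0.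
exists (2 * (s - j%:R) * eps / 4); first by rewrite divr_gt0// mulr_gt0// mulr_gt0.
move=> z Cz; have [gz zx] := C_good xBr x1r Cz.
have [i1 i2] := hA j jN tj z gz zx (le_trans Acr (Z_gt Cz)).
split; first exact: integrableS mH (mC r) (@CH r) i1.
apply: le_trans i2; rewrite /Rintegral fine_le//.
- apply: integrable_fin_num => //; exact: integrableS mH (mC r) (@CH r) i1.
- exact: integrable_fin_num i1.
- apply: ge0_subset_integral => //; first exact: measurable_int i1.
  by move=> y _; rewrite lee_fin powR_ge0.
Qed.

(** The law of a reachable state charges reachable states only, and dropping those below [r], where
    [f] is nonpositive, can only increase the integral. A drift bound for the full kernel thus
    becomes one for the killed kernel. *)
Lemma integral_reachable_le r z (f : strip R S -> R) : good z ->
  (Ks z).-integrable H (EFin \o f) -> (forall y, H y -> y.1 <= r -> f y <= 0) ->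
  Ex z f <= \int[Ks z]_(y in C r) f y.
Proof.
move=> Gz fi f0.
have GH : good `<=` H by move=> y; exact: reachable_half_strip.
have -> : Ex z f = \int[Ks z]_(y in good) f y.
  rewrite /Rintegral (negligible_integral (measurableC mG) mH fi (reachable_absorbing Gz)).
  by rewrite setDE setCK setIidr.
have GU : good = C r `|` (good `\` above r).
  by rewrite setIC setUIDK.
have mA : measurable (@above R S r) by exact: measurable_abscissa_gt.
have mD : measurable (good `\` above r) by exact: measurableD.
have iG := integrableS mH mG GH fi.
have disj : [disjoint C r & good `\` above r].
  by apply/disj_setPS => y [[Ay _] [_]].
have iU : (Ks z).-integrable (C r `|` (good `\` above r)) (EFin \o f) by rewrite -GU.
rewrite [X in Rintegral _ X _]GU (Rintegral_setU (mC r) mD iU disj) gerDl.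
have iD : (Ks z).-integrable (good `\` above r) (EFin \o f).
  by apply: (integrableS mG mD _ iG) => y [].
have := le_Rintegral mD iD (integrable_cst_fin mD _ 0).
rewrite Rintegral_cst// mul0r; apply.
  by rewrite (le_lt_trans (kernel_le1 _ mD z))// ltry.
by move=> y [Gy /negP]; rewrite /above /= -leNgt; apply: f0; exact: GH.
Qed.

Lemma survival_lower : 2 * theta <= p ->
  (forall z, good_states Ks p b z -> x1 <= z.1 -> eps <= drift theta z) ->
  exists2 r0, 0 <= r0 & forall r, r0 <= r ->
    exists2 k, 0 < k & forall m N z, 0 < m -> r + c <= m -> N%:R <= k * m ^+ 2 -> C r z ->
      2^-1 * ((Num.min (Z z) (4 * m) `^ (2 * theta) - (r + c) `^ (2 * theta))
        / (4 * m) `^ (2 * theta)) <= survival Ks (C r) N z.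
Proof.
move=> tp up.
have Hp : H (0, point) by split => //; rewrite /Rplus /=.
have c0 : 0 <= c by have [_] := Z_abscissa Hp; exact: le_trans.
have nu0 : 0 < 2 * theta <= p by rewrite mulr_gt0.
have [a0 a01 hup] := powR_drift_up p_gt2 nu0 eps_gt0 B_ge0.
exists (`|xB| + x1 + a0 + c).
  by rewrite !addr_ge0// ?(le_trans ler01).
move=> r r0r.
have [xBr x1r acr r_ge0] : [/\ xB <= r, x1 <= r, a0 <= r - c & 0 <= r].
  have h1 := ler_norm xB; have h2 := normr_ge0 xB.
  by have x10 := x1_ge1; split; lra.
(* With this [k] the total loss over [N] steps is at most 1/10; starting from at least 3/5, at least
   1/2 remains. *)
exists (80 * (B + 1))^-1; first by rewrite invr_gt0 mulr_gt0// ltr_wpDl.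
move=> m N z m0 rm Nm Cz.
have m20 : 0 < m ^+ 2 by rewrite exprn_gt0.
have escape y : C r y -> 2 * m <= Z y -> 2^-1 <= survival Ks (C r) N y.
  move=> Cy my.
  (* [G] is nonpositive where Z <= m, in particular where the abscissa is at most [r] since r + c <=
     m, and it is at least 3/5 where Z >= 2 m. *)
  pose G w := 1 - 2 * (m ^+ 2 / (m ^+ 2 + Z w ^+ 2)).
  have q01 w : 0 <= m ^+ 2 / (m ^+ 2 + Z w ^+ 2) <= 1.
    have A0 : 0 < m ^+ 2 + Z w ^+ 2 by rewrite ltr_pwDl ?sqr_ge0.
    by rewrite divr_ge0 ?(ltW m20) ?(ltW A0)//= ler_pdivrMr// mul1r lerDl sqr_ge0.
  have mq : measurable_fun H (fun w => m ^+ 2 / (m ^+ 2 + Z w ^+ 2)).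
    apply: (@measurableT_comp _ _ _ _ _ _ (fun y : R => m ^+ 2 / (m ^+ 2 + y ^+ 2))) => //.
    apply: continuous_measurable_fun => t.
    apply: cvgM; first exact: cvg_cst.
    apply: cvgV; first by rewrite gt_eqF// ltr_pwDl ?sqr_ge0.
    by apply: cvgD; [exact: cvg_cst|exact: exprn_continuous].
  have iq w : H w -> (Ks w).-integrable H (EFin \o (fun w => m ^+ 2 / (m ^+ 2 + Z w ^+ 2))).
    move=> Hw; apply: (@integrable_bdd _ _ _ _ _ mH _ _ 1) => //.
      by rewrite Ks_half_strip// ltry.
    by move=> v _; have /andP[q0 q1] := q01 v; rewrite ger0_norm.
  have iG w : H w -> (Ks w).-integrable H (EFin \o G).
    move=> Hw; apply: integrable_sub => //; last exact/integrable_scale/iq.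
    by apply: integrable_cst_fin => //; rewrite Ks_half_strip// ltry.
  have Glow : 3 / 5 <= G y.
    rewrite /G; have h : m ^+ 2 / (m ^+ 2 + Z y ^+ 2) <= 1 / 5.
      rewrite ler_pdivrMr; last by rewrite ltr_pwDl ?sqr_ge0.
      have : (2 * m) ^+ 2 <= Z y ^+ 2.
        by rewrite lerXn2r ?nnegrE ?mulr_ge0 ?(ltW m0)// Z_ge0//; exact: CH Cy.
      rewrite exprMn; lra.
    by lra.
  have cB : 0 <= 8 * B / m ^+ 2 by rewrite divr_ge0 ?mulr_ge0// ltW.
  apply: (@le_trans _ _ (G y - N%:R * (8 * B / m ^+ 2))).
    have h : N%:R * (8 * B / m ^+ 2) <= 1 / 10.
      apply: (@le_trans _ _ ((80 * (B + 1))^-1 * m ^+ 2 * (8 * B / m ^+ 2))).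
        by rewrite ler_wpM2r.
      have B1 : 0 < B + 1 by rewrite ltr_wpDl.
      have -> : (80 * (B + 1))^-1 * m ^+ 2 * (8 * B / m ^+ 2) = 1 / 10 * (B / (B + 1)).
        by field; rewrite !gt_eqF.
      by rewrite ler_piMr// ler_pdivrMr// mul1r lerDl.
    by lra.
  apply: (survival_ge_linear (mC r) cB) => //.
  - by move=> w _; rewrite /G gerBl mulr_ge0//; have /andP[] := q01 w.
  - by move=> w Cw; exact: integrableS mH (mC r) (@CH r) (iG w (CH Cw)).
  - move=> w Cw; have Hw := CH Cw; have [gw wx] := C_good xBr x1r Cw.
    have [i1 i2 i3 i4] := Z_step gw wx.
    have := escape_step p_gt2 B_ge0 mH (Ks_half_strip Hw) mZH Z_ge0 (Z_ge0 Hw) m0 i1 i3 i4.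
    move=> esc; apply: le_trans (integral_reachable_le Cw.2 (iG w Hw) _).
      rewrite RintegralB//; last 2 first.
      + by apply: integrable_cst_fin => //; rewrite Ks_half_strip// ltry.
      + exact/integrable_scale/iq.
      rewrite (Rintegral_cst1 mH (Ks_half_strip Hw)) (RintegralZl _ mH (iq w Hw)) /G.
      have -> : 8 * B / m ^+ 2 = 2 * (4 * B / m ^+ 2) by ring.
      by rewrite -addrA lerD2l -opprD lerN2 -mulrDr ler_wpM2l.
    move=> v Hv vr; rewrite /G; have [_] := Z_abscissa Hv; rewrite ler_norml => /andP[_ h].
    have Zm : Z v <= m by apply: le_trans rm; rewrite -lerBlDl (le_trans _ h)// lerD2l lerN2.
    have Z2 : Z v ^+ 2 <= m ^+ 2 by rewrite lerXn2r ?nnegrE ?Z_ge0 ?(ltW m0).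
    have A0 : 0 < m ^+ 2 + Z v ^+ 2 by rewrite ltr_pwDl ?sqr_ge0.
    by rewrite subr_le0 mulrA ler_pdivlMr// mul1r; lra.
set nu := 2 * theta in nu0 hup *; have /andP[nu_gt0 nup] := nu0.
have m40 : 0 < 4 * m by rewrite mulr_gt0.
have P0 : 0 < (4 * m) `^ nu by rewrite powR_gt0.
(* [W] is at most 1/2, the survival probability after the level 2 m, and nonpositive where the
   abscissa is at most [r], since Z <= r + c there. The cut 4 m is twice that level, as
   [powR_drift_up] requires. *)
pose W w := 2^-1 * ((Num.min (Z w) (4 * m) `^ nu - (r + c) `^ nu) / (4 * m) `^ nu).
have min_le w : H w -> Num.min (Z w) (4 * m) `^ nu <= (4 * m) `^ nu.
  move=> Hw; apply: ge0_ler_powR; rewrite ?nnegrE ?le_min ?(ltW nu_gt0) ?(ltW m40) ?Z_ge0//.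
  by rewrite ge_min lexx orbT.
have mW : measurable_fun H W.
  apply: measurable_funM; first exact: measurable_cst.
  apply: measurable_funM; last exact: measurable_cst.
  apply: measurable_funB; last exact: measurable_cst.
  apply: (measurableT_comp (measurable_powR nu)).
  by apply: measurable_minr => //; exact: measurable_cst.
have Wle w : H w -> W w <= 2^-1.
  move=> Hw; rewrite /W ger_pMr ?invr_gt0// ler_pdivrMr// mul1r.
  by rewrite lerBlDr (le_trans (min_le w Hw))// lerDl powR_ge0.
have mini w : H w -> (Ks w).-integrable H (EFin \o (fun v => Num.min (Z v) (4 * m) `^ nu)).
  move=> Hw; apply: (@integrable_bdd _ _ _ _ _ mH _ _ ((4 * m) `^ nu)).
  - by rewrite Ks_half_strip// ltry.
  - apply: (measurableT_comp (measurable_powR nu)).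
    by apply: measurable_minr => //; exact: measurable_cst.
  - by move=> v Hv; rewrite ger0_norm ?powR_ge0//; exact: min_le.
have icst w k : H w -> (Ks w).-integrable H (EFin \o (fun=> k : R)).
  by move=> Hw; apply: integrable_cst_fin => //; rewrite Ks_half_strip// ltry.
pose q := 2^-1 / (4 * m) `^ nu.
have WE : W = (fun w => q * (Num.min (Z w) (4 * m) `^ nu - (r + c) `^ nu)).
  by apply/funext => w; rewrite /W /q; ring.
have iW w : H w -> (Ks w).-integrable H (EFin \o W).
  by move=> Hw; rewrite WE; apply/integrable_scale/integrable_sub => //; [exact: mini|exact: icst].
apply: (survival_ge_stationary (mC r) (W := W) (N := N)) => //.
- by move=> w Cw; apply: le_trans (Wle w (CH Cw)) _; rewrite invf_le1// ler1n.
- by move=> w Cw; exact: integrableS mH (mC r) (@CH r) (iW w (CH Cw)).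
- move=> w Cw; have Hw := CH Cw; have [gw wx] := C_good xBr x1r Cw.
  (* At or above the level 2 m the escape estimate applies; below it the truncated power is a
     submartingale. *)
  have [mw|mw] := leP (2 * m) (Z w).
    by left; exact: le_trans (Wle w Hw) (escape w Cw mw).
  right; have [i1 i2 i3 i4] := Z_step gw wx.
  apply: le_trans (integral_reachable_le Cw.2 (iW w Hw) _); last first.
    move=> v Hv vr; rewrite /W pmulr_rle0 ?invr_gt0// pmulr_lle0 ?invr_gt0// subr_le0.
    apply: ge0_ler_powR; rewrite ?nnegrE ?le_min ?(ltW nu_gt0) ?(ltW m40) ?Z_ge0 ?addr_ge0//.
    have [_] := Z_abscissa Hv; rewrite ler_norml => /andP[_ h].
    by rewrite ge_min -lerBlDl (le_trans _ h)// lerD2l lerN2.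
  have aw := le_trans acr (Z_gt Cw).
  have := hup _ _ (Ks w) H Z (Z w) (2 * m) mH (Ks_half_strip Hw) mZH Z_ge0 aw (ltW mw) i1 i3 i2.
  have -> : 2 * (2 * m) = 4 * m by ring.
  move=> /(_ (up w gw wx)) h.
  rewrite WE (RintegralZl _ mH (integrable_sub mH (mini w Hw) (icst w _ Hw))).
  rewrite RintegralB//; [|exact: mini|exact: icst].
  rewrite (Rintegral_cst1 mH (Ks_half_strip Hw)).
  have -> : Num.min (Z w) (4 * m) = Z w.
    by apply/min_idPl; rewrite (le_trans (ltW mw))// ler_pM2r// ler_nat.
  by rewrite ler_wpM2l ?divr_ge0 ?invr_ge0 ?(ltW P0)// lerD2r.
Qed.

End lyapunov_survival.

(** * Divergence of the moments, and the conclusion *)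

Section unbounded_moment.
Context (R : realType) d (Omega : measurableType d) (P : probability Omega R).
Context (S : pmetricType R) (F : nat -> set (set Omega)).
Context (Ks : R.-pker strip R S ~> strip R S) (z0 : strip R S).
Context (xi : nat -> Omega -> strip R S).
Hypothesis hp : half_strip_process P F Ks z0 xi.

(** Markov's inequality at a time of order m^2 bounds the moment below by a multiple of m^(2 s -
    nu), which is unbounded. *)
Lemma passage_moment_infinite (r s nu k g M : R) : 0 < k -> 0 < g -> 0 <= nu -> nu < 2 * s ->
  (forall m N, M <= m -> N%:R <= k * m ^+ 2 ->
    ((g / m `^ nu)%:E <= P (stay xi (above r) N))%E) ->
  passage_moment P xi r s = +oo%E.
Proof.
move=> k0 g0 nu0 nus hP; have s0 : 0 < s.
  by rewrite -(pmulr_rgt0 _ (ltr0n R 2)); exact: le_lt_trans nus.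
have pm0 : (0 <= passage_moment P xi r s)%E.
  by apply: integral_ge0 => w _; exact: poweR_ge0.
apply/eqP; rewrite -leye_eq leNgt; apply/negP => pmoo.
have pmE : passage_moment P xi r s = (fine (passage_moment P xi r s))%:E.
  by rewrite fineK// ge0_fin_numE.
set A := fine _ in pmE; have A0 : 0 <= A by rewrite -lee_fin -pmE.
have A1 : 0 < A + 1 by rewrite ltr_wpDl.
pose D := k `^ s * g; have D0 : 0 < D by rewrite mulr_gt0// powR_gt0.
have q0 : 0 < 2 * s - nu by rewrite subr_gt0.
have [a0 a01 decay] := powR_decay q0 (divr_gt0 D0 A1).
pose m := Num.max a0 M; have m0 : 0 < m.
  by rewrite lt_max (lt_le_trans ltr01 a01).
have km0 : 0 <= k * m ^+ 2 by rewrite mulr_ge0 ?exprn_ge0 ?(ltW k0) ?(ltW m0).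
(* The largest admissible time; the factor [N.+1%:R]^ s[of the lower bound still dominates](k * m ^+
   2) [^ s]. *)
pose N := Num.truncn (k * m ^+ 2).
have Nkm : N%:R <= k * m ^+ 2 by rewrite truncn_le.
have kmN : k * m ^+ 2 <= N.+1%:R by rewrite ltW// truncnS_gt.
have := passage_moment_ge hp r N (ltW s0); rewrite pmE leNgt => /negP; apply.
have lowP : ((g / m `^ nu)%:E <= P (stay xi (above r) N))%E.
  by apply: hP => //; rewrite le_max lexx orbT.
apply: (@lt_le_trans _ _ ((k * m ^+ 2) `^ s * (g / m `^ nu))%:E); last first.
  rewrite EFinM; apply: lee_pmul => //.
  - by rewrite lee_fin powR_ge0.
  - by rewrite lee_fin divr_ge0 ?powR_ge0// ltW.
  - by rewrite lee_fin ge0_ler_powR ?nnegrE ?(ltW s0).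
have -> : (k * m ^+ 2) `^ s * (g / m `^ nu) = D * m `^ (2 * s - nu).
  rewrite powRM ?(ltW k0) ?exprn_ge0 ?(ltW m0)// -powR_mulrn ?(ltW m0)// -powRrM.
  by rewrite powRB ?gt_eqF// /D; ring.
rewrite lte_fin; apply: (@lt_le_trans _ _ (A + 1)); first by rewrite ltrDl.
have := decay m; rewrite le_max lexx => /(_ isT).
rewrite powRN ler_pdivlMr// mulrC ler_pdivrMr ?powR_gt0//.
Qed.

End unbounded_moment.

Theorem theorem2p7 (R : realType) (S : pmetricType R)
  (Ks : R.-pker strip R S ~> strip R S)
  (L : R.-pker (strip R S * borel S) ~> measurableTypeR R)
  (K : R.-pker borel S ~> borel S) (pi0 : probability (borel S) R)
  (Gamma : S -> {charge set (borel S) -> \bar R})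
  (p q xB Bp Bq : R) (d e sigma2 : S -> R) (lambda : S -> S -> R)
  (psi : S -> R)
  (compact_S : compact [set: S])
  (Ks_half_strip : half_strip_kernel Ks)
  (L_conditional : conditional_law Ks L)
  (pi0_invariant : unique_invariant K pi0)
  (K_continuous : tv_continuous (kernel_at K))
  (Gamma_continuous : tv_continuous Gamma)
  (asymptotic_markov :
    (x%:E * ereal_sup [set tv_norm
       (charge_sub (charge_sub (modulation_law Ks (x, u)) (kernel_at K u))
                   (cscale x^-1 (Gamma u))) | u in [set: S]])%E
      @[x --> +oo] --> 0%E)
  (p_gt2 : 2 < p) (q_ge2 : 2 <= q) (xB_ge0 : 0 <= xB)
  (d_continuous : continuous d) (e_continuous : continuous e)
  (sigma2_continuous : continuous sigma2)
  (first_moment :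
    (x%:E * ereal_sup
       [set `|drift_moment Ks 1 x u - (d u + e u / x)%:E| | u in [set: S]])%E
      @[x --> +oo] --> 0%E)
  (second_moment :
    ereal_sup [set `|drift_moment Ks 2 x u - (sigma2 u)%:E|%E | u in [set: S]]
      @[x --> +oo] --> 0%E)
  (d_centred : \int[pi0]_u d u = 0)
  (lambda_measurable : forall u, measurable_fun setT (lambda u : borel S -> R))
  (lambda_bounded : forall u, exists M, forall v, `|lambda u v| <= M)
  (lambda_continuous : forall u,
    ereal_sup [set (`|lambda u' v - lambda u v|)%:E | v in [set: S]]
      @[u' --> u] --> 0%E)
  (drift_limit :
    ereal_sup [set `|conditional_drift L x uv.1 uv.2
                     - (lambda uv.1 uv.2)%:E|%E | uv in [set: S * S]]
      @[x --> +oo] --> 0%E)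
  (psi_continuous : continuous psi)
  (psi_poisson : forall u, \int[K u]_v (psi u - psi v) = d u) :
  (forall theta, 0 < theta ->
    delta_tilde K pi0 Gamma e sigma2 lambda psi theta < 0 ->
    forall s, 0 <= s -> s < Num.min theta (Num.min (p / 2) (q / 2)) ->
    exists2 r1, 0 <= r1 &
      forall (dO : measure_display) (Omega : measurableType dO)
        (P : probability Omega R) (F : nat -> set (set Omega))
        (x0 : R) (u0 : S) (xi : nat -> Omega -> strip R S),
        half_strip_process P F Ks (x0, u0) xi ->
        non_confined P xi ->
        moment_bounds P xi F p q xB Bp Bq ->
        forall r, r1 <= r -> (passage_moment P xi r s < +oo)%E)
  /\
  (forall theta, 0 < theta -> theta <= Num.min (p / 2) (q / 2) ->
    0 < delta_tilde K pi0 Gamma e sigma2 lambda psi theta ->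
    forall s r, theta < s -> 0 <= r ->
    exists2 r1, r < r1 &
      forall (dO : measure_display) (Omega : measurableType dO)
        (P : probability Omega R) (F : nat -> set (set Omega))
        (x0 : R) (u0 : S) (xi : nat -> Omega -> strip R S),
        half_strip_process P F Ks (x0, u0) xi ->
        non_confined P xi ->
        moment_bounds P xi F p q xB Bp Bq ->
        r1 < x0 -> passage_moment P xi r s = +oo%E).
Proof.
pose b := Num.max Bp 0.
have mG := @measurable_reachable R S Ks p xB b.
have key theta eps (eps0 : 0 < eps) := @lyapunov_drift R S Ks L K Gamma p b d e sigma2
  lambda psi compact_S Ks_half_strip L_conditional K_continuous Gamma_continuous p_gt2
  asymptotic_markov e_continuous sigma2_continuous first_moment second_moment
  lambda_measurable lambda_bounded lambda_continuous drift_limit psi_continuous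
  psi_poisson theta pi0 pi0_invariant eps eps0.
split=> theta theta0.
- set delta := delta_tilde _ _ _ _ _ _ _ _ => delta0 s s0.
  rewrite !lt_min => /and3P[s_theta s_p _].
  (* An error of half of |delta| leaves a drift of at most delta / 2, which is minus the error
     itself. *)
  have eps0 : 0 < - delta / 2 by rewrite divr_gt0// oppr_gt0.
  have [Z [c [B [x1 [mZ B0 x11 Zabs step]]]]] := key theta _ eps0.
  (* The tail is estimated with this exponent; it exceeds [s] strictly, which makes the moment of
     order [s] summable. *)
  pose s' := Num.min theta (p / 2).
  have s'0 : 0 < s' by rewrite lt_min theta0 (le_lt_trans s0 s_p).
  have ss' : s < s' by rewrite lt_min s_theta s_p.
  have s'p : 2 * s' <= p.
    by rewrite mulrC -ler_pdivlMr// ge_min lexx orbT.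
  have s'theta : s' <= theta by rewrite ge_min lexx.
  have [||r1 r10 upper] := survival_upper xB (b := b) Ks_half_strip p_gt2 eps0 x11 mZ
      B0 Zabs _ s'0 s'theta s'p.
  + by move=> z gz zx; have [] := step z gz zx.
  + move=> z gz zx; have [_ _ _ _] := step z gz zx.
    by rewrite -/delta ler_norml => /andP[_]; lra.
  exists r1 => // dO Omega P F x0 u0 xi hp _ hm r r1r.
  (* For [s = 0] the integrand is the constant 1, also where the passage time is infinite. *)
  have [s_eq0|s_neq0] := eqVneq s 0.
    rewrite /passage_moment s_eq0 (_ : (fun w => _) = cst 1%E); last first.
      by apply/funext => w; rewrite poweRe0.
    by rewrite integral_cst// [X in (_ * X)%E]probability_setT mule1 ltry.
  have sure_good n := sure_reachable hp hm n.
  have [k k0 kbound] := upper r r1r.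
  apply: (@passage_moment_lty _ _ _ _ _ _ _ _ _ hp r s s' (k * Z (x0, u0) `^ (2 * s'))).
  + by rewrite lt_neqAle eq_sym s_neq0 s0.
  + by rewrite mulr_ge0// powR_ge0.
  + move=> n; rewrite (alive_reachable hp r n mG sure_good) lee_fin.
    have [Cz|nCz] := pselect ((above r `&` reachable Ks p xB b) (x0, u0)).
      exact: kbound.
    by rewrite survival_out// !mulr_ge0// powR_ge0.
- rewrite le_min => /andP[theta_p _].
  set delta := delta_tilde _ _ _ _ _ _ _ _ => delta0 s r theta_s r0.
  have eps0 : 0 < delta / 2 by rewrite divr_gt0.
  have [Z [c [B [x1 [mZ B0 x11 Zabs step]]]]] := key theta _ eps0.
  have tp : 2 * theta <= p by rewrite mulrC -ler_pdivlMr.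
  have [||r0' r0'0 lower] := survival_lower xB (b := b) Ks_half_strip p_gt2 eps0
      theta0 x11 mZ B0 Zabs _ tp.
  + by move=> z gz zx; have [] := step z gz zx.
  + move=> z gz zx; have [_ _ _ _] := step z gz zx.
    by rewrite -/delta ler_norml => /andP[]; lra.
  (* The estimate is available only at high levels; surviving above [r'] implies surviving above
     [r]. *)
  pose r' := Num.max r r0'; have rr' : r <= r' by rewrite le_max lexx.
  have r'0 : 0 <= r' by exact: le_trans rr'.
  have r0r' : r0' <= r' by rewrite le_max lexx orbT.
  have [k k0 kbound] := lower r' r0r'.
  have Hp : half_strip ((0, point) : strip R S) by split => //; rewrite /Rplus /=.
  have c0 : 0 <= c by have [_] := Zabs _ Hp; exact: le_trans.
  (* Z differs from the abscissa by at most [c], so a start beyond this point has Z > r' + c, which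
     makes the gap [g] positive. *)
  exists (r' + 2 * c + 1); first by clear -rr' c0; lra.
  move=> dO Omega P F x0 u0 xi hp _ hm x0_large.
  have sure_good n := sure_reachable hp hm n.
  have good0 : reachable Ks p xB b (x0, u0) by exact: (sure_init hp mG (sure_good 0%N)).
  have Cz : (above r' `&` reachable Ks p xB b) (x0, u0).
    by split => //; rewrite /above /=; clear -x0_large c0; lra.
  have Z0 : r' + c < Z (x0, u0).
    have [_] := Zabs _ (reachable_half_strip good0); rewrite ler_norml /= => /andP[h _].
    by clear -h x0_large; lra.
  have rc0 : 0 <= r' + c by rewrite addr_ge0.
  have nu0 : 0 < 2 * theta by rewrite mulr_gt0.
  pose g := Z (x0, u0) `^ (2 * theta) - (r' + c) `^ (2 * theta).
  have g0 : 0 < g.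
    by rewrite subr_gt0 gt0_ltr_powR ?nnegrE// ltW// (le_lt_trans rc0).
  (* For m at least the initial value of Z, the truncation at 4 m does not affect that value; the
     factor [4]^ (2 * theta)[comes from the normalisation by](4 * m) [^ (2 * theta)]. *)
  apply: (@passage_moment_infinite _ _ _ _ _ _ _ _ _ hp r s (2 * theta) k
    (2^-1 * (g / 4 `^ (2 * theta))) (Z (x0, u0))) => //.
  + by rewrite mulr_gt0 ?invr_gt0// divr_gt0// powR_gt0.
  + exact: ltW.
  + by rewrite ltr_pM2l.
  move=> m N Zm Nm; have m0 : 0 < m by rewrite (lt_le_trans _ Zm)// (le_lt_trans rc0).
  apply: (@le_trans _ _ (P (stay xi (above r') N))); last first.
    apply: le_measure; rewrite ?inE; try by apply: (measurable_alive hp).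
    by move=> w h i iN; apply: le_lt_trans rr' (h i iN).
  rewrite (alive_reachable hp r' N mG sure_good) lee_fin.
  apply: le_trans (kbound m N _ m0 _ Nm Cz); last first.
    exact: le_trans (ltW Z0) Zm.
  rewrite (_ : Num.min (Z (x0, u0)) (4 * m) = Z (x0, u0)); last first.
    by apply/min_idPl; rewrite (le_trans Zm)// ler_peMl ?(ltW m0)// ler1n.
  rewrite powRM ?(ltW m0)// -/g invfM; apply: eq_ler; ring.
Qed.
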